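(* Let $\mathcal E:=\{7,9,11,15,19,23,25,27,31,35,39,49,51,63,91\}$. Then, for every integer $n\ge4$, $$f(n)=\begin{cases}U(n)-2,& n\in\{15,27\},\\ U(n)-1,& n\in\mathcal E\setminus\{15,27\},\\ U(n),& n\notin\mathcal E.\end{cases}$$
   Context: For a positive integer $n$, the Farey sequence of order $n$ is $\mathcal F_n=(a_0/b_0,a_1/b_1,\dots)$, the increasing sequence of all reduced fractions $a/b\in[0,1]$ with $1\le b\le n$ (including $0=0/1$ and $1=1/1$); $|\mathcal F_n|$ is its number of terms, indexed from $0$ to $|\mathcal F_n|-1$. For $n\ge4$ define $$f(n):=\min\{\,j-i-1:\ 0\le i<j<|\mathcal F_n|,\ (a_j-a_i)(b_j-b_i)<0\,\}.$$ For an integer $n\ge4$, write $n=4m+r$ with $m\ge1$ and $r\in\{0,1,2,3\}$, and define $U(n):=m+1$ if $r=0$, $U(n):=m+2$ if $r\in\{1,2\}$, and $U(n):=m+4$ if $r=3$. *)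

(* Defs.v *)
From HB Require Import structures.
From mathcomp Require Import all_boot all_order all_algebra.
Set Implicit Arguments.
Unset Strict Implicit.
Unset Printing Implicit Defensive.
Import Order.TTheory GRing.Theory Num.Theory.
Local Open Scope ring_scope.

(* The terms are rationals, so the reduced form a/b of a term x is             *)
(* (numq x)/(denq x).                                                          *)
Definition farey (n : nat) : seq rat :=
  sort <=%R (undup [seq a%:R / b%:R | b <- iota 1 n, a <- iota 0 b.+1]).

Lemma mem_farey (n : nat) (x : rat) :
  (x \in farey n) = [&& 0 <= x, x <= 1 & denq x <= n%:Z].
Proof.
rewrite mem_sort mem_undup; apply/allpairsPdep/idP => [[b [a []]]|].
  rewrite !mem_iota add1n add0n !ltnS => /andP[b_gt0 le_bn] /= le_ab ->.
  have b_gt0' : (0 : rat) < b%:R by rewrite ltr0n.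
  rewrite divr_ge0 ?ler0n //= ler_pdivrMr // mul1r ler_nat le_ab /=.
  have -> : (a%:R / b%:R : rat) = fracq (a%:Z, b%:Z) by rewrite fracqE.
  rewrite den_fracq /= -lt0n b_gt0 lez_nat.
  exact: leq_trans (leq_div _ _) le_bn.
case/and3P=> x_ge0 x_le1 le_dn.
have := divq_num_den x; have := denq_gt0 x; move: x_le1 le_dn x_ge0.
rewrite -numq_ge0; case: (denq x) (numq x) => [b|//] [a|//] x_le1 le_bn _ b_gt0 def_x.
exists b, a; rewrite !mem_iota add1n add0n !ltnS /= -def_x.
split=> //; first exact/andP.
by move: x_le1; rewrite -def_x ler_pdivrMr ?ltr0n // mul1r ler_nat.
Qed.

Lemma farey_sorted (n : nat) : sorted <%R (farey n).
Proof. by rewrite sort_lt_sorted undup_uniq. Qed.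

Definition fnum (n i : nat) : int := numq (farey n)`_i.
Definition fden (n i : nat) : int := denq (farey n)`_i.

Definition discordant (n i j : nat) : bool :=
  (i < j)%N && ((fnum n j - fnum n i) * (fden n j - fden n i) < 0).

(* The default value size (farey n) exceeds every gap j - i - 1, so it does    *)
(* not affect the minimum as soon as a discordant pair exists (see             *)
(* farey_gap_attained and farey_gap_le).                                       *)
Definition farey_gap (n : nat) : nat :=
  \big[minn/size (farey n)]_(ij : 'I_(size (farey n)) * 'I_(size (farey n))
                             | discordant n ij.1 ij.2) (ij.2 - ij.1 - 1)%N.

Lemma farey_gap_le (n i j : nat) :
  (j < size (farey n))%N -> discordant n i j -> (farey_gap n <= j - i - 1)%N.
Proof.
move=> ltj dij; have lti : (i < size (farey n))%N.
  by case/andP: dij => /ltn_trans-> .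
rewrite /farey_gap.
have := mem_index_enum (Ordinal lti, Ordinal ltj).
elim: (index_enum _) => //= ij s IHs; rewrite inE big_cons => /predU1P[<- /=|/IHs le_s].
  by rewrite dij geq_minl.
by case: ifP => // _; rewrite geq_min le_s orbT.
Qed.

Lemma farey_gap_attained (n : nat) : (4 <= n)%N ->
  exists i j, [/\ (j < size (farey n))%N, discordant n i j
                & farey_gap n = (j - i - 1)%N].
Proof.
move=> n_ge4.
pose x : rat := 1%:R / 4%:R; pose y : rat := 2%:R / 3%:R.
have dx : denq x = 4 by [].
have dy : denq y = 3 by [].
have Fx : x \in farey n by rewrite mem_farey dx.
have Fy : y \in farey n by rewrite mem_farey dy; apply: (ltn_trans _ n_ge4).
have d0 : discordant n (index x (farey n)) (index y (farey n)).
  rewrite /discordant /fnum /fden !nth_index // andbT.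
  by rewrite -(lt_sorted_ltn_nth 0 (farey_sorted n)) ?inE ?index_mem ?nth_index.
have lt0 : (index y (farey n) < size (farey n))%N by rewrite index_mem.
have lt_gap : (farey_gap n < size (farey n))%N.
  apply: leq_ltn_trans (farey_gap_le lt0 d0) _.
  by rewrite -subnDA; apply: leq_ltn_trans (leq_subr _ _) lt0.
move: lt_gap; rewrite /farey_gap.
elim/big_ind: _ => [|k l IHk IHl|[i j] /= dij _]; first by rewrite ltnn.
  by rewrite /minn; case: ifP.
by exists i, j; split.
Qed.

Definition U (n : nat) : nat :=
  let m := (n %/ 4)%N in
  match (n %% 4)%N with
  | 0 => m + 1
  | 1 | 2 => m + 2
  | _ => m + 4
  end%N.

Definition exceptional : seq nat :=
  [:: 7; 9; 11; 15; 19; 23; 25; 27; 31; 35; 39; 49; 51; 63; 91]%N.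

(* Main.v *)
(* If a/b < c/d is discordant then c >= a + 1 and d <= b - 1, so with xi = a/b and b <= n the window
   (xi, (n xi + 1)/(n - 1)) lies below c/d. For n >= 92 it is shown that this window already contains
   U(n) reduced fractions of order n, unless b = 2a + 1 or b = 2a + 2. In these two cases the pair
   encloses 1/2, and the fractions x/y between a/b and c/d with |2x - y| <= 1 suffice. Conversely,
   for (2m-1)/4m < 2m/(4m-1) (if n = 4m) and 2m/(4m+1) < (2m+1)/4m (otherwise) these are all the
   fractions in between, and their number is U(n).

   The window count is a count of primitive points in a triangle. A linear change of variables turns
   the window into a plane strip that a three-distance argument shows to be of width W with
   3 W^2 <= 4 N along some primitive direction (p, s); the primitive points on the t-th line parallel
   to it correspond to integers coprime to t in an interval. For W < 450 the counts per line are
   bounded by tables of the discrepancy of the residues coprime to t, for larger W by a sieve. Moderate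
   orders (n < 1350 away from large xi) are covered by a grid: for n0 <= n <= n1 it suffices to
   find, after each Farey fraction u of order n0, enough fractions of order n0 in the window of n1. For
   n < 92 the Farey sequence is computed. *)
Require Import Defs.
From Stdlib Require Import ZArith.
From mathcomp Require Import all_boot all_order all_algebra.
From mathcomp Require Import zify ring lra.
From mathcomp Require Import ssrZ.
Set Implicit Arguments. Unset Strict Implicit. Unset Printing Implicit Defensive.
Import Order.TTheory GRing.Theory Num.Theory.
Local Open Scope ring_scope.
Delimit Scope Z_scope with bZ.

(** * Lattice points of a strip, line by line *)

(** With [N = n + n * xi] the triangle has area [N / 2], so it should contain about
    [3 * N / pi ^ 2], roughly [0.304 * N], primitive points, while [n / 4 + 13 / 4] suffice. All
    errors must fit into a slack of about a fifth of the requirement, and this slack is smallest for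
    small [xi]: hence the treatment by slope for moderate orders. The obstacle is that the triangle
    is thin. A count line by line loses a few points on every line, so it is useless unless the
    triangle meets only [O(sqrt N)] lines; this is what the direction [(p, s)] achieves. Conversely
    the width bound makes [N] at least quadratic in the number of lines, so an inequality checked at
    the least [N] that a width allows holds for all larger [N]. The fraction [1/2] can lie in the
    window only if [b] is [2 * a + 1] or [2 * a + 2], which is where these two cases come from. *)

Definition line_bound (w e : rat) (t : nat) : Prop :=
  forall x y : rat, 0 <= x -> x <= y ->
  exists ks : seq nat, [/\ uniq ks,
    all (fun k => [&& coprime k t, x < k%:R & k%:R < y]) ks &
    w * (y - x) - e <= (size ks)%:R].

Definition hat (b : rat) (t : nat) : rat := if t%:R <= b then 1 - t%:R / b else 0.

(* A fraction [x / y] is stored as [(x, x + y)]. With [c = n * xi] and [N = n + c], these are the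
   reduced fractions in the window [(xi, (n * xi + 1) / (n - 1))] with denominator below [n]. *)
Definition in_window (N c : rat) (z : int * int) : bool :=
  [&& coprimez z.1 z.2, c * z.2%:~R < z.1%:~R * N, z.1%:~R * N < (c + 1) * z.2%:~R
    & z.2%:~R < N].

(* The points [(x, s')] of the window with [s * x - p * s' = eps * t] lie on a line on which they
   form an interval of length [N / s * (hat be t - hat al t)], indexed by integers coprime to [t]. *)
Lemma side_points (N c al be : rat) (p s e f eps : int) (w er : nat -> rat) (T : nat) :
  0 < N -> 0 < s -> 0 <= e -> p * e - s * f = eps -> (eps == 1) || (eps == -1) ->
  (eps = 1 -> be = s%:~R * c - p%:~R * N + s%:~R) ->
  (eps = -1 -> be = p%:~R * N - s%:~R * c) ->
  al = be - s%:~R -> 0 < be -> T%:R <= be ->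
  (forall t, (0 < t <= T)%N -> line_bound (w t) (er t) t) ->
  exists L : seq (int * int), [/\ uniq L,
    all (fun z => in_window N c z && (0 < eps * (s * z.1 - p * z.2) <= T%:Z)) L &
    \sum_(1 <= t < T.+1) (w t * (N / s%:~R * (hat be t - hat al t)) - er t)
      <= (size L)%:R].
Proof.
move=> N_gt0 s_gt0 e_ge0 bez epsP be1 be2 def_al be_gt0.
elim: T => [|T IHT] leT lineP.
  by exists [::]; rewrite big_geq.
have{IHT} [||L [uL aL szL]] := IHT.
- by apply: le_trans leT; rewrite ler_nat.
- by move=> t /andP[t0 tT]; apply: lineP; rewrite t0 leqW.
set t := T.+1 in leT *.
have t_gt0 : (0 : rat) < t%:R by rewrite ltr0n.
have sr_gt0 : (0 : rat) < s%:~R by rewrite ltr0z.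
have er_ge0 : (0 : rat) <= e%:~R by rewrite ler0z.
(* The [k]-th point on the [t]-th line is [(k * p - t * f, k * s - t * e)]. One side of the window
   says that its second coordinate exceeds [N * t / be], which is [x < k]; the other side and the
   bound [N] on this coordinate follow from [k < y] by [hy]. *)
pose x := (N * t%:R / be + t%:R * e%:~R) / s%:~R.
pose y := x + N / s%:~R * (hat be t - hat al t).
have hbe : hat be t = 1 - t%:R / be by rewrite /hat leT.
have x_ge0 : 0 <= x.
  by rewrite !(divr_ge0, addr_ge0, mulr_ge0) // ltW.
have [hy le_xy] : (y <= (N + t%:R * e%:~R) / s%:~R /\
   (0 < al -> y <= (N * t%:R / al + t%:R * e%:~R) / s%:~R)) /\ x <= y.
  have hat_ge0 : 0 <= hat al t.
    rewrite /hat; case: ifP => // letal; rewrite subr_ge0 ler_pdivrMr ?mul1r //.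
    exact: lt_le_trans t_gt0 letal.
  have ye : y = (N + t%:R * e%:~R) / s%:~R - N / s%:~R * hat al t.
    by rewrite /y hbe /x; field; rewrite !gt_eqF.
  have hN : 0 <= N / s%:~R * hat al t by rewrite mulr_ge0 // divr_ge0 // ltW.
  split; first split.
  - by rewrite ye lerBlDr lerDl.
  - move=> al_gt0; have h : N - N * hat al t <= N * t%:R / al.
      rewrite /hat; case: ifP => [_|/negbT].
        by rewrite mulrBr mulr1 opprB addrC subrK mulrA.
      rewrite -ltNge mulr0 subr0 => lt_al; rewrite ler_pdivlMr // ler_pM2l //.
      exact: ltW.
    have -> : y = (N - N * hat al t + t%:R * e%:~R) / s%:~R by rewrite ye; ring.
    by rewrite ler_pM2r ?invr_gt0 // lerD2r.
  - rewrite /y lerDl mulr_ge0 ?divr_ge0 ?(ltW N_gt0) ?(ltW sr_gt0) // subr_ge0 hbe.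
    rewrite /hat; case: ifP => [letal|_]; last first.
      by rewrite subr_ge0 ler_pdivrMr // mul1r.
    rewrite lerD2l lerN2 ler_pM2l // lef_pV2 ?qualifE /= ?(lt_le_trans t_gt0) //.
    by rewrite def_al gerBl ltW.
have [|ks [uks aks szks]] := lineP t _ x y x_ge0 le_xy; first by rewrite /t ltnSn.
pose pt (k : nat) : int * int := (k%:Z * p - t%:Z * f, k%:Z * s - t%:Z * e).
have tval k : eps * (s * (pt k).1 - p * (pt k).2) = t%:Z.
  have -> : s * (pt k).1 - p * (pt k).2 = t%:Z * eps by rewrite -bez /=; ring.
  by case/orP: epsP => /eqP->; ring.
exists (L ++ map pt ks); split.
- rewrite cat_uniq uL /= map_inj_uniq ?uks ?andbT; last first.
    move=> k1 k2 [_ /addIr /eqP]; rewrite -subr_eq0 -mulrBl mulf_eq0 (gt_eqF s_gt0) orbF.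
    by rewrite subr_eq0 => /eqP[].
  apply/hasPn => z /mapP[k _ ->]; apply/negP => /(allP aL) /andP[_].
  by rewrite tval /t => /andP[_]; rewrite lez_nat ltnn.
- rewrite all_cat; apply/andP; split.
    apply: sub_all aL => z /andP[-> /andP[-> /= le_T]].
    by apply: le_trans le_T _; rewrite lez_nat /t.
  apply/allP => z /mapP[k /(allP aks) /and3P[co_kt lt_xk lt_ky] ->].
  rewrite tval lexx !andbT.
  have := tval k; rewrite /in_window.
  have eX : (pt k).1 = k%:Z * p - t%:Z * f by [].
  have eS : (pt k).2 = k%:Z * s - t%:Z * e by [].
  move: (pt k).1 (pt k).2 eX eS => X S eX eS tv.
  have Se : S%:~R = k%:R * s%:~R - t%:R * e%:~R :> rat.
    by rewrite eS rmorphB /= !rmorphM.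
  have tv' : (s%:~R * X%:~R - p%:~R * S%:~R) = eps%:~R * t%:R :> rat.
    have -> : t%:R = (t%:Z)%:~R :> rat by [].
    rewrite -tv -!rmorphM -!rmorphB /=; congr (_%:~R).
    by case/orP: epsP => /eqP->; ring.
  have kx : N * t%:R < be * S%:~R.
    rewrite Se; move: lt_xk; rewrite /x ltr_pdivrMr // => h.
    have : (N * t%:R / be) < k%:R * s%:~R - t%:R * e%:~R by lra.
    by rewrite ltr_pdivrMr // [be * _]mulrC.
  have kN : S%:~R < N.
    rewrite Se; have := lt_le_trans lt_ky (hy.1); rewrite ltr_pdivlMr //; lra.
  have S_gt0 : (0 : rat) < S%:~R.
    by rewrite -(pmulr_rgt0 _ be_gt0); apply: lt_trans kx; rewrite mulr_gt0.
  have ka : al * S%:~R < N * t%:R.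
    have [al_gt0|al_le0] := ltP 0 al; last first.
      apply: le_lt_trans (_ : 0 < _); last by rewrite mulr_gt0.
      by rewrite mulr_le0_ge0 // ltW.
    rewrite Se; have := lt_le_trans lt_ky (hy.2 al_gt0); rewrite ltr_pdivlMr // => h.
    have : k%:R * s%:~R - t%:R * e%:~R < N * t%:R / al by lra.
    by rewrite ltr_pdivlMr // [al * _]mulrC.
  rewrite /in_window /= kN andbT; apply/and3P; split.
  (* A common divisor of the coordinates divides [t] and [k], which are up to sign the coordinates
     of the point in the basis [(f, e)], [(p, s)] of determinant [eps]. *)
  + have hg : (gcdz X S %| t%:Z)%Z.
      by rewrite -tv dvdz_mull // rpredB // dvdz_mull // ?dvdz_gcdl ?dvdz_gcdr.
    have hk : (gcdz X S %| k%:Z)%Z.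
      have -> : k%:Z = eps * (e * X - f * S).
        rewrite eX eS; have -> : e * (k%:Z * p - t%:Z * f) - f * (k%:Z * s - t%:Z * e)
           = k%:Z * (p * e - s * f) by ring.
        by rewrite bez; case/orP: epsP => /eqP->; ring.
      by rewrite dvdz_mull // rpredB // dvdz_mull // ?dvdz_gcdl ?dvdz_gcdr.
    have: (gcdz X S %| gcdz k t)%Z by rewrite dvdz_gcd hk.
    have -> : gcdz k t = 1 by rewrite /gcdz !absz_nat (eqP co_kt).
    by rewrite dvdz1.
  + have E : s%:~R * (X%:~R * N - c * S%:~R)
       = N * (eps%:~R * t%:R) + S%:~R * (p%:~R * N - s%:~R * c) by rewrite -tv'; ring.
    rewrite -subr_gt0 -(pmulr_rgt0 _ sr_gt0) E.
    case/orP: epsP => /eqP ee; [have:= be1 ee|have := be2 ee] => hb; rewrite ee; nra.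
  + have E : s%:~R * ((c + 1) * S%:~R - X%:~R * N)
       = S%:~R * (s%:~R * c - p%:~R * N + s%:~R) - N * (eps%:~R * t%:R) by rewrite -tv'; ring.
    rewrite -subr_gt0 -(pmulr_rgt0 _ sr_gt0) E.
    case/orP: epsP => /eqP ee; [have:= be1 ee|have := be2 ee] => hb; rewrite ee; nra.
- rewrite big_nat_recr //= size_cat size_map natrD lerD //.
  by move: szks; rewrite /y addrAC subrr add0r.
Qed.

(** * Integers coprime to [t] in an interval *)

Definition coprime_count (t k : nat) : nat := count (coprime^~ t) (iota 1 k).

Lemma coprime_countD t m k :
  coprime_count t (m + k) = (coprime_count t m + count (coprime^~ t) (iota m.+1 k))%N.
Proof. by rewrite /coprime_count iotaD count_cat add1n. Qed.

Lemma coprime_count_period t k :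
  coprime_count t (t + k) = (coprime_count t t + coprime_count t k)%N.
Proof.
rewrite coprime_countD; congr (_ + _)%N; rewrite -addn1 iotaDl count_map.
by apply: eq_count => i /=; rewrite coprime_sym /coprime gcdnDl gcdnC.
Qed.

Lemma open_interval (x y : rat) : 0 <= x -> x <= y ->
  exists X m : nat, [/\ forall k, (k \in iota X.+1 m) -> x < k%:R < y,
    y - x <= m%:R + 1 & (0 < m)%N -> m%:R - 1 <= y - x].
Proof.
move=> x_ge0 le_xy; have [lx ux] := andP (truncn_itv x_ge0).
set X := Num.truncn x in lx ux.
have y_ge0 : 0 <= y by apply: le_trans le_xy.
pose Y := `|Num.ceil y|%N.
have YE : Y%:R = (Num.ceil y)%:~R :> rat.
  rewrite /Y natr_absz ger0_norm //; rewrite -(ler_int rat).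
  by apply: le_trans (ceil_ge _).
have [lY uY] : Y%:R - 1 < y /\ y <= Y%:R.
  by have /andP[] := ceil_itv y; rewrite YE rmorphB.
exists X, (Y.-1 - X)%N; split.
- move=> k; rewrite mem_iota => /andP[lk uk].
  have -> /= : x < k%:R by apply: lt_le_trans ux _; rewrite ler_nat.
  have kY : (k.+1 <= Y)%N by lia.
  apply: le_lt_trans lY; have : (k.+1%:R : rat) <= Y%:R by rewrite ler_nat.
  by rewrite -natr1; lra.
- have : (Y <= (Y.-1 - X) + 1 + X)%N by lia.
  by rewrite -(ler_nat rat) !natrD; lra.
- move=> m0; have : ((Y.-1 - X) + X.+1 <= Y)%N by lia.
  rewrite -(ler_nat rat) natrD; move: ux; rewrite -natr1; lra.
Qed.

(** The interval contains a run of at least [y - x - 1] consecutive integers. The missing unit costs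
    the term [coprime_count t t] of the error, and the deviation of the run from the mean density
    costs [del]. *)
Lemma line_bound_discrepancy (t : nat) (w e : rat) (del : int) :
  (0 < t)%N -> 0 <= w ->
  (forall X m : nat, (coprime_count t t)%:Z * m%:Z - del <=
     t%:Z * (count (coprime^~ t) (iota X.+1 m))%:Z) ->
  w * t%:R <= (coprime_count t t)%:R ->
  (coprime_count t t)%:R + del%:~R <= e * t%:R ->
  line_bound w e t.
Proof.
move=> t_gt0 w_ge0 discP wP eP x y x0 lexy.
have [X [m [mP myx _]]] := open_interval x0 lexy.
exists [seq k <- iota X.+1 m | coprime k t]; split.
- by rewrite filter_uniq ?iota_uniq.
- apply/allP => k; rewrite mem_filter => /andP[-> /mP/andP[-> ->]] //.
rewrite size_filter; have := discP X m; rewrite -(ler_int rat) rmorphB !rmorphM /=.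
set c := count _ _; set phi := coprime_count t t in wP eP * => h.
have tr_gt0 : (0 : rat) < t%:R by rewrite ltr0n.
rewrite -(ler_pM2l tr_gt0); apply: le_trans h.
have phi_ge0 : (0 : rat) <= phi%:R by rewrite ler0n.
have m_ge0 : (0 : rat) <= m%:R by rewrite ler0n.
have : w * (y - x) * t%:R <= phi%:R * (m%:R + 1).
  rewrite mulrAC; apply: ler_pM => //; last by rewrite subr_ge0.
  by rewrite mulr_ge0 // ltW.
rewrite -!pmulrn; lra.
Qed.

Definition weight_scale : Z := Eval vm_compute in Z.pow 2 14.

Fixpoint coprime_flags (fuel : nat) (i t : Z) : seq bool :=
  if fuel is f.+1 then Z.eqb (Z.gcd i t) 1 :: coprime_flags f (Z.succ i) t else [::].

(** Spread between the largest and the smallest value of the walk that adds [t - phi] at integers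
    coprime to [t] and [- phi] elsewhere. A run of consecutive integers is the difference of two
    values of the walk, so the spread bounds its deficit. *)
Fixpoint discrepancy (t phi : Z) (fl : seq bool) (d lo hi : Z) : Z :=
  match fl with
  | [::] => Z.sub hi lo
  | b :: fl' => let d' := (Z.add d (if b then Z.sub t phi else Z.opp phi)) in
      discrepancy t phi fl' d' (Z.min lo d') (Z.max hi d')
  end.

(* Slope and error, in units of [1 / weight_scale], of a lower bound for the number of integers
   coprime to [t] in an interval. *)
Definition line_weight (t : Z) : Z * Z :=
  let fl := coprime_flags (Z.to_nat t) 1 t in
  let phi := foldr (fun b c => if b then Z.succ c else c) Z0 fl in
  let del := discrepancy t phi fl 0 0 0 in
  (Z.div (Z.mul weight_scale phi) t,
   Z.succ (Z.div (Z.mul weight_scale (Z.add phi del)) t)).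

Lemma coprime_flagsE f i t :
  coprime_flags f (Z.of_nat i) (Z.of_nat t) = [seq coprime k t | k <- iota i f].
Proof.
elim: f i => //= f IHf i; rewrite -IHf; congr (_ :: coprime_flags _ _ _).
  lia.
lia.
Qed.

Lemma discrepancyP (t phi : Z) fl d lo hi : (lo <= d <= hi)%bZ ->
  exists lo' hi', [/\ discrepancy t phi fl d lo hi = (hi' - lo')%bZ,
    (lo' <= lo)%bZ, (hi <= hi')%bZ &
    forall k, (k <= size fl)%N ->
    (lo' <= d + t * Z.of_nat (count id (take k fl)) - phi * Z.of_nat k <= hi')%bZ].
Proof.
elim: fl d lo hi => [|b fl IHfl] d lo hi hd.
  exists lo, hi; split=> // [||k]; try lia.
  by rewrite leqn0 => /eqP-> /=; lia.
rewrite [discrepancy _ _ _ _ _ _]/=; set d' := (d + _)%bZ.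
have [|lo' [hi' [-> h1 h2 h3]]] := IHfl d' (Z.min lo d') (Z.max hi d'); first lia.
exists lo', hi'; split=> //; try lia; case=> [_|k /h3 {h1 h2 h3 IHfl}]; first by rewrite take0 /=; lia.
have -> : count id (take k.+1 (b :: fl)) = (b + count id (take k fl))%N by [].
by rewrite {}/d'; case: b => /= h; lia.
Qed.

(* Opaque, since the unary integer behind [int_of_Z z] must never be computed. *)
Lemma ratZ_spec : {f : Z -> rat | forall z, f z = (int_of_Z z)%:~R}.
Proof. by exists (fun z => (int_of_Z z)%:~R). Qed.

Definition ratZ : Z -> rat := sval ratZ_spec.

Lemma ratZ_int z : ratZ z = (int_of_Z z)%:~R.
Proof. exact: (svalP ratZ_spec). Qed.

Lemma ratZD x y : ratZ (Z.add x y) = ratZ x + ratZ y.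
Proof. by rewrite !ratZ_int -[Z.add x y]/(x + y) !rmorphD. Qed.

Lemma ratZM x y : ratZ (Z.mul x y) = ratZ x * ratZ y.
Proof. by rewrite !ratZ_int -[Z.mul x y]/(x * y) !rmorphM. Qed.

Lemma ratZB x y : ratZ (Z.sub x y) = ratZ x - ratZ y.
Proof. by rewrite !ratZ_int -[Z.sub x y]/(x - y) !rmorphB. Qed.

Lemma ratZ_nat n : ratZ (Z.of_nat n) = n%:R.
Proof. by rewrite ratZ_int (_ : int_of_Z _ = n) //; lia. Qed.

Lemma le_ratZ x y : (ratZ x <= ratZ y) = Z.leb x y.
Proof. by rewrite !ratZ_int ler_int; lia. Qed.

Lemma lt_ratZ x y : (ratZ x < ratZ y) = Z.ltb x y.
Proof. by rewrite !ratZ_int ltr_int; lia. Qed.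

Lemma ratZ0 : 0 = ratZ Z0.
Proof. by rewrite ratZ_int. Qed.

Lemma line_weightP (t : nat) : (0 < t)%N ->
  let we := line_weight (Z.of_nat t) in
  Z.le 0 we.1 /\ line_bound (ratZ we.1 / ratZ weight_scale) (ratZ we.2 / ratZ weight_scale) t.
Proof.
move=> t_gt0; rewrite /line_weight; set fl := coprime_flags _ _ _.
have flE : fl = [seq coprime k t | k <- iota 1 t].
  by rewrite /fl Nat2Z.id; exact: (coprime_flagsE t 1 t).
set phi := foldr _ _ _; have phiE : phi = Z.of_nat (coprime_count t t).
  rewrite /phi flE /coprime_count; elim: (iota _ _) => //= k s ->.
  by case: (coprime k t); lia.
have szfl : size fl = t by rewrite flE size_map size_iota.
have [//|lo [hi [-> h1 h2 dP]]] := @discrepancyP (Z.of_nat t) phi fl 0 0 0.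
have cE k : (k <= t)%N -> count id (take k fl) = coprime_count t k.
  by move=> le_kt; rewrite flE -map_take take_iota (minn_idPl le_kt) count_map.
(* Over a full period the walk returns to 0, so the bounds for [k <= t] extend to all [k] by
   induction on the number of periods. *)
have dP' k : Z.le lo (Z.of_nat t * Z.of_nat (coprime_count t k) - phi * Z.of_nat k) /\
    Z.le (Z.of_nat t * Z.of_nat (coprime_count t k) - phi * Z.of_nat k) hi.
  have [q] := ubnP (k %/ t)%N; elim: q k => // q IHq k lt_kq.
  have [le_kt|lt_tk] := leqP k t.
    by have := dP k; rewrite szfl cE // => /(_ le_kt); lia.
  have kE : k = (t + (k - t))%N by rewrite subnKC // ltnW.
  have ck : coprime_count t k = (coprime_count t t + coprime_count t (k - t))%N.
    by rewrite {1}kE coprime_count_period.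
  have dk : (k %/ t = ((k - t) %/ t).+1)%N.
    by rewrite {1}kE divnDl ?dvdnn // divnn t_gt0.
  have := IHq (k - t)%N; rewrite -ltnS -dk ck phiE => /(_ lt_kq).
  have : Z.of_nat k = Z.add (Z.of_nat t) (Z.of_nat (k - t)) by lia.
  move: (Z.of_nat k) (k - t)%N => K k' ->; rewrite Nat2Z.inj_add.
  move: (Z.of_nat (coprime_count t t)) (Z.of_nat (coprime_count t k')) => a b.
  by rewrite /GRing.add /GRing.opp /GRing.mul /=; lia.
have M_gt0 : 0 < ratZ weight_scale by rewrite ratZ0 lt_ratZ.
have t_gt0' : (0 : rat) < t%:R by rewrite ltr0n.
have phi_ge0 : Z.le 0 phi by rewrite phiE; lia.
have tZ_gt0 : Z.lt 0 (Z.of_nat t) by lia.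
have Mphi_ge0 : Z.le 0 (Z.mul weight_scale phi).
  by apply: Z.mul_nonneg_nonneg; last exact: phi_ge0; rewrite /weight_scale; lia.
rewrite /=; set w := Z.div _ _; set e := Z.succ _.
have w_ge0 : Z.le 0 w := Z.div_pos _ _ Mphi_ge0 tZ_gt0.
have wP : Z.le (Z.mul (Z.of_nat t) w) (Z.mul weight_scale phi) := Z.mul_div_le _ _ tZ_gt0.
have eP : Z.lt (Z.mul weight_scale (Z.add phi (Z.sub hi lo))) (Z.mul (Z.of_nat t) e).
  exact: Z.mul_succ_div_gt.
clearbody w e; split; first exact: w_ge0.
move: weight_scale M_gt0 {Mphi_ge0} wP eP => M M_gt0 wP eP.
apply: (@line_bound_discrepancy _ _ _ (int_of_Z (Z.sub hi lo))) => //.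
- by apply: divr_ge0; [rewrite ratZ0 le_ratZ; apply/Z.leb_le | exact: ltW].
- move=> X m; have [a1 b1] := dP' X; have [a2 b2] := dP' (X + m)%N.
  by move: b1 a2; rewrite coprime_countD phiE; lia.
- rewrite mulrAC ler_pdivrMr // -!ratZ_nat -!ratZM le_ratZ -phiE; apply/Z.leb_le.
  by rewrite Z.mul_comm [Z.mul phi _]Z.mul_comm.
- rewrite mulrAC ler_pdivlMr // -!ratZ_nat -[(int_of_Z _)%:~R]ratZ_int -ratZD -!ratZM le_ratZ -phiE.
  apply/Z.leb_le; rewrite Z.mul_comm [Z.mul e _]Z.mul_comm.
  exact/Z.lt_le_incl.
Qed.

(* Removing the multiples of all [d > 1] coprime to [6], prime or not, overcounts little and avoids
   any estimate on primes. *)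
Definition sieving (d : nat) : bool := (1 < d)%N && ((d \in [:: 2; 3]%N) || coprime d 6).

Lemma sieving_dvd_gcd (k t : nat) : (0 < t)%N -> ~~ coprime k t ->
  exists d, [/\ sieving d, (d %| t)%N & (d %| k)%N].
Proof.
move=> t_gt0 ncop; have g_gt1 : (1 < gcdn k t)%N.
  by rewrite ltn_neqAle eq_sym ncop gcdn_gt0 t_gt0 orbT.
exists (pdiv (gcdn k t)); have p_pr := pdiv_prime g_gt1.
have := pdiv_dvd (gcdn k t); rewrite dvdn_gcd => /andP[-> ->]; split=> //.
rewrite /sieving prime_gt1 //= !inE; have [//|/= n2] := eqVneq _ 2%N.
have [//|/= n3] := eqVneq _ 3%N.
by rewrite (coprimeMr _ 2 3) !prime_coprime // !dvdn_prime2 // n2 n3.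
Qed.

Lemma count_multiples (d X m : nat) : (0 < d)%N -> (0 < m)%N ->
  (count (dvdn d) (iota X.+1 m))%:R <= (m%:R - 1) / d%:R + 1 :> rat.
Proof.
move=> d_gt0 m_gt0; have d_gt0' : (0 : rat) < d%:R by rewrite ltr0n.
have cE n : count (dvdn d) (iota 1 n) = (n %/ d)%N.
  elim: n => [|n IHn]; first by rewrite div0n.
  by rewrite -{1}[n.+1]addn1 iotaD count_cat IHn /= addn0 add1n divnS // addnC.
have : (count (dvdn d) (iota X.+1 m) * d <= m.-1 + d)%N.
  have := cE (X + m)%N; rewrite iotaD count_cat add1n cE.
  set c := count _ _ => cE'.
  have := divn_eq (X + m) d; have := divn_eq X d; rewrite -cE'.
  have := ltn_pmod X d_gt0; have := ltn_pmod (X + m) d_gt0; nia.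
rewrite -(ler_nat rat) natrD natrM -subn1 natrB // => h.
by rewrite -lerBlDr ler_pdivlMr // mulrBl mul1r lerBlDr.
Qed.

(** Union bound: every integer of the run that is not coprime to [t] is a multiple of some sieving
    divisor [d] of [t], and a run of [m > 0] integers has at most [(m - 1) / d + 1] multiples of
    [d]. This is weaker than the tables but explicit for every [t]. *)
Lemma line_bound_sieve (t : nat) : (0 < t)%N ->
  line_bound (1 - \sum_(1 <= d < t.+1 | sieving d && (d %| t)%N) d%:R^-1)
    (1 + \sum_(1 <= d < t.+1 | sieving d && (d %| t)%N) 1) t.
Proof.
move=> t_gt0 x y x_ge0 le_xy.
have [X [m [mP myx mx]]] := open_interval x_ge0 le_xy.
exists [seq k <- iota X.+1 m | coprime k t]; split.
- by rewrite filter_uniq ?iota_uniq.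
- by apply/allP => k; rewrite mem_filter => /andP[-> /mP/andP[-> ->]].
rewrite size_filter.
have sz : (count (coprime^~ t) (iota X.+1 m) + count (predC (coprime^~ t)) (iota X.+1 m) = m)%N.
  by rewrite count_predC size_iota.
have {}sz : (count (coprime^~ t) (iota X.+1 m))%:R =
   m%:R - (count (predC (coprime^~ t)) (iota X.+1 m))%:R :> rat.
  by rewrite -[in m%:R]sz natrD addrK.
have nc : (count (predC (coprime^~ t)) (iota X.+1 m))%:R <=
   \sum_(1 <= d < t.+1 | sieving d && (d %| t)%N) ((y - x) / d%:R + 1).
  apply: le_trans (_ : \sum_(1 <= d < t.+1 | sieving d && (d %| t)%N)
      (count (dvdn d) (iota X.+1 m))%:R <= _).
    rewrite -natr_sum ler_nat.
    elim: (iota _ _) => //= k s IHs.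
    rewrite big_split /= leq_add //; case: (boolP (coprime k t)) => //= ncop.
    have [d [sd dt dk]] := sieving_dvd_gcd t_gt0 ncop.
    rewrite big_mkcond (bigD1_seq d) /= ?dk ?sd ?dt ?iota_uniq //.
    rewrite mem_index_iota ltnS (dvdn_leq t_gt0 dt) andbT.
    by case/andP: sd => /ltnW.
  have [m0|m_gt0] := posnP m.
    rewrite m0 /= big1 // sumr_ge0 // => d _.
    by rewrite addr_ge0 ?ler01 ?divr_ge0 ?subr_ge0 ?ler0n.
  rewrite big_seq_cond [leRHS]big_seq_cond; apply: ler_sum => d.
  rewrite mem_index_iota => /andP[/andP[d_gt0 _] _].
  apply: le_trans (count_multiples X d_gt0 m_gt0) _.
  by rewrite lerD2r ler_pM2r ?invr_gt0 ?ltr0n // mx.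
rewrite sz; move: nc; rewrite big_split /= -mulr_sumr.
set A := \sum_(_ <= d < _ | _) _^-1; set B := \sum_(_ <= d < _ | _) 1; lra.
Qed.

(** * Tables of line weights *)

Definition triple := (Z * Z * Z)%type.

Fixpoint prefix_sums (fuel : nat) (t : Z) (acc : triple) : seq triple :=
  acc :: if fuel is f.+1 then
    let we := line_weight (Z.succ t) in
    let: (F, G, E) := acc in
    prefix_sums f (Z.succ t)
      (Z.add F we.1, Z.add G (Z.mul (Z.succ t) we.1), Z.add E we.2)
  else [::].

Definition table_weight (t : nat) : rat := ratZ (line_weight (Z.of_nat t)).1.
Definition table_error (t : nat) : rat := ratZ (line_weight (Z.of_nat t)).2.

Definition prefix_ok (k : nat) (p : triple) : Prop :=
  [/\ ratZ p.1.1 = \sum_(1 <= t < k.+1) table_weight t,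
      ratZ p.1.2 = \sum_(1 <= t < k.+1) t%:R * table_weight t &
      ratZ p.2 = \sum_(1 <= t < k.+1) table_error t].

Lemma prefix_sumsP fuel t acc k p0 : prefix_ok t acc -> (k <= fuel)%N ->
  prefix_ok (t + k) (nth p0 (prefix_sums fuel (Z.of_nat t) acc) k).
Proof.
elim: fuel t acc k => [|f IHf] t [[F G] E] [|k] // [hF hG hE] le_k; rewrite ?addn0 //.
rewrite addnS -addSn [prefix_sums _ _ _]/= -Nat2Z.inj_succ; apply: IHf => //.
split; rewrite big_nat_recr //; cbn [fst snd]; rewrite /= in hF hG hE;
  rewrite ratZD ?ratZM ?hF ?hG ?hE //.
by rewrite -ratZ_nat.
Qed.

Lemma size_prefix_sums fuel t acc : size (prefix_sums fuel t acc) = fuel.+1.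
Proof. by elim: fuel t acc => [|f IHf] t [[F G] E] //=; rewrite IHf. Qed.

Fixpoint all_from (f : Z -> triple -> bool) (k : Z) (s : seq triple) : bool :=
  if s is p :: s' then f k p && all_from f (Z.succ k) s' else true.

Fixpoint all_near (m : nat) (f : Z -> triple -> Z -> triple -> bool) (k : Z) (s : seq triple) : bool :=
  if s is p :: s' then all_from (f k p) k (take m s) && all_near m f (Z.succ k) s' else true.

Lemma all_fromP f k s p0 i : all_from f (Z.of_nat k) s -> (i < size s)%N ->
  f (Z.of_nat (k + i)) (nth p0 s i).
Proof.
elim: s k i => // p s IHs k [|i] /= /andP[fk fs] lt_i; first by rewrite addn0.
by rewrite addnS -addSn; apply: IHs => //; rewrite Nat2Z.inj_succ.
Qed.

Lemma all_nearP m f k s p0 i j : all_near m f (Z.of_nat k) s ->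
  (i <= j < size s)%N -> (j < i + m)%N ->
  f (Z.of_nat (k + i)) (nth p0 s i) (Z.of_nat (k + j)) (nth p0 s j).
Proof.
elim: s k i j => [|p s IHs] k i j; first by rewrite /= ltn0 andbF.
move=> /andP[fk fs]; case: i => [|i].
  move=> /andP[_ lt_j]; rewrite addn0 add0n => lt_jm.
  rewrite -(nth_take p0 lt_jm (p :: s)); apply: (all_fromP p0 fk).
  by rewrite size_take; case: ifP.
case: j => // j; rewrite !ltnS => hij lt_j; rewrite !addnS -!addSn.
by apply: IHs => //; rewrite Nat2Z.inj_succ.
Qed.

(* [(num, den, ex)] stands for the bound [M * n <= (M * N * num + ex) / den], [M = weight_scale]. *)
Definition out_cap (th : option (Z * Z)) (s j : Z) : Z * Z * Z :=
  if th is Some (a, b) then (a, b, Z0) else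
  if Z.eqb s 1 then (1, 1, Z.opp (Z.mul j weight_scale))%bZ
  else (Z.pred s, s, Z.mul weight_scale (Z.succ (Z.add s j))).

Definition in_cap (th : option (Z * Z)) (s : Z) : Z * Z * Z :=
  if th is Some (a, b) then
    if Z.ltb (Z.mul a s) (Z.mul (Z.pred s) b) then (a, b, Z0) else (Z.pred s, s, Z.mul s weight_scale)
  else (Z.pred s, s, Z.mul s weight_scale).

(* [N1] is a lower bound for [N], by the width bound [3 * be ^ 2 <= 4 * N]. With denominators
   cleared the count is quadratic in the offset [a] of the strip, hence bounded by its values at
   the ends of [[j, j + 1]] up to a quarter of the leading coefficient [D]. *)
Definition out_ok (N0 : Z) (th : option (Z * Z)) (j : Z) (pj : triple) (k : Z) (pk : triple) : bool :=
  let s := Z.sub k j in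
  let N1 := Z.max N0 (Z.div2 (Z.div2 (3 * k * k)))%bZ in
  let: (num, den, ex) := out_cap th s j in
  let e := ((4 * pk.2 + 13 * weight_scale) * den + ex)%bZ in
  let c := (4 * den * N1)%bZ in
  let D := (c * (pk.1.1 - pj.1.1) - s * (num * weight_scale * N1 + e))%bZ in
  Z.leb 0 e &&
  if Z.eqb j 0 then Z.leb 0 D && Z.leb (Z.mul c pk.1.2) (Z.mul D s)
  else
    let q a := (4 * (D * (a * (a + s)) - c * (pk.1.2 * a - pj.1.2 * (a + s))))%bZ in
    let D' := Z.max 0 D in Z.leb D' (q j) && Z.leb D' (q (Z.succ j)).

(** The constant 9 is [13 - 4], because the point [(p, s)] itself lies in the window and counts for
    one more. As [D >= 0], the quadratic [q] is concave in the offset, and its values at the two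
    ends suffice without a correction. *)
Definition in_ok (N0 : Z) (th : option (Z * Z)) (j : Z) (pj : triple) (l : Z) (pl : triple) : bool :=
  let s := Z.succ (Z.add j l) in
  let N1 := Z.max N0 (Z.div2 (Z.div2 (3 * s * s)))%bZ in
  let: (num, den, ex) := in_cap th s in
  let e := ((4 * (pj.2 + pl.2) + 9 * weight_scale) * den + ex)%bZ in
  let c := (4 * den * N1)%bZ in
  let D := (c * (pj.1.1 + pl.1.1) - s * (num * weight_scale * N1 + e))%bZ in
  let q a := (D * (a * (s - a)) - c * (pj.1.2 * (s - a) + pl.1.2 * a))%bZ in
  [&& Z.leb 0 e, Z.leb 0 D &
  if Z.eqb j 0 then Z.leb (Z.mul c pl.1.2) (Z.mul D l)
  else Z.leb 0 (q j) && Z.leb 0 (q (Z.succ j))].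

(** For [s = 1] the direction is [(0, 1)] and the offset of the strip is [n * xi]. This is at least
    1, and at least 60 in the ranges with a slope threshold, where the width bound leaves no room
    for it; the cells passed over do not occur. *)
Definition out_check N0 th j pj k pk : bool :=
  [|| Z.leb k j, Z.eqb (Z.sub k j) 1 && (Z.eqb j 0 || isSome th) | out_ok N0 th j pj k pk].

(** The cells passed over have [s = j + l + 1 <= 3]; [narrow_cases] rules them out. *)
Definition in_check N0 th j pj l pl : bool :=
  Z.ltb (Z.add j l) 3 || in_ok N0 th j pj l pl.

Definition table := prefix_sums 450 0 (Z0, Z0, Z0).

(** From index 110 on the estimates of [profile_table] are sharp enough, so the cell by cell check
    stops there. *)
Lemma out_table_large : all_near 111 (out_check 1350 None) 0 (take 111 table).
Proof. by vm_cast_no_check (erefl true). Qed.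

Lemma in_table_large : all_near 111 (in_check 1350 None) 0 (take 111 table).
Proof. by vm_cast_no_check (erefl true). Qed.

(** For [n >= 670] and [xi >= 1 / 10], [N = n * (1 + xi)] is at least [737 = 670 * 11 / 10] and
    [n <= N * 10 / 11]. In this and the next two ranges [N <= 2700], so the width is at most 60 and
    65 rows are enough. *)
Lemma out_table_tenth : all_near 65 (out_check 737 (Some (10, 11)%bZ)) 0 (take 65 table).
Proof. by vm_cast_no_check (erefl true). Qed.

Lemma in_table_tenth : all_near 65 (in_check 737 (Some (10, 11)%bZ)) 0 (take 65 table).
Proof. by vm_cast_no_check (erefl true). Qed.

Lemma out_table_quarter : all_near 65 (out_check 376 (Some (4, 5)%bZ)) 0 (take 65 table).
Proof. by vm_cast_no_check (erefl true). Qed.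

Lemma in_table_quarter : all_near 65 (in_check 376 (Some (4, 5)%bZ)) 0 (take 65 table).
Proof. by vm_cast_no_check (erefl true). Qed.

Lemma out_table_half : all_near 65 (out_check 202 (Some (2, 3)%bZ)) 0 (take 65 table).
Proof. by vm_cast_no_check (erefl true). Qed.

Lemma in_table_half : all_near 65 (in_check 202 (Some (2, 3)%bZ)) 0 (take 65 table).
Proof. by vm_cast_no_check (erefl true). Qed.

(* [0.3039] is slightly below [3 / pi ^ 2], the slope of [\sum_(t <= x) (1 - t / x) phi(t) / t]. *)
Definition profile_ok (k : Z) (p : triple) : bool :=
  let u := if Z.ltb k 110 then 3040%bZ else 20%bZ in
  let S x := Z.mul 10000 (Z.sub (Z.mul p.1.1 x) p.1.2) in
  let lower x := Z.leb (Z.mul weight_scale (Z.sub (Z.mul 3039 (Z.mul x x)) (Z.mul u x))) (S x) in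
  let upper x := Z.leb (Z.add (Z.mul 4 (S x)) (Z.mul weight_scale 3039))
    (Z.mul 4 (Z.mul weight_scale (Z.add (Z.mul 3039 (Z.mul x x)) (Z.mul 220 x)))) in
  [|| Z.leb k 0 | [&& lower k, lower (Z.succ k), upper k, upper (Z.succ k)
    & Z.leb (Z.mul 10 p.2) (Z.mul weight_scale (Z.mul 23 k))]].

Lemma profile_table : all_from profile_ok 0 table.
Proof. by vm_cast_no_check (erefl true). Qed.

(** * Sums of hats in terms of prefix sums *)

Definition wsum (w : nat -> rat) (k : nat) : rat := \sum_(1 <= t < k.+1) w t.

Lemma wsum_hat (w : nat -> rat) (T j : nat) (a : rat) :
  (j <= T)%N -> a < j%:R + 1 -> (0 < j)%N -> j%:R <= a ->
  \sum_(1 <= t < T.+1) w t * hat a t = wsum w j - wsum (fun t => t%:R * w t) j / a.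
Proof.
move=> le_jT lt_a j_gt0 le_ja; have a_gt0 : 0 < a.
  by apply: lt_le_trans le_ja; rewrite ltr0n.
have tail0 : \sum_(j.+1 <= t < T.+1) w t * hat a t = 0.
  rewrite big_nat big1 // => t /andP[lt_jt _].
  by rewrite /hat leNgt (lt_le_trans lt_a) ?mulr0 // natr1 ler_nat.
rewrite (@big_cat_nat _ _ _ j.+1) //= tail0 addr0 /wsum mulr_suml -sumrB big_nat [RHS]big_nat.
apply: eq_bigr => t /andP[t_gt0]; rewrite ltnS => le_tj.
rewrite /hat (le_trans _ le_ja) ?ler_nat //.
by rewrite mulrBr mulr1 mulrA [w t * _]mulrC.
Qed.

Lemma wsum_hat0 (w : nat -> rat) (T : nat) (a : rat) : a < 1 ->
  \sum_(1 <= t < T.+1) w t * hat a t = 0.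
Proof.
move=> a_lt1; rewrite big_nat big1 // => t /andP[t_gt0 _].
by rewrite /hat leNgt (lt_le_trans a_lt1) ?mulr0 // ler1n.
Qed.

(** For [j] the integer part of [a] this is the full sum of [w t * hat a t], read off from the two
    prefix sums stored in the table. For [j = 0] it is 0 whatever [a] is, which covers offsets
    [a <= 0]. *)
Definition hat_sum (w : nat -> rat) (j : nat) (a : rat) : rat :=
  wsum w j - wsum (fun t => t%:R * w t) j / a.

Lemma hat_sumP (w : nat -> rat) (T j : nat) (a : rat) :
  (j <= T)%N -> a < j%:R + 1 -> (0 < j)%N ==> (j%:R <= a) ->
  \sum_(1 <= t < T.+1) w t * hat a t = hat_sum w j a.
Proof.
move=> le_jT lt_a; case: j => [|j] in le_jT lt_a * => /= le_ja; last exact: wsum_hat.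
by rewrite wsum_hat0 ?(lt_le_trans lt_a) ?add0r // /hat_sum /wsum !big_geq // mul0r subr0.
Qed.

Lemma hat_sum_top (w : nat -> rat) (T : nat) (b : rat) : 0 < b -> T%:R <= b ->
  \sum_(1 <= t < T.+1) w t * hat b t = hat_sum w T b.
Proof.
move=> b_gt0 le_Tb; rewrite /hat_sum /wsum mulr_suml -sumrB big_nat [RHS]big_nat.
apply: eq_bigr => t /andP[t_gt0]; rewrite ltnS => le_tT.
rewrite /hat (le_trans _ le_Tb) ?ler_nat //.
by rewrite mulrBr mulr1 mulrA [w t * _]mulrC.
Qed.

Lemma side_count (M : rat) (w er : nat -> rat) (N c al be : rat) (p e f eps : int) (s T j : nat) :
  0 < M -> (forall t, (0 < t)%N -> line_bound (w t / M) (er t / M) t) ->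
  0 < N -> (0 < s)%N -> 0 <= e -> p * e - s%:Z * f = eps -> (eps == 1) || (eps == -1) ->
  (eps = 1 -> be = s%:R * c - p%:~R * N + s%:R) ->
  (eps = -1 -> be = p%:~R * N - s%:R * c) ->
  al = be - s%:R -> 0 < be -> T%:R <= be -> (j <= T)%N ->
  al < j%:R + 1 -> (0 < j)%N ==> (j%:R <= al) ->
  exists L : seq (int * int), [/\ uniq L,
    all (fun z => in_window N c z && (0 < eps * (s%:Z * z.1 - p * z.2))) L &
    (N / s%:R * (hat_sum w T be - hat_sum w j al) - wsum er T) / M <= (size L)%:R].
Proof.
move=> M_gt0 lineP N_gt0 s_gt0 e_ge0 bez epsP be1 be2 al_def be_gt0 le_T le_jT lt_al le_al.
have lineP' t : (0 < t <= T)%N -> line_bound (w t / M) (er t / M) t.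
  by case/andP=> t_gt0 _; apply: lineP.
have sZ_gt0 : 0 < s%:Z by rewrite ltz_nat.
have [L [uL aL szL]] := side_points N_gt0 sZ_gt0 e_ge0 bez epsP be1 be2 al_def be_gt0 le_T lineP'.
exists L; split=> //.
  by apply: sub_all aL => z /andP[-> /andP[-> _]].
apply: le_trans szL; rewrite le_eqVlt; apply/orP; left; apply/eqP.
rewrite sumrB -mulr_suml mulrBl; congr (_ - _ / _).
rewrite -(hat_sum_top w be_gt0 le_T) -(hat_sumP w le_jT lt_al le_al).
rewrite -sumrB mulr_sumr mulr_suml; apply: eq_bigr => t _; ring.
Qed.

(** A check at the single value [N1] settles all [N >= N1]: the main terms on both sides are
    proportional to [N], and the error [e >= 0] stays fixed. *)
Lemma scaled_count (M N N1 num den ex n e0 e L s : rat) :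
  0 < M -> 0 < s -> 0 < den -> 0 < N1 -> N1 <= N -> 0 <= e -> e = e0 * den + ex ->
  s * (num * M * N1 + e) <= 4 * den * N1 * L ->
  den * (M * n) <= M * N * num + ex -> M * n + e0 <= 4 * (N / s * L).
Proof.
move=> M_gt0 s_gt0 den_gt0 N1_gt0 le_N e_ge0 eE hL hn.
have N_gt0 : 0 < N := lt_le_trans N1_gt0 le_N.
have h1 : N * (s * (num * M * N1 + e)) <= N * (4 * den * N1 * L) by rewrite ler_pM2l.
have h2 : N1 * e <= N * e by rewrite ler_wpM2r.
have h3 : den * (M * n + e0) <= num * M * N + e by rewrite eE; lra.
rewrite -(ler_pM2l den_gt0); apply: le_trans h3 _.
rewrite -(ler_pM2l (mulr_gt0 s_gt0 N1_gt0)).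
have -> : s * N1 * (den * (4 * (N / s * L))) = N * (4 * den * N1 * L).
  by field; rewrite gt_eqF.
apply: le_trans h1; rewrite mulrCA.
have -> : s * N1 * (num * M * N + e) = s * (N * (num * M * N1) + N1 * e) by ring.
by rewrite ler_pM2l // mulrDr lerD2l.
Qed.

Lemma out_real (M N N1 num den ex n Fk Gk Fj Gj E al be s j D Dp : rat) :
  0 < M -> 0 < s -> 0 < den -> 0 < N1 -> N1 <= N -> be = al + s ->
  0 <= j -> j <= al -> al < j + 1 -> 0 <= Gk ->
  0 <= (4 * E + 13 * M) * den + ex ->
  D = 4 * den * N1 * (Fk - Fj) - s * (num * M * N1 + ((4 * E + 13 * M) * den + ex)) ->
  (Gj = 0 /\ 0 <= D /\ 4 * den * N1 * Gk <= D * s) \/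
  (0 < j /\ 0 <= Dp /\ D <= Dp /\
   Dp <= 4 * (D * (j * (j + s)) - 4 * den * N1 * (Gk * j - Gj * (j + s))) /\
   Dp <= 4 * (D * ((j + 1) * (j + 1 + s)) - 4 * den * N1 * (Gk * (j + 1) - Gj * (j + 1 + s)))) ->
  den * (M * n) <= M * N * num + ex ->
  n + 13 <= 4 * ((N / s * ((Fk - Gk / be) - (Fj - Gj / al)) - E) / M).
Proof.
move=> M_gt0 s_gt0 den_gt0 N1_gt0 le_N def_be j_ge0 le_j lt_j Gk_ge0 e_ge0 def_D hD hn.
have al_ge0 : 0 <= al by lra.
have be_gt0 : 0 < be by lra.
set c := 4 * den * N1 in def_D hD *; have c_gt0 : 0 < c by rewrite !mulr_gt0.
have key : s * (num * M * N1 + ((4 * E + 13 * M) * den + ex)) <=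
   c * ((Fk - Gk / be) - (Fj - Gj / al)).
  rewrite -subr_ge0.
  case: hD => [[Gj0 [D_ge0 hs]]|[j_gt0 [Dp_ge0 [leD [q0 q1]]]]].
    have -> : c * (Fk - Gk / be - (Fj - Gj / al)) -
       s * (num * M * N1 + ((4 * E + 13 * M) * den + ex)) = D - c * Gk / be.
      by rewrite Gj0 def_D; ring.
    rewrite subr_ge0 ler_pdivrMr //; apply: le_trans hs _.
    by rewrite ler_wpM2l // def_be lerDr.
  have al_gt0 : 0 < al by lra.
  have -> : c * (Fk - Gk / be - (Fj - Gj / al)) -
       s * (num * M * N1 + ((4 * E + 13 * M) * den + ex)) =
       (D * (al * be) - c * (Gk * al - Gj * be)) / (al * be).
    by rewrite def_D; field; rewrite !gt_eqF.
  apply: divr_ge0; last by rewrite mulr_ge0 // ltW.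
  rewrite def_be.
  pose x := al - j; have alE : al = j + x by rewrite /x; ring.
  have x0 : 0 <= x by rewrite /x; lra.
  have x1 : x <= 1 by rewrite /x; lra.
  have -> : D * (al * (al + s)) - c * (Gk * al - Gj * (al + s)) =
    (1 - x) * (D * (j * (j + s)) - c * (Gk * j - Gj * (j + s))) +
    x * (D * ((j + 1) * (j + 1 + s)) - c * (Gk * (j + 1) - Gj * (j + 1 + s)))
    - D * (x * (1 - x)) by rewrite alE; ring.
  set P0 := D * _ - _ in q0 *; set P1 := D * _ - _ in q1 *.
  have hx : x * (1 - x) <= 4^-1 by have := sqr_ge0 (x - 2^-1); rewrite expr2; lra.
  have xx0 : 0 <= x * (1 - x) by rewrite mulr_ge0 // subr_ge0.
  have h1 : D * (x * (1 - x)) <= Dp * 4^-1.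
    by apply: le_trans (_ : Dp * (x * (1 - x)) <= _); [rewrite ler_wpM2r | rewrite ler_wpM2l].
  have quarter P : Dp <= 4 * P -> Dp / 4 <= P by move=> hP; rewrite ler_pdivrMr // mulrC.
  have h2 : (1 - x) * (Dp / 4) <= (1 - x) * P0 by apply: ler_wpM2l (quarter _ q0); rewrite subr_ge0.
  have h3 : x * (Dp / 4) <= x * P1 by apply: ler_wpM2l (quarter _ q1).
  have hDp : (1 - x) * (Dp / 4) + x * (Dp / 4) = Dp * 4^-1 by ring.
  by rewrite subr_ge0 (le_trans h1) // -hDp lerD.
have := scaled_count M_gt0 s_gt0 den_gt0 N1_gt0 le_N e_ge0 erefl key hn.
set Q := N / s * _ => h; rewrite -(ler_pM2r M_gt0) -mulrA divfK ?gt_eqF //; lra.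
Qed.

Lemma in_real (M N N1 num den ex n Fl Gl Fj Gj Ej El A B s j l D : rat) :
  0 < M -> 0 < den -> 0 < N1 -> N1 <= N -> s = j + l + 1 -> A + B = s -> 0 < A -> 0 < B ->
  0 <= j -> j <= A -> A <= j + 1 -> 0 < l -> 0 <= Gl ->
  0 <= (4 * (Ej + El) + 9 * M) * den + ex ->
  D = 4 * den * N1 * (Fj + Fl) - s * (num * M * N1 + ((4 * (Ej + El) + 9 * M) * den + ex)) ->
  0 <= D ->
  (Gj = 0 /\ j = 0 /\ 4 * den * N1 * Gl <= D * l) \/
  (0 <= D * (j * (s - j)) - 4 * den * N1 * (Gj * (s - j) + Gl * j) /\
   0 <= D * ((j + 1) * (s - (j + 1))) - 4 * den * N1 * (Gj * (s - (j + 1)) + Gl * (j + 1))) ->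
  den * (M * n) <= M * N * num + ex ->
  n + 13 <= 4 * ((N / s * (Fj - Gj / A) - Ej) / M + (N / s * (Fl - Gl / B) - El) / M + 1).
Proof.
move=> M_gt0 den_gt0 N1_gt0 le_N def_s AB A_gt0 B_gt0 j_ge0 le_j lt_j l_gt0 Gl_ge0 e_ge0 def_D D_ge0 hD hn.
have s_gt0 : 0 < s by lra.
set c := 4 * den * N1 in def_D hD *; have c_gt0 : 0 < c by rewrite !mulr_gt0.
have key : s * (num * M * N1 + ((4 * (Ej + El) + 9 * M) * den + ex)) <=
   c * ((Fj - Gj / A) + (Fl - Gl / B)).
  rewrite -subr_ge0.
  case: hD => [[Gj0 [j0 hs]]|[q0 q1]].
    have -> : c * (Fj - Gj / A + (Fl - Gl / B)) -
       s * (num * M * N1 + ((4 * (Ej + El) + 9 * M) * den + ex)) = D - c * Gl / B.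
      by rewrite Gj0 def_D; ring.
    rewrite subr_ge0 ler_pdivrMr //; apply: le_trans hs _.
    by rewrite ler_wpM2l //; lra.
  have -> : c * (Fj - Gj / A + (Fl - Gl / B)) -
       s * (num * M * N1 + ((4 * (Ej + El) + 9 * M) * den + ex)) =
       (D * (A * B) - c * (Gj * B + Gl * A)) / (A * B).
    by rewrite def_D; field; rewrite !gt_eqF.
  apply: divr_ge0; last by rewrite mulr_ge0 // ltW.
  pose x := A - j; have AE : A = j + x by rewrite /x; ring.
  have x0 : 0 <= x by rewrite /x; lra.
  have x1 : 0 <= 1 - x by rewrite /x; lra.
  have -> : D * (A * B) - c * (Gj * B + Gl * A) =
    (1 - x) * (D * (j * (s - j)) - c * (Gj * (s - j) + Gl * j)) +
    x * (D * ((j + 1) * (s - (j + 1))) - c * (Gj * (s - (j + 1)) + Gl * (j + 1)))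
    + D * (x * (1 - x)).
    have -> : B = s - A by lra.
    by rewrite AE; ring.
  by rewrite !addr_ge0 // mulr_ge0 // mulr_ge0.
have e0E : (4 * (Ej + El) + 9 * M) * den + ex = (4 * (Ej + El) + 9 * M) * den + ex by [].
have := scaled_count M_gt0 s_gt0 den_gt0 N1_gt0 le_N e_ge0 e0E key hn.
set U := Fj - _; set V := Fl - _ => h; rewrite -(ler_pM2r M_gt0).
have -> : 4 * ((N / s * U - Ej) / M + (N / s * V - El) / M + 1) * M =
  4 * (N / s * (U + V)) - 4 * (Ej + El) + 4 * M by field; rewrite !gt_eqF.
lra.
Qed.

Lemma ratZS x : ratZ (Z.succ x) = ratZ x + 1.
Proof. by rewrite -Z.add_1_r ratZD [ratZ 1]ratZ_int. Qed.

Lemma ratZN x : ratZ (Z.opp x) = - ratZ x.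
Proof. by rewrite -Z.sub_0_l ratZB -ratZ0 add0r. Qed.

Lemma ratZ_const : (ratZ 3 = 3) * (ratZ 4 = 4) * (ratZ 9 = 9) * (ratZ 13 = 13).
Proof. by rewrite !ratZ_int. Qed.

Definition ratZE := (ratZD, ratZM, ratZB, ratZS, ratZN, ratZ_nat, ratZ_const).

Lemma weight_scale_gt0 : 0 < ratZ weight_scale.
Proof. by rewrite ratZ0 lt_ratZ. Qed.

Lemma quarter_le (N : rat) (x : Z) : ratZ x <= 4 * N -> ratZ (Z.div2 (Z.div2 x)) <= N.
Proof.
move=> h; rewrite -(ler_pM2l (_ : 0 < 4)) //; apply: le_trans h.
rewrite -ratZ_const -ratZM le_ratZ; apply/Z.leb_le.
rewrite !Z.div2_div Z.div_div //; exact: Z.mul_div_le.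
Qed.

Lemma ratZ_max (N : rat) x y : ratZ x <= N -> ratZ y <= N -> ratZ (Z.max x y) <= N.
Proof. by case: (Z.max_spec x y) => [[_ ->]|[_ ->]]. Qed.

Lemma ratZ_max_gt0 x y : 0 < ratZ x -> 0 < ratZ (Z.max x y).
Proof. by rewrite ratZ0 !lt_ratZ; lia. Qed.

Lemma wsum_ge0 (w : nat -> rat) k : (forall t, (0 < t)%N -> 0 <= w t) -> 0 <= wsum w k.
Proof. by move=> h; rewrite /wsum big_nat sumr_ge0 // => t /andP[t_gt0 _]; apply: h. Qed.

Lemma table_weight_ge0 t : (0 < t)%N -> 0 <= table_weight t.
Proof. by case/line_weightP=> h _; rewrite /table_weight ratZ0 le_ratZ; apply/Z.leb_le. Qed.

Lemma moment_ge0 t : (0 < t)%N -> 0 <= t%:R * table_weight t.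
Proof. by move=> t_gt0; rewrite mulr_ge0 ?ler0n ?table_weight_ge0. Qed.

Lemma line_bound_table t : (0 < t)%N ->
  line_bound (table_weight t / ratZ weight_scale) (table_error t / ratZ weight_scale) t.
Proof. by case/line_weightP. Qed.

Lemma out_okP (N0 : Z) th (j k : nat) pj pk (N n al be : rat) :
  prefix_ok j pj -> prefix_ok k pk -> (j < k)%N ->
  out_ok N0 th (Z.of_nat j) pj (Z.of_nat k) pk ->
  0 < ratZ N0 -> ratZ N0 <= N -> 3 * be ^+ 2 <= 4 * N ->
  be = al + (k - j)%:R -> j%:R <= al -> al < j%:R + 1 ->
  (let: (num, den, ex) := out_cap th (Z.of_nat (k - j)) (Z.of_nat j) in
   0 < ratZ den /\ ratZ den * (ratZ weight_scale * n) <= ratZ weight_scale * N * ratZ num + ratZ ex) ->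
  n + 13 <= 4 * ((N / (k - j)%:R * (hat_sum table_weight k be - hat_sum table_weight j al) - wsum table_error k) / ratZ weight_scale).
Proof.
move=> [Fj Gj _] [Fk Gk Ek] lt_jk ok N0_gt0 le_N hW def_be le_j lt_j.
have s_gt0 : (0 : rat) < (k - j)%:R by rewrite ltr0n subn_gt0.
have le_kb : k%:R <= be.
  by rewrite def_be -{1}(subnKC (ltnW lt_jk)) natrD lerD2r.
move: ok; rewrite /out_ok.
have -> : Z.sub (Z.of_nat k) (Z.of_nat j) = Z.of_nat (k - j) by lia.
set N1 := Z.max N0 _; case: out_cap => [[num den] ex] /andP[e_ge0 hD] [den_gt0 cap].
rewrite /hat_sum /wsum -Fj -Fk -Gj -Gk -Ek.
have N1_le : ratZ N1 <= N.
  apply: ratZ_max => //; apply: quarter_le; rewrite !ratZE; apply: le_trans hW.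
  by rewrite -mulrA ler_pM2l // -expr2 lerXn2r // ?nnegrE ?(le_trans (ler0n _ k)).
apply: (@out_real (ratZ weight_scale) N (ratZ N1) (ratZ num) (ratZ den) (ratZ ex) n
  _ _ _ _ _ al be (k - j)%:R j%:R _ (ratZ (Z.max 0 (Z.sub (Z.mul (Z.mul (Z.mul 4 den) N1) (Z.sub pk.1.1 pj.1.1))
     (Z.mul (Z.of_nat (k - j)) (Z.add (Z.mul (Z.mul num weight_scale) N1)
     (Z.add (Z.mul (Z.add (Z.mul 4 pk.2) (Z.mul 13 weight_scale)) den) ex))))))
   weight_scale_gt0 s_gt0 den_gt0 (ratZ_max_gt0 _ N0_gt0) N1_le def_be _ le_j lt_j _ _ erefl _ cap).
- by rewrite ler0n.
- by rewrite Gk; apply: wsum_ge0 moment_ge0.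
- by move: e_ge0; rewrite -le_ratZ !ratZE -ratZ0.
move: hD; case: ifP => [/Z.eqb_eq j0|/Z.eqb_neq j0].
  have {}j0 : j = 0%N by move: j0; clear; lia.
  rewrite -!le_ratZ !ratZE -ratZ0 => /andP[h1 h2]; left; split; last by [].
  by rewrite Gj j0 big_geq.
rewrite -!le_ratZ !ratZE => /andP[h1 h2]; right; split.
  by rewrite ltr0n; move: j0; clear; lia.
split; first by rewrite ratZ0 le_ratZ; apply/Z.leb_le/Z.le_max_l.
split; first by rewrite -!ratZE le_ratZ; apply/Z.leb_le/Z.le_max_r.
by split.
Qed.

Lemma in_okP (N0 : Z) th (j l : nat) pj pl (N n A B : rat) :
  prefix_ok j pj -> prefix_ok l pl -> (0 < l)%N ->
  in_ok N0 th (Z.of_nat j) pj (Z.of_nat l) pl ->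
  0 < ratZ N0 -> ratZ N0 <= N -> 3 * (j + l + 1)%:R ^+ 2 <= 4 * N ->
  A + B = (j + l + 1)%:R -> 0 < A -> 0 < B -> j%:R <= A -> A <= j%:R + 1 ->
  (let: (num, den, ex) := in_cap th (Z.of_nat (j + l + 1)) in
   0 < ratZ den /\ ratZ den * (ratZ weight_scale * n) <= ratZ weight_scale * N * ratZ num + ratZ ex) ->
  n + 13 <= 4 * ((N / (j + l + 1)%:R * hat_sum table_weight j A - wsum table_error j) / ratZ weight_scale +
                 (N / (j + l + 1)%:R * hat_sum table_weight l B - wsum table_error l) / ratZ weight_scale + 1).
Proof.
move=> [Fj Gj Ej] [Fl Gl El] l_gt0 ok N0_gt0 le_N hW AB A_gt0 B_gt0 le_j le_A.
move: ok; rewrite /in_ok.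
have -> : Z.succ (Z.add (Z.of_nat j) (Z.of_nat l)) = Z.of_nat (j + l + 1) by lia.
set N1 := Z.max N0 _; case: in_cap => [[num den] ex] /and3P[e_ge0 D_ge0 hD] [den_gt0 cap].
rewrite /hat_sum /wsum -Fj -Fl -Gj -Gl -Ej -El.
have N1_le : ratZ N1 <= N.
  apply: ratZ_max => //; apply: quarter_le; rewrite !ratZE; apply: le_trans hW.
  by rewrite -mulrA -expr2.
have sE : (j + l + 1)%:R = j%:R + l%:R + 1 :> rat by rewrite !natrD.
apply: (@in_real (ratZ weight_scale) N (ratZ N1) (ratZ num) (ratZ den) (ratZ ex) n
  _ _ _ _ _ _ A B (j + l + 1)%:R j%:R l%:R _
   weight_scale_gt0 den_gt0 (ratZ_max_gt0 _ N0_gt0) N1_le sE AB A_gt0 B_gt0 _ le_j le_A _ _ _ erefl _ _ cap).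
- by rewrite ler0n.
- by rewrite ltr0n.
- by rewrite Gl; apply: wsum_ge0 moment_ge0.
- by move: e_ge0; rewrite -le_ratZ !ratZE -ratZ0.
- by move: D_ge0; rewrite -le_ratZ !ratZE -ratZ0.
move: hD; case: ifP => [/Z.eqb_eq j0|/Z.eqb_neq j0].
  have {}j0 : j = 0%N by move: j0; clear; lia.
  rewrite -!le_ratZ !ratZE => h1; left; split; first by rewrite Gj j0 big_geq.
  by rewrite {1}j0.
by rewrite -!le_ratZ !ratZE -ratZ0 => /andP[h1 h2]; right.
Qed.

Lemma table_prefix p0 k : (k <= 450)%N -> prefix_ok k (nth p0 table k).
Proof.
move=> le_k; apply: (@prefix_sumsP 450 0 (Z0, Z0, Z0) k p0) => //.
by split; rewrite big_geq // ratZ0.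
Qed.

Lemma ratZ_pos (p : positive) : ratZ (Zpos p) = (Pos.to_nat p)%:R.
Proof. by rewrite -positive_nat_Z ratZ_nat. Qed.

(** * Strips of width between 110 and 450 *)

Lemma mid_point (x y k : rat) (k_le : k <= x) (le_k : x <= k + 1) :
  y = x - k -> [/\ 0 <= y, 0 <= 1 - y, 0 <= y * (1 - y) & y * (1 - y) <= 4^-1].
Proof.
move=> ->; have y0 : 0 <= x - k by lra.
have y1 : 0 <= 1 - (x - k) by lra.
split=> //; first by rewrite mulr_ge0.
by have := sqr_ge0 ((x - k) - 2^-1); rewrite expr2; lra.
Qed.

(** After multiplication by [x] the middle term is linear on the cell and both bounds are convex
    quadratics. A convex function lies below its chord, so the end points settle the lower bound; it
    lies below by at most [M * th / 4], which has to be added for the upper bound. *)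
Lemma hat_profile (F G M th u v k x : rat) : 0 < M -> 0 <= th -> 0 < k -> k <= x -> x <= k + 1 ->
  M * (th * (k * k) - u * k) <= F * k - G ->
  M * (th * ((k + 1) * (k + 1)) - u * (k + 1)) <= F * (k + 1) - G ->
  F * k - G + M * th / 4 <= M * (th * (k * k) + v * k) ->
  F * (k + 1) - G + M * th / 4 <= M * (th * ((k + 1) * (k + 1)) + v * (k + 1)) ->
  M * (th * x - u) <= F - G / x <= M * (th * x + v).
Proof.
move=> M_gt0 th_ge0 k_gt0 le_kx le_xk l0 l1 u0 u1.
have x_gt0 : 0 < x := lt_le_trans k_gt0 le_kx.
have [] := mid_point le_kx le_xk erefl.
set y := x - k => y0 y1 yy yq; have xE : x = k + y by rewrite /y; ring.
clearbody y; have Mth : 0 <= M * th by rewrite mulr_ge0 // ltW.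
have EF : F - G / x = (F * x - G) / x by field; rewrite gt_eqF.
rewrite EF ler_pdivlMr // ler_pdivrMr //; apply/andP; split.
  rewrite -subr_ge0.
  have -> : F * x - G - M * (th * x - u) * x =
    (1 - y) * (F * k - G - M * (th * (k * k) - u * k)) +
    y * (F * (k + 1) - G - M * (th * ((k + 1) * (k + 1)) - u * (k + 1))) +
    M * th * (y * (1 - y)) by rewrite xE; ring.
  by rewrite !addr_ge0 // mulr_ge0 // subr_ge0.
rewrite -subr_ge0.
have -> : M * (th * x + v) * x - (F * x - G) =
    (1 - y) * (M * (th * (k * k) + v * k) - (F * k - G + M * th / 4)) +
    y * (M * (th * ((k + 1) * (k + 1)) + v * (k + 1)) - (F * (k + 1) - G + M * th / 4)) +
    M * th * (4^-1 - y * (1 - y)) by rewrite xE; field.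
by rewrite !addr_ge0 // mulr_ge0 // subr_ge0.
Qed.

Definition mean_slope : rat := ratZ 3039 / ratZ 10000.
Definition low_defect : rat := ratZ 3040 / ratZ 10000.
Definition far_defect : rat := ratZ 20 / ratZ 10000.
Definition excess : rat := ratZ 220 / ratZ 10000.

Lemma ratZ_pos_gt0 p : 0 < ratZ (Zpos p).
Proof. by rewrite ratZ0 lt_ratZ. Qed.

Lemma profile_constants : [/\ 3 / 10 <= mean_slope, low_defect <= 1 / 3,
  12 / 43 <= mean_slope - far_defect - excess & 0 <= excess].
Proof.
have h := ratZ_pos_gt0 10000.
have e1 : 10 = ratZ 10 by rewrite ratZ_pos.
have e2 : 3 = ratZ 3 by rewrite ratZ_pos.
have e3 : 12 = ratZ 12 by rewrite ratZ_pos.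
have e4 : 43 = ratZ 43 by rewrite ratZ_pos.
rewrite e1 e2 e3 e4 /mean_slope /low_defect /far_defect /excess -!mulrBl.
split.
- rewrite (ler_pdivrMr _ _ (ratZ_pos_gt0 10)) mulrAC (ler_pdivlMr _ _ h) -!ratZM le_ratZ.
  by vm_compute.
- rewrite (ler_pdivrMr _ _ h) mulrAC mul1r (ler_pdivlMr _ _ (ratZ_pos_gt0 3)) -!ratZM le_ratZ.
  by vm_compute.
- rewrite (ler_pdivrMr _ _ (ratZ_pos_gt0 43)) mulrAC (ler_pdivlMr _ _ h) -!ratZB -!ratZM le_ratZ.
  by vm_compute.
- exact: divr_ge0 (ltW (ratZ_pos_gt0 _)) (ltW h).
Qed.

Lemma profileP (k : nat) (x : rat) : (0 < k <= 450)%N -> k%:R <= x -> x <= k%:R + 1 ->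
  [/\ ratZ weight_scale * (mean_slope * x - low_defect) <= hat_sum table_weight k x,
     (110 <= k)%N -> ratZ weight_scale * (mean_slope * x - far_defect) <= hat_sum table_weight k x,
     hat_sum table_weight k x <= ratZ weight_scale * (mean_slope * x + excess) &
     wsum table_error k <= ratZ weight_scale * (23 / 10 * k%:R)].
Proof.
case/andP=> k_gt0 le_k le_kx le_xk.
have := table_prefix (Z0, Z0, Z0) le_k.
have := @all_fromP profile_ok 0 table (Z0, Z0, Z0) k profile_table.
rewrite size_prefix_sums ltnS add0n => /(_ le_k).
move: (nth _ _ _) => p ok [Fk Gk Ek].
have k_gt0' : (0 : rat) < k%:R by rewrite ltr0n.
have M_gt0 := weight_scale_gt0; rewrite /hat_sum /wsum -Fk -Gk -Ek.
have C_gt0 := ratZ_pos_gt0 10000.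
have C0 : ratZ 10000 != 0 by rewrite gt_eqF.
move: ok; rewrite /profile_ok; case/orP=> [/Z.leb_le|]; first lia.
have -> : Z.ltb (Z.of_nat k) 110 = (k < 110)%N by lia.
set u := if _ then _ else _.
rewrite -!le_ratZ !(ratZS, ratZB, ratZM, ratZD, ratZ_nat).
case/and5P; set C := ratZ 10000 in C_gt0 C0 *.
have -> : ratZ 4 = 4 by rewrite ratZ_pos.
have -> : ratZ 10 = 10 by rewrite ratZ_pos.
have -> : ratZ 23 = 23 by rewrite ratZ_pos.
move=> l0 l1 u0 u1 eb.
have scale A B : C * A <= C * B -> A <= B by rewrite ler_pM2l.
have th_ge0 : 0 <= mean_slope by rewrite divr_ge0 // ltW // ratZ_pos_gt0.
have low : ratZ weight_scale * (mean_slope * x - ratZ u / C) <= ratZ p.1.1 - ratZ p.1.2 / x <=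
   ratZ weight_scale * (mean_slope * x + excess).
  apply: (hat_profile M_gt0 th_ge0 k_gt0' le_kx le_xk); apply: scale; rewrite /mean_slope /excess -/C.
  - by apply: le_trans l0; rewrite le_eqVlt; apply/orP; left; apply/eqP; field.
  - by apply: le_trans l1; rewrite le_eqVlt; apply/orP; left; apply/eqP; field.
  - rewrite -(ler_pM2l (_ : 0 < 4)) //.
    have -> : 4 * (C * (ratZ p.1.1 * k%:R - ratZ p.1.2 + ratZ weight_scale * (ratZ 3039 / C) / 4)) =
      4 * (C * (ratZ p.1.1 * k%:R - ratZ p.1.2)) + ratZ weight_scale * ratZ 3039 by field.
    by apply: le_trans u0 _; rewrite le_eqVlt; apply/orP; left; apply/eqP; field.
  - rewrite -(ler_pM2l (_ : 0 < 4)) //.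
    have -> : 4 * (C * (ratZ p.1.1 * (k%:R + 1) - ratZ p.1.2 + ratZ weight_scale * (ratZ 3039 / C) / 4)) =
      4 * (C * (ratZ p.1.1 * (k%:R + 1) - ratZ p.1.2)) + ratZ weight_scale * ratZ 3039 by field.
    by apply: le_trans u1 _; rewrite le_eqVlt; apply/orP; left; apply/eqP; field.
case/andP: low => low up; split=> //.
- apply: le_trans low; rewrite ler_pM2l // lerD2l lerN2 /low_defect -/C ler_pM2r ?invr_gt0 //.
  by rewrite le_ratZ /u; case: ifP.
- move=> k_ge; apply: le_trans low; rewrite ler_pM2l // lerD2l lerN2 /far_defect -/C ler_pM2r ?invr_gt0 //.
  by rewrite le_ratZ /u ltnNge k_ge.
- by rewrite -(ler_pM2l (_ : 0 < 10)) //; apply: le_trans eb _; rewrite le_eqVlt; apply/orP; left; apply/eqP; field.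
Qed.

(** The width bound gives [N >= 3 / 4 * k ^ 2], at least [82 * k] for [k >= 110]. As
    [4 * 12 / 43 = 1 + 5 / 43], the surplus [5 / 43 * N] pays for the error [4 * 23 / 10 * k] and
    for 13. *)
Lemma far_count (M N n s k b r H E : rat) : 0 < M -> 1 <= s -> 110 <= k -> k <= b ->
  3 * b ^+ 2 <= 4 * N -> n <= N -> 12 / 43 <= r ->
  M * (r * s) <= H -> E <= M * (23 / 10 * k) ->
  n + 13 <= 4 * ((N / s * H - E) / M).
Proof.
move=> M_gt0 s1 k110 le_kb hW le_nN le_r hH hE.
have s_gt0 : 0 < s by lra.
have k_gt0 : 0 < k by lra.
have kk : k * k <= b * b by exact: (ler_pM (ltW k_gt0) (ltW k_gt0) le_kb le_kb).
have k110k : 110 * k <= k * k by rewrite (ler_pM2r k_gt0).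
rewrite expr2 in hW; have N_gt0 : 0 < N by lra.
have h3 : n + 13 <= 4 * (12 / 43 * N - 23 / 10 * k) by lra.
move=> {k110 k110k kk hW le_nN le_kb}; have h1 : N / s * (M * (12 / 43 * s)) <= N / s * H.
  apply: ler_wpM2l; first exact: divr_ge0 (ltW N_gt0) (ltW s_gt0).
  apply: le_trans hH; rewrite (ler_pM2l M_gt0); exact: ler_wpM2r (ltW s_gt0) _ _ le_r.
have e1 : N / s * (M * (12 / 43 * s)) = M * (12 / 43 * N) by field; rewrite gt_eqF.
rewrite -(ler_pM2r M_gt0).
have -> : 4 * ((N / s * H - E) / M) * M = 4 * (N / s * H - E) by field; rewrite !gt_eqF.
have h4 : (n + 13) * M <= 4 * (12 / 43 * N - 23 / 10 * k) * M by rewrite (ler_pM2r M_gt0).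
apply: le_trans h4 _; rewrite -mulrA; apply: ler_wpM2l; first exact: (ler0n _ 4).
by rewrite mulrC mulrBr -e1; exact: lerB h1 hE.
Qed.

Lemma two_sides (x H1 H2 E1 E2 M : rat) :
  4 * ((x * (H1 + H2) - (E1 + E2)) / M) <= 4 * ((x * H1 - E1) / M + (x * H2 - E2) / M + 1).
Proof.
have -> : 4 * ((x * (H1 + H2) - (E1 + E2)) / M) = 4 * ((x * H1 - E1) / M + (x * H2 - E2) / M).
  by ring.
by rewrite ler_pM2l // lerDl.
Qed.

Lemma hat_sum0 w a : hat_sum w 0 a = 0.
Proof. by rewrite /hat_sum /wsum !big_geq // mul0r subr0. Qed.

(** The difference of the profiles at [be] and [al] has main term [mean_slope * s] with [s = k - j],
    and [s] may be 1. Both defects are charged to [s], so the defect at [be] must be the sharp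
    [far_defect], available for [k >= 110]. *)
Lemma out_far (N n al be : rat) (j k : nat) : (j < k)%N -> (110 <= k <= 450)%N ->
  j%:R <= al -> al < j%:R + 1 -> be = al + (k - j)%:R -> 3 * be ^+ 2 <= 4 * N -> n <= N ->
  n + 13 <= 4 * ((N / (k - j)%:R * (hat_sum table_weight k be - hat_sum table_weight j al) - wsum table_error k) / ratZ weight_scale).
Proof.
move=> lt_jk /andP[k110 k450] le_j lt_j def_be hW le_nN.
have [c1 c2 c3 c4] := profile_constants; have M_gt0 := weight_scale_gt0.
have kb : k%:R <= be by rewrite def_be -{1}(subnKC (ltnW lt_jk)) natrD lerD2r.
have bk : be <= k%:R + 1.
  by rewrite def_be -{2}(subnKC (ltnW lt_jk)) natrD addrAC lerD2r ltW.
have k110' : (110 : rat) <= k%:R by rewrite (ler_nat _ 110).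
have kr : (0 < k <= 450)%N by rewrite k450 andbT (leq_ltn_trans _ lt_jk).
have [_ /(_ k110) lo _ eb] := profileP kr kb bk.
have s1 : (1 : rat) <= (k - j)%:R by rewrite ler1n subn_gt0.
set s := (k - j)%:R in def_be s1 *.
have up : hat_sum table_weight j al <= ratZ weight_scale * (mean_slope * al + excess).
  case: (posnP j) => [j0|j_gt0].
    rewrite j0 hat_sum0; apply: mulr_ge0; first exact: ltW.
    apply: addr_ge0 c4; apply: mulr_ge0; first lra.
    exact: le_trans (ler0n _ _) le_j.
  have jr : (0 < j <= 450)%N by rewrite j_gt0 (leq_trans (ltnW lt_jk)).
  by have [_ _ h _] := profileP jr le_j (ltW lt_j); exact: h.
have hS : ratZ weight_scale * (12 / 43 * s) <= hat_sum table_weight k be - hat_sum table_weight j al.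
  apply: le_trans (lerB lo up); rewrite -mulrBr (ler_pM2l M_gt0) def_be.
  have -> : mean_slope * (al + s) - far_defect - (mean_slope * al + excess) =
    mean_slope * s - (far_defect + excess) by ring.
  have h : (far_defect + excess) * 1 <= (far_defect + excess) * s.
    apply: ler_wpM2l s1; apply: addr_ge0 c4.
    exact: divr_ge0 (ltW (ratZ_pos_gt0 _)) (ltW (ratZ_pos_gt0 _)).
  have h2 : 12 / 43 * s <= (mean_slope - far_defect - excess) * s :=
    ler_wpM2r (ler0n _ _) c3.
  move: h h2; set a := far_defect; set b := excess; set m := mean_slope; clear; lra.
exact: (far_count M_gt0 s1 k110' kb hW le_nN (lexx _) hS eb).
Qed.

Lemma profile_low (i : nat) (x : rat) : (i <= 450)%N -> i%:R <= x -> x <= i%:R + 1 -> 0 < x ->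
  ratZ weight_scale * (mean_slope * x - low_defect) <= hat_sum table_weight i x /\
  wsum table_error i <= ratZ weight_scale * (23 / 10 * i%:R).
Proof.
move=> le_i le_ix le_xi x_gt0; have M_gt0 := weight_scale_gt0.
case: (posnP i) => [i0|i_gt0]; last first.
  have ir : (0 < i <= 450)%N by rewrite i_gt0.
  by have [h _ _ h'] := profileP ir le_ix le_xi; split; [exact: h | exact: h'].
rewrite {}i0 add0r in le_xi *; rewrite hat_sum0 /wsum big_geq ?mulr0; last by [].
split; last exact: lexx.
apply: mulr_ge0_le0; first exact: ltW.
rewrite subr_le0; have C_gt0 := ratZ_pos_gt0 10000.
have th_ge0 : 0 <= mean_slope by exact: divr_ge0 (ltW (ratZ_pos_gt0 _)) (ltW C_gt0).
apply: le_trans (ler_wpM2l th_ge0 le_xi) _; rewrite mulr1.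
by rewrite /mean_slope /low_defect ler_pM2r ?invr_gt0 ?le_ratZ.
Qed.

(** Either side may be short, so only [low_defect] is at hand. It is lost just twice, at most
    [2 / 3] in all, against a main term of [3 / 10 * s] with [s >= 110]. *)
Lemma in_far (N n A B : rat) (j l : nat) : (110 <= j + l + 1 <= 450)%N ->
  j%:R <= A -> A <= j%:R + 1 -> 0 < A -> 0 < B -> A + B = (j + l + 1)%:R ->
  3 * (j + l + 1)%:R ^+ 2 <= 4 * N -> n <= N ->
  n + 13 <= 4 * ((N / (j + l + 1)%:R * hat_sum table_weight j A - wsum table_error j) / ratZ weight_scale +
                 (N / (j + l + 1)%:R * hat_sum table_weight l B - wsum table_error l) / ratZ weight_scale + 1).
Proof.
move=> /andP[s110 s450] le_j le_A A_gt0 B_gt0 AB hW le_nN.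
have le_r : 12 / 43 <= 29 / 100 :> rat by lra.
have r_ge0 : 0 <= 23 / 10 :> rat by lra.
have [c1 c2 c3 c4] := profile_constants; have M_gt0 := weight_scale_gt0.
have sE : (j + l + 1)%:R = j%:R + l%:R + 1 :> rat by rewrite !natrD.
have j450 : (j <= 450)%N by apply: leq_trans s450; rewrite -addnA leq_addr.
have l450 : (l <= 450)%N by apply: leq_trans s450; rewrite addnAC leq_addl.
have le_l : l%:R <= B by lra.
have le_B : B <= l%:R + 1 by lra.
have [lA eA] := profile_low j450 le_j le_A A_gt0.
have [lB eB] := profile_low l450 le_l le_B B_gt0.
set s := (j + l + 1)%:R in AB hW sE *.
have s110' : (110 : rat) <= s by rewrite (ler_nat _ 110).
have s_gt0 : 0 < s := lt_le_trans (ltr0n _ 110) s110'.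
have hS : ratZ weight_scale * (29 / 100 * s) <= hat_sum table_weight j A + hat_sum table_weight l B.
  apply: le_trans (lerD lA lB); rewrite -mulrDr (ler_pM2l M_gt0).
  have -> : mean_slope * A - low_defect + (mean_slope * B - low_defect) =
    mean_slope * s - 2 * low_defect by rewrite -AB; ring.
  have h : 3 / 10 * s <= mean_slope * s by apply: ler_wpM2r c1; exact: ltW.
  lra.
have s1 : 1 <= s by apply: le_trans s110'; rewrite (ler_nat _ 1 110).
have hE : wsum table_error j + wsum table_error l <= ratZ weight_scale * (23 / 10 * s).
  apply: le_trans (lerD eA eB) _; rewrite -mulrDr (ler_pM2l M_gt0) -mulrDr.
  by apply: (ler_wpM2l r_ge0); rewrite sE lerDl ler01.
apply: le_trans (far_count M_gt0 s1 s110' (lexx s) hW le_nN le_r hS hE) _.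
exact: two_sides.
Qed.

(** * A narrow direction *)

(** A multiple of [(s, p)] is added to a Bezout pair. The sign of [e] keeps the intervals of
    [side_points] among the nonnegative numbers, as [line_bound] requires. *)
Lemma bezout_nonneg (p s : nat) (eps : int) : (0 < s)%N -> coprime p s ->
  exists e f : int, 0 <= e /\ p%:Z * e - s%:Z * f = eps.
Proof.
move=> s_gt0 cop; have [u [v uv]] := Bezoutz p%:Z s%:Z.
have g1 : gcdz p%:Z s%:Z = 1 by rewrite /gcdz !absz_nat (eqP cop).
rewrite {}g1 in uv.
exists (u * eps + `|u * eps| * s%:Z), (- (v * eps) + `|u * eps| * p%:Z); split.
  have : - `|u * eps| <= u * eps by rewrite lerNl -normrN ler_norm.
  have : `|u * eps| * 1 <= `|u * eps| * s%:Z by rewrite ler_wpM2l // lez_nat.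
  lra.
have -> : p%:Z * (u * eps + `|u * eps| * s%:Z) - s%:Z * (- (v * eps) + `|u * eps| * p%:Z) =
  (u * p%:Z + v * s%:Z) * eps by ring.
by rewrite uv mul1r.
Qed.

(* [narrow N c p s W]: the window [(c/N, (c+1)/N)] meets the lines parallel to [(p, s)]
   in a strip of width at most [W]. *)
Definition narrow (N c : rat) (p s : nat) (W : rat) : Prop :=
  (0 <= s%:R * c - p%:R * N /\ W = s%:R * c - p%:R * N + s%:R) \/
  [/\ s%:R * c < p%:R * N, (1 < s)%N, p%:R * N - s%:R * c <= W, s%:R <= W &
   W = p%:R * N - s%:R * c \/ W = s%:R].

(** As [r >= W] and both [sr] and [tau] are at least [W - sl], one has [N >= sl * W + (W - sl) ^ 2]
    if [sl < W], and the minimum over [sl] is [3 / 4 * W ^ 2], at [sl = W / 2]. *)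
Lemma three_widths (N tau sl r sr W : rat) : 0 <= tau -> 0 <= sl -> 0 <= sr -> N = sl * r + sr * tau ->
  0 < W -> W <= r -> W <= sl + sr -> W <= tau + sl -> 3 * W ^+ 2 <= 4 * N.
Proof.
move=> tau0 sl0 sr0 -> W0 Wr Ws Wt; rewrite expr2.
have h1 : sl * W <= sl * r by rewrite ler_wpM2l.
have [le_W|lt_W] := leP W sl.
  have h2 : W * W <= sl * W by rewrite ler_wpM2r // ltW.
  have h3 : 0 <= sr * tau by rewrite mulr_ge0.
  have h4 : 0 <= W * W by rewrite mulr_ge0 // ltW.
  lra.
have h2 : (W - sl) * (W - sl) <= sr * tau by apply: ler_pM; lra.
have := sqr_ge0 (W - 2 * sl); rewrite expr2; lra.
Qed.

Lemma coprime_det (a b c d : nat) : (a * d = b * c + 1)%N -> coprime b d && coprime a c.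
Proof.
move=> det; apply/andP; split.
  have : coprime b (a * d) by rewrite det mulnC /coprime gcdnMDl gcdn1.
  by rewrite coprimeMr => /andP[].
have : coprime c (a * d) by rewrite det /coprime gcdnMDl gcdn1.
by rewrite coprimeMr coprime_sym => /andP[].
Qed.

(** Stern-Brocot descent between neighbours [pl / sl <= c / N] and [pr / sr >= (c + 1) / N] until
    the mediant falls strictly inside the window. The strips along the left, right and middle
    directions then have widths [tau + sl], [rho] and [sl + sr], and [three_widths] applies to the
    smallest of them. *)
Lemma narrow_direction (n c : rat) : 0 <= c -> c <= n - 2 ->
  exists p s W, [/\ (0 < s)%N, coprime p s, (p < s)%N, narrow (n + c) c p s W &
    3 * W ^+ 2 <= 4 * (n + c)].
Proof.
move=> c_ge0 le_c; set N := n + c; have N_gt0 : 0 < N by rewrite /N; lra.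
suff: forall m (pl sl pr sr : nat), (Num.truncn (2 * N) < m + (sl + sr))%N ->
    (0 < sl)%N -> (1 < sr)%N -> (pl < sl)%N -> (pr < sr)%N -> (pr * sl = pl * sr + 1)%N ->
    0 <= sl%:R * c - pl%:R * N -> sr%:R <= pr%:R * N - sr%:R * c ->
  exists p s W, [/\ (0 < s)%N, coprime p s, (p < s)%N, narrow N c p s W & 3 * W ^+ 2 <= 4 * N].
  move=> /(_ (Num.truncn (2 * N)) 0%N 1%N 1%N 2%N); apply=> //.
  - by rewrite addn3 ltnS leqW // leqW.
  - by rewrite mul1r mul0r subr0.
  - by rewrite /N mul1r; lra.
clearbody N; elim=> [|m IHm] pl sl pr sr fuel sl0 sr1 lt_l lt_r det tau0 rho0.
all: have detR : pr%:R * sl%:R = pl%:R * sr%:R + 1 :> rat by rewrite -!natrM det natrD.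
all: have slR : (1 : rat) <= sl%:R by rewrite ler1n.
all: have srR : (2 : rat) <= sr%:R by rewrite (ler_nat _ 2).
all: set tau := sl%:R * c - pl%:R * N in tau0; set rho := pr%:R * N - sr%:R * c in rho0.
all: have NE : N = sl%:R * rho + sr%:R * tau by
  have := congr1 ( *%R N) detR; rewrite /rho /tau; lra.
  (* The fuel cannot run out: [N = sl * rho + sr * tau] with [rho >= sr] keeps [sl + sr] below
     [2 * N]. *)
  have h1 : sl%:R * rho <= N by rewrite NE lerDl mulr_ge0.
  have h2 : sl%:R * 2 <= sl%:R * rho by rewrite ler_wpM2l //; lra.
  have h3 : 1 * sr%:R <= sl%:R * rho by rewrite ler_pM.
  have : (sl + sr)%:R <= 2 * N by rewrite natrD; lra.
  move=> h; have N2 : 0 <= 2 * N by lra.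
  by move: fuel; rewrite add0n ltnNge truncn_ge_nat // h.
have /andP[copl copr] := coprime_det det.
have detL : ((pl + pr) * sl = pl * (sl + sr) + 1)%N by rewrite mulnDl mulnDr det addnA.
have detM : (pr * (sl + sr) = (pl + pr) * sr + 1)%N.
  by rewrite mulnDr mulnDl det addnAC.
have /andP[_ copm] := coprime_det detL.
have lt_m : (pl + pr < sl + sr)%N by rewrite -addSn leq_add // ltnW.
have m_gt1 : (1 < sl + sr)%N by rewrite (leq_trans sr1) ?leq_addl.
have fuelL : (Num.truncn (2 * N) < m + (sl + sr + sr))%N.
  by apply: leq_trans fuel _; rewrite addSnnS leq_add2l -addn1 leq_add2l ltnW.
have fuelR : (Num.truncn (2 * N) < m + (sl + (sl + sr)))%N.
  by apply: leq_trans fuel _; rewrite addSnnS leq_add2l -add1n leq_add2r.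
have mR : (sl + sr)%:R = sl%:R + sr%:R :> rat by rewrite natrD.
have pR : (pl + pr)%:R = pl%:R + pr%:R :> rat by rewrite natrD.
have tauM : (sl + sr)%:R * c - (pl + pr)%:R * N = tau - rho by rewrite mR pR /tau /rho; ring.
have [le_rt|lt_tr] := leP rho tau.
  apply: (IHm (pl + pr)%N (sl + sr)%N pr sr) => //; first exact: ltnW.
  by rewrite tauM subr_ge0.
have rhoM : (pl + pr)%:R * N - (sl + sr)%:R * c = rho - tau by rewrite -opprB tauM opprB.
have [le_m|gt_m] := leP (sl + sr)%:R (rho - tau).
  by apply: (IHm pl sl (pl + pr)%N (sl + sr)%N) => //; rewrite rhoM.
have rho_gt0 : 0 < rho := lt_le_trans (lt_le_trans (ltr0n _ 2) srR) rho0.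
have key W : 0 < W -> W <= rho -> W <= (sl + sr)%:R -> W <= tau + sl%:R -> 3 * W ^+ 2 <= 4 * N.
  by rewrite mR; apply: (three_widths tau0 (ler0n _ _) (ler0n _ _) NE).
have right : rho <= (sl + sr)%:R -> rho <= tau + sl%:R ->
  exists p s W, [/\ (0 < s)%N, coprime p s, (p < s)%N, narrow N c p s W & 3 * W ^+ 2 <= 4 * N].
  move=> h1 h2; exists pr, sr, rho; split=> //; [exact: ltnW | | exact: key].
  by right; split=> //; [rewrite -subr_gt0 | left].
have left : tau + sl%:R <= (sl + sr)%:R -> tau + sl%:R <= rho ->
  exists p s W, [/\ (0 < s)%N, coprime p s, (p < s)%N, narrow N c p s W & 3 * W ^+ 2 <= 4 * N].
  move=> h1 h2; exists pl, sl, (tau + sl%:R); split=> //; [by left | apply: key => //].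
  by rewrite ltr_wpDl // ltr0n.
have [h1|h1] := leP rho (sl + sr)%:R.
  have [h2|h2] := leP rho (tau + sl%:R); first exact: right.
  by apply: left; [apply: le_trans h1 |]; exact: ltW.
have [h3|h3] := leP (sl + sr)%:R (tau + sl%:R); last first.
  by apply: left; [exact: ltW | exact: ltW (lt_trans h3 h1)].
exists (pl + pr)%N, (sl + sr)%N, (sl + sr)%:R; split=> //; first exact: ltnW.
  right; split=> //; last by right.
    by rewrite -subr_gt0 rhoM subr_gt0.
  by rewrite rhoM ltW.
by apply: key => //; [rewrite ltr0n ltnW | exact: ltW].
Qed.

(* [4 * U n <= n + 13]. *)
Definition rich (N c n : rat) : Prop := exists L : seq (int * int),
  [/\ uniq L, all (in_window N c) L & n + 13 <= 4 * (size L)%:R].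

(** * From a narrow strip to enough fractions *)

Lemma side_bound_rich (M : rat) (w er : nat -> rat) (N c n al be : rat) (eps : int) (p s T j : nat) :
  0 < M -> (forall t, (0 < t)%N -> line_bound (w t / M) (er t / M) t) ->
  0 < N -> (0 < s)%N -> coprime p s -> (eps == 1) || (eps == -1) ->
  (eps = 1 -> be = s%:R * c - p%:R * N + s%:R) ->
  (eps = -1 -> be = p%:R * N - s%:R * c) ->
  al = be - s%:R -> 0 < be -> T%:R <= be -> (j <= T)%N -> al < j%:R + 1 ->
  (0 < j)%N ==> (j%:R <= al) ->
  n + 13 <= 4 * ((N / s%:R * (hat_sum w T be - hat_sum w j al) - wsum er T) / M) ->
  rich N c n.
Proof.
move=> M0 lineP N0 s0 cop epsP be1 be2 al_def be0 le_T le_jT lt_al le_al hn.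
have [e [f [e0 bez]]] := bezout_nonneg eps s0 cop.
have [L [uL aL szL]] := side_count M0 lineP N0 s0 e0 bez epsP be1 be2 al_def be0 le_T le_jT lt_al le_al.
exists L; split=> //; first by apply: sub_all aL => z /andP[].
by apply: le_trans hn _; rewrite ler_pM2l.
Qed.

(** Here [(p, s)] lies strictly inside the window, and the lines on both sides of it contribute. On
    each side the offsets start at 0, so no second hat is subtracted; the final 1 is the point
    [(p, s)]. *)
Lemma two_sides_rich (M : rat) (w er : nat -> rat) (N c n A B : rat) (p s j l : nat) :
  0 < M -> (forall t, (0 < t)%N -> line_bound (w t / M) (er t / M) t) ->
  s%:R < N -> (0 < s)%N -> coprime p s ->
  A = p%:R * N - s%:R * c -> B = s%:R * c - p%:R * N + s%:R -> 0 < A -> 0 < B ->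
  j%:R <= A -> l%:R <= B ->
  n + 13 <= 4 * ((N / s%:R * hat_sum w j A - wsum er j) / M +
                 (N / s%:R * hat_sum w l B - wsum er l) / M + 1) ->
  rich N c n.
Proof.
move=> M0 lineP ltN s0 cop def_A def_B A0 B0 le_j le_l hn.
have s0' : (0 : rat) < s%:R by rewrite ltr0n.
have N0 : 0 < N := lt_trans s0' ltN.
have [e [f [e0 bez]]] := bezout_nonneg 1 s0 cop.
have [e' [f' [e0' bez']]] := bezout_nonneg (-1) s0 cop.
have AB : A + B = s%:R by rewrite def_A def_B; ring.
have al1 : B - s%:R < 0%:R + 1 by lra.
have al2 : A - s%:R < 0%:R + 1 by lra.
have hat00 x : hat_sum w 0 x = 0 by rewrite /hat_sum /wsum !big_geq // mul0r subr0.
have ne1 : (1 : int) = -1 -> B = p%:Z%:~R * N - s%:R * c by [].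
have ne2 : (-1 : int) = 1 -> A = s%:R * c - p%:Z%:~R * N + s%:R by [].
have [L1 [u1 a1 z1]] := side_count M0 lineP N0 s0 e0 bez isT (fun _ => def_B) ne1 erefl B0
  le_l (leq0n _) al1 isT.
have [L2 [u2 a2 z2]] := side_count M0 lineP N0 s0 e0' bez' isT ne2 (fun _ => def_A) erefl A0
  le_j (leq0n _) al2 isT.
rewrite !hat00 !subr0 in z1 z2.
exists ((p%:Z, s%:Z) :: L1 ++ L2); split.
- rewrite /= mem_cat cat_uniq u1 u2 andbT negb_or /=; apply/andP; split; first (apply/andP; split).
  + by apply/negP => /(allP a1) /andP[_] /=; rewrite [p%:Z * _]mulrC subrr mulr0 ltxx.
  + by apply/negP => /(allP a2) /andP[_] /=; rewrite [p%:Z * _]mulrC subrr mulr0 ltxx.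
  apply/hasPn => z /(allP a2) /andP[_ h2]; apply/negP => /(allP a1) /andP[_ h1].
  by move: h1 h2; rewrite mul1r mulN1r oppr_gt0 => h1; rewrite ltNge (ltW h1).
- rewrite /= all_cat; apply/and3P; split.
  + rewrite /in_window /= /coprimez /gcdz !absz_nat (eqP cop) eqxx /=.
    rewrite ltN andbT; apply/andP; split.
      by rewrite -subr_gt0 mulrC; move: A0; rewrite def_A mulrC [s%:R * _]mulrC; lra.
    by move: B0; rewrite def_B; lra.
  + by apply: sub_all a1 => z /andP[].
  + by apply: sub_all a2 => z /andP[].
- apply: le_trans hn _; rewrite ler_pM2l //= size_cat -natr1 natrD lerD2r.
  by rewrite addrC lerD.
Qed.

Lemma real_cell (al be : rat) (s : nat) : 0 <= al -> be = al + s%:R ->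
  exists j, [/\ j%:R <= al, al < j%:R + 1, (j + s)%:R <= be & be < (j + s)%:R + 1].
Proof.
move=> al0 ->; have /andP[h1 h2] := truncn_itv al0; exists (Num.truncn al).
rewrite natr1; split=> //; first by rewrite natrD lerD2r.
by rewrite natrD -natr1 in h2 *; rewrite addrAC ltrD2r.
Qed.

Lemma nth_take_table p0 m k : (k < m)%N -> nth p0 (take m table) k = nth p0 table k.
Proof. by move=> h; rewrite nth_take. Qed.

Lemma size_take_table m : (m <= 451)%N -> size (take m table) = m.
Proof. by move=> h; rewrite size_take_min size_prefix_sums; apply/minn_idPl. Qed.

Section Side.
Variables (N c n al be : rat) (eps : int) (p s : nat).
Hypotheses (N_gt0 : 0 < N) (s_gt0 : (0 < s)%N) (cop : coprime p s)
  (epsP : (eps == 1) || (eps == -1))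
  (be1 : eps = 1 -> be = s%:R * c - p%:R * N + s%:R)
  (be2 : eps = -1 -> be = p%:R * N - s%:R * c)
  (al_def : al = be - s%:R) (al_ge0 : 0 <= al) (width : 3 * be ^+ 2 <= 4 * N).

(** In this section [p / s] is not inside the window: it lies to the left if [eps = 1] and to the
    right if [eps = -1], and the strip consists of the offsets between [al] and [be]. *)
Lemma side_rich (j : nat) : j%:R <= al -> al < j%:R + 1 ->
  n + 13 <= 4 * ((N / s%:R * (hat_sum table_weight (j + s) be - hat_sum table_weight j al) - wsum table_error (j + s)) /
    ratZ weight_scale) -> rich N c n.
Proof.
move=> le_j lt_j; have be_gt0 : 0 < be.
  have -> : be = al + s%:R by rewrite al_def subrK.
  by rewrite ltr_wpDl // ltr0n.
have le_T : (j + s)%:R <= be by rewrite natrD -lerBrDr -al_def.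
apply: (side_bound_rich weight_scale_gt0 line_bound_table N_gt0 s_gt0 cop epsP be1 be2 al_def be_gt0 le_T
  (leq_addr _ _) lt_j).
by rewrite le_j implybT.
Qed.

Lemma side_rich_table (N0 : Z) th m (j : nat) :
  all_near m (out_check N0 th) 0 (take m table) -> (m <= 451)%N ->
  0 < ratZ N0 -> ratZ N0 <= N -> (j + s < m)%N -> j%:R <= al -> al < j%:R + 1 ->
  ~~ ((s == 1%N) && ((j == 0%N) || isSome th)) ->
  (let: (num, den, ex) := out_cap th (Z.of_nat s) (Z.of_nat j) in
   0 < ratZ den /\ ratZ den * (ratZ weight_scale * n) <= ratZ weight_scale * N * ratZ num + ratZ ex) ->
  rich N c n.
Proof.
move=> tab le_m N0_gt0 le_N lt_m le_j lt_j not1 cap.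
have lt_jm : (j < m)%N by apply: leq_ltn_trans lt_m; rewrite leq_addr.
have szT := size_take_table le_m.
have := @all_nearP m _ 0 _ (Z0, Z0, Z0) j (j + s) tab.
rewrite szT leq_addr /= !add0n !nth_take_table // => /(_ lt_m).
have -> : (j + s < j + m)%N by rewrite ltn_add2l (leq_ltn_trans _ lt_m) // leq_addl.
move=> /(_ isT).
have kj : Z.sub (Z.of_nat (j + s)) (Z.of_nat j) = Z.of_nat s by clear; lia.
rewrite /out_check kj => /or3P[|/andP[s1 j1]|ok].
- by move=> /Z.leb_le h; exfalso; move: s_gt0 h; clear; lia.
- exfalso; move: not1; suff -> : (s == 1%N) && ((j == 0%N) || isSome th) by [].
  by move: s1 j1; clear; case: th => [[? ?]|] /=; lia.
have le451 k : (k < m)%N -> (k <= 450)%N by move=> h; rewrite -ltnS (leq_trans h).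
apply: (side_rich le_j lt_j).
have sE : (j + s - j = s)%N by rewrite addKn.
have /= := @out_okP N0 th j (j + s) _ _ N n al be (table_prefix (Z0, Z0, Z0) (le451 _ lt_jm))
  (table_prefix (Z0, Z0, Z0) (le451 _ lt_m)) _ ok N0_gt0 le_N width.
rewrite sE; apply=> //; last by rewrite al_def subrK.
by rewrite -[X in (X < _)%N]addn0 ltn_add2l.
Qed.

Lemma side_rich_far (j : nat) : (110 <= j + s <= 450)%N -> j%:R <= al -> al < j%:R + 1 -> n <= N ->
  rich N c n.
Proof.
move=> hk le_j lt_j le_n; apply: (side_rich le_j lt_j).
have sE : (j + s - j = s)%N by rewrite addKn.
have def_be : be = al + (j + s - j)%:R by rewrite sE al_def subrK.
have lt_jk : (j < j + s)%N by rewrite -[X in (X < _)%N]addn0 ltn_add2l.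
by have := out_far lt_jk hk le_j lt_j def_be width le_n; rewrite sE.
Qed.

End Side.

Section Both.
Variables (N c n A B : rat) (p s : nat).
Hypotheses (s_gt3 : (3 < s)%N) (cop : coprime p s)
  (def_A : A = p%:R * N - s%:R * c) (def_B : B = s%:R * c - p%:R * N + s%:R)
  (A_gt0 : 0 < A) (B_gt0 : 0 < B) (width : 3 * s%:R ^+ 2 <= 4 * N).

Lemma both_lt : s%:R < N.
Proof.
have s4 : (4 : rat) <= s%:R by rewrite (ler_nat _ 4).
by move: width; rewrite expr2; nra.
Qed.

Lemma both_cell : exists j l, [/\ (j + l + 1 = s)%N, j%:R <= A, A <= j%:R + 1, l%:R <= B & B <= l%:R + 1].
Proof.
have AB : A + B = s%:R by rewrite def_A def_B; ring.
have /andP[h1 h2] := truncn_itv (ltW A_gt0); set j := Num.truncn A in h1 h2.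
rewrite -natr1 in h2.
have lt_js : (j < s)%N by rewrite -(ltr_nat rat); apply: le_lt_trans h1 _; rewrite -AB ltrDl.
exists j, (s - j.+1)%N; have sE : (j + (s - j.+1) + 1 = s)%N by rewrite addn1 -addSn subnKC.
have sR : s%:R = j%:R + (s - j.+1)%:R + 1 :> rat by rewrite -{1}sE !natrD.
rewrite sR in AB; split=> //; first exact: ltW.
  by rewrite -(lerD2l A) AB addrAC lerD2r ltW.
by rewrite -(lerD2l A) AB -addrA lerD2r.
Qed.

Lemma both_rich (j l : nat) : j%:R <= A -> l%:R <= B ->
  n + 13 <= 4 * ((N / s%:R * hat_sum table_weight j A - wsum table_error j) / ratZ weight_scale +
                 (N / s%:R * hat_sum table_weight l B - wsum table_error l) / ratZ weight_scale + 1) ->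
  rich N c n.
Proof.
have s_gt0 : (0 < s)%N by apply: leq_trans s_gt3.
exact: (two_sides_rich weight_scale_gt0 line_bound_table both_lt s_gt0 cop def_A def_B A_gt0 B_gt0).
Qed.

Lemma both_rich_table (N0 : Z) th m :
  all_near m (in_check N0 th) 0 (take m table) -> (m <= 451)%N ->
  0 < ratZ N0 -> ratZ N0 <= N -> (s <= m)%N ->
  (let: (num, den, ex) := in_cap th (Z.of_nat s) in
   0 < ratZ den /\ ratZ den * (ratZ weight_scale * n) <= ratZ weight_scale * N * ratZ num + ratZ ex) ->
  rich N c n.
Proof.
move=> tab le_m N0_gt0 le_N le_sm cap.
have [j [l [sE le_j le_A le_l le_B]]] := both_cell.
have AB : A + B = s%:R by rewrite def_A def_B; ring.
have le451 k : (k < m)%N -> (k <= 450)%N by move=> h; rewrite -ltnS (leq_trans h).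
have szT := size_take_table le_m.
have ltm (i i' : nat) : (i + i' + 1 = s)%N -> (i < m)%N.
  by move=> h; apply: leq_trans le_sm; rewrite -h addn1 ltnS leq_addr.
have okP (i i' : nat) : (i + i' + 1 = s)%N -> (i <= i')%N ->
    in_ok N0 th (Z.of_nat i) (nth (Z0, Z0, Z0) table i) (Z.of_nat i') (nth (Z0, Z0, Z0) table i')
    /\ (0 < i')%N.
  move=> iE le_ii; have lt_i := ltm _ _ iE; have lt_i' : (i' < m)%N.
    by apply: (ltm _ i); rewrite [(i' + i)%N]addnC.
  have := @all_nearP m _ 0 _ (Z0, Z0, Z0) i i' tab.
  rewrite szT le_ii lt_i' !add0n !nth_take_table // => /(_ isT).
  rewrite (leq_trans lt_i') ?leq_addl // => /(_ isT); rewrite /in_check => /orP[|ok].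
    by move=> h; exfalso; move: iE s_gt3 h; clear; lia.
  by split=> //; move: iE s_gt3 le_ii; clear; lia.
have width' : 3 * (j + l + 1)%:R ^+ 2 <= 4 * N by rewrite sE.
have pre k : (k < m)%N -> prefix_ok k (nth (Z0, Z0, Z0) table k).
  by move=> h; apply: table_prefix; apply: le451.
have sE' : (l + j + 1 = s)%N by rewrite [(l + j)%N]addnC.
(* The table covers pairs with [j <= l]; the other case exchanges the two sides. *)
apply: (both_rich le_j le_l); have [le_jl|lt_lj] := leqP j l.
  have [ok l_gt0] := okP j l sE le_jl; rewrite -sE.
  apply: (in_okP (pre j (ltm _ _ sE)) (pre l (ltm _ _ sE')) l_gt0 ok N0_gt0 le_N width'
    _ A_gt0 B_gt0 le_j le_A); rewrite sE //.
have [ok j_gt0] := okP l j sE' (ltnW lt_lj).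
rewrite [X in X + 1]addrC -sE'.
by apply: (in_okP (pre l (ltm _ _ sE')) (pre j (ltm _ _ sE)) j_gt0 ok N0_gt0 le_N _
    _ B_gt0 A_gt0 le_l le_B); rewrite sE' // addrC.
Qed.

Lemma both_rich_far : (110 <= s <= 450)%N -> n <= N -> rich N c n.
Proof.
move=> hs le_n; have [j [l [sE le_j le_A le_l le_B]]] := both_cell.
have AB : A + B = (j + l + 1)%:R by rewrite sE def_A def_B; ring.
have w := width; apply: (both_rich le_j le_l); rewrite -sE in hs w *.
exact: in_far hs le_j le_A A_gt0 B_gt0 AB w le_n.
Qed.

End Both.

(** * Strips of large width *)

(* [saw x] is the value of [\sum_(t > 0) hat x t]. *)
Definition saw (x : rat) : rat := (Num.truncn x)%:R - (Num.truncn x)%:R * ((Num.truncn x)%:R + 1) / 2 / x.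

Lemma sawE (x : rat) (m : nat) : m%:R <= x -> x < m%:R + 1 -> saw x = m%:R - m%:R * (m%:R + 1) / 2 / x.
Proof.
move=> h1 h2; rewrite /saw (_ : Num.truncn x = m) //.
by apply: truncn_def; rewrite h1 -natr1.
Qed.

Lemma saw_cell (x : rat) : 0 <= x -> exists m : nat, [/\ m%:R <= x, x < m%:R + 1 &
  saw x = m%:R - m%:R * (m%:R + 1) / 2 / x].
Proof.
move=> x0; have /andP[h1 h2] := truncn_itv x0; rewrite -natr1 in h2.
by exists (Num.truncn x).
Qed.

Lemma saw_lower (x : rat) : 0 < x -> (x - 1) / 2 <= saw x.
Proof.
move=> x0; have [m [h1 h2 ->]] := saw_cell (ltW x0).
have h : 0 <= (x - m%:R) * (m%:R + 1 - x) by rewrite mulr_ge0; lra.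
rewrite -subr_ge0; have -> : m%:R - m%:R * (m%:R + 1) / 2 / x - (x - 1) / 2 =
  (x - m%:R) * (m%:R + 1 - x) / (2 * x) by field; rewrite gt_eqF.
by rewrite divr_ge0 // mulr_ge0 // ltW.
Qed.

Lemma saw_upper (x : rat) : 0 < x -> saw x <= x / 2.
Proof.
move=> x0; have [m [h1 h2 ->]] := saw_cell (ltW x0).
rewrite -subr_ge0; have -> : x / 2 - (m%:R - m%:R * (m%:R + 1) / 2 / x) =
  ((x - m%:R) ^+ 2 + m%:R) / (2 * x) by field; rewrite gt_eqF.
by rewrite divr_ge0 ?addr_ge0 ?sqr_ge0 ?ler0n // mulr_ge0 // ltW.
Qed.

Lemma saw0 : saw 0 = 0.
Proof. by rewrite (@sawE 0 0) ?ltr01 // mul0r mul0r mul0r subr0. Qed.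

(** The error has to be proportional to [x - y]: this difference will be [s / d], the estimate gets
    multiplied by [N / s], and [s] may be 1. Combining [saw_upper] and [saw_lower] would leave a
    constant error. *)
Lemma saw_diff_upper (x y : rat) : 0 <= y -> y <= x -> 0 < x ->
  saw x - saw y <= (x - y) / 2 + (x - y) / (2 * x).
Proof.
move=> y0 le_yx x0; have [y00|yp] := eqVneq y 0.
  rewrite y00 saw0 !subr0; apply: le_trans (saw_upper x0) _.
  by rewrite lerDl divr_ge0 ?mulr_ge0 // ltW.
have {yp}y_gt0 : 0 < y by rewrite lt_neqAle eq_sym yp.
have [m [h1 h2 E]] := saw_cell (ltW x0).
have [le_my|lt_ym] := leP m%:R y.
  rewrite E (sawE le_my) ?(le_lt_trans le_yx) // -subr_ge0.
  have -> : (x - y) / 2 + (x - y) / (2 * x) -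
    (m%:R - m%:R * (m%:R + 1) / 2 / x - (m%:R - m%:R * (m%:R + 1) / 2 / y)) =
    (x - y) * ((x + 1) * y - m%:R * (m%:R + 1)) / (2 * x * y) by field; rewrite !gt_eqF.
  apply: divr_ge0; last by rewrite !mulr_ge0 // ltW.
  apply: mulr_ge0; first by rewrite subr_ge0.
  rewrite subr_ge0 mulrC; apply: ler_pM => //; first by rewrite addr_ge0 ?ler0n.
  by rewrite lerD2r.
have h := saw_lower y_gt0.
have h3 : saw x <= (x - 1) / 2 + (x - y) / (2 * x); last first.
  by apply: le_trans (lerB h3 h) _; rewrite le_eqVlt; apply/orP; left; apply/eqP; field; rewrite gt_eqF.
rewrite E -subr_ge0.
have -> : (x - 1) / 2 + (x - y) / (2 * x) - (m%:R - m%:R * (m%:R + 1) / 2 / x) =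
  ((x - m%:R) ^+ 2 + (m%:R - y)) / (2 * x) by field; rewrite gt_eqF.
apply: divr_ge0; last by rewrite mulr_ge0 // ltW.
by apply: addr_ge0; [exact: sqr_ge0 | rewrite subr_ge0 ltW].
Qed.

Lemma saw_diff_lower (al : rat) (s : nat) : 0 <= al -> (0 < s)%N ->
  s%:R / 2 - s%:R / (2 * (al + s%:R)) <= saw (al + s%:R) - saw al.
Proof.
move=> al0 s0; have sR : (1 : rat) <= s%:R by rewrite ler1n.
have [al00|alp] := eqVneq al 0.
  have s_gt0 : (0 : rat) < s%:R by rewrite ltr0n.
  rewrite al00 add0r saw0 subr0; apply: le_trans (saw_lower s_gt0).
  by rewrite le_eqVlt; apply/orP; left; apply/eqP; field; rewrite gt_eqF.
have al_gt0 : 0 < al by rewrite lt_neqAle eq_sym alp.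
have [m [h1 h2 E]] := saw_cell al0.
have b_gt0 : 0 < al + s%:R by lra.
rewrite E (@sawE (al + s%:R) (m + s)) ?natrD ?lerD2r //; last by rewrite addrAC ltrD2r.
rewrite -subr_ge0.
have -> : m%:R + s%:R - (m%:R + s%:R) * (m%:R + s%:R + 1) / 2 / (al + s%:R) -
   (m%:R - m%:R * (m%:R + 1) / 2 / al) - (s%:R / 2 - s%:R / (2 * (al + s%:R))) =
   s%:R * (al - (al - m%:R) * (1 - (al - m%:R))) / (2 * al * (al + s%:R)).
  by field; rewrite !gt_eqF.
have f0 : 0 <= al - m%:R by lra.
have ff : (al - m%:R) * (1 - (al - m%:R)) <= (al - m%:R) * 1 by rewrite ler_wpM2l //; lra.
have m0 : (0 : rat) <= m%:R by rewrite ler0n.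
apply: divr_ge0; last by rewrite !mulr_ge0 // ltW.
by apply: mulr_ge0; lra.
Qed.

Lemma hat_sum_saw (x : rat) (T : nat) : 0 < x -> (Num.truncn x <= T)%N ->
  \sum_(1 <= i < T.+1) hat x i = saw x.
Proof.
move=> x0 le_T; have [m [h1 h2 E]] := saw_cell (ltW x0).
have mE : Num.truncn x = m by apply: truncn_def; rewrite h1 -natr1.
rewrite mE in le_T; rewrite E.
under eq_bigr do rewrite -[hat x _]mul1r.
have [m0|m_gt0] := posnP m; last first.
  rewrite (@wsum_hat (fun=> 1) T m x) // /wsum; congr (_ - _ / _).
    by rewrite big_const_nat subn1 /= iter_addr addr0.
  elim: m {h1 h2 E mE le_T m_gt0} => [|m IHm]; first by rewrite big_geq // mul0r mul0r.
  by rewrite big_nat_recr //= IHm -natr1; field.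
by rewrite (@wsum_hat0 (fun=> 1)) ?m0 ?mul0r ?subr0 // -[1]add0r -[0]/(0%:R) -m0.
Qed.

Lemma sum_multiples (g : nat -> rat) (d T : nat) : (0 < d)%N ->
  \sum_(1 <= t < T.+1 | (d %| t)%N) g t = \sum_(1 <= i < (T %/ d).+1) g (d * i)%N.
Proof.
move=> d0; elim: T => [|T IHT]; first by rewrite div0n !big_geq.
rewrite big_mkcond big_nat_recr //= -big_mkcond IHT divnS //.
case: ifP => [/dvdnP[q Tq]|_]; last by rewrite add0n addr0.
have qE : (T %/ d).+1 = q by have := divnS T d0; rewrite Tq dvdn_mull // mulnK.
by rewrite add1n qE big_nat_recr -?qE //= qE mulnC -Tq.
Qed.

Lemma hat_mul (x : rat) (d i : nat) : (0 < d)%N -> hat x (d * i) = hat (x / d%:R) i.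
Proof.
move=> d0; have d0' : (0 : rat) < d%:R by rewrite ltr0n.
rewrite /hat natrM ler_pdivlMr // [_ * d%:R]mulrC; case: ifP => // _.
by rewrite invf_div mulrA [i%:R * _]mulrC.
Qed.

Lemma hat_sum_saw0 (x : rat) (T : nat) : 0 <= x -> (Num.truncn x <= T)%N ->
  \sum_(1 <= i < T.+1) hat x i = saw x.
Proof.
move=> x0 le_T; have [xe|xn] := eqVneq x 0; last first.
  by apply: hat_sum_saw => //; rewrite lt_neqAle eq_sym xn.
rewrite xe saw0; under eq_bigr do rewrite -[hat _ _]mul1r.
by rewrite (@wsum_hat0 (fun=> 1)).
Qed.

Lemma hat_sum_mul (x : rat) (d T : nat) : 0 <= x -> (0 < d)%N -> (Num.truncn x <= T)%N ->
  \sum_(1 <= i < (T %/ d).+1) hat x (d * i) = saw (x / d%:R).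
Proof.
move=> x0 d0 le_T; have d0' : (0 : rat) < d%:R by rewrite ltr0n.
have xd0 : 0 <= x / d%:R by rewrite divr_ge0 // ltW.
under eq_bigr do rewrite hat_mul //.
apply: hat_sum_saw0 => //; rewrite leq_divRL //; apply: leq_trans le_T.
by rewrite truncn_ge_nat // natrM -ler_pdivlMr // -truncn_ge_nat.
Qed.

Definition sieve_weight (t : nat) : rat :=
  1 - \sum_(1 <= d < t.+1 | sieving d && (d %| t)%N) d%:R^-1.
Definition sieve_error (t : nat) : rat :=
  1 + \sum_(1 <= d < t.+1 | sieving d && (d %| t)%N) 1.
Definition sieve_sum (e K : nat) : rat := \sum_(1 <= d < K.+1 | sieving d) (d%:R ^+ e)^-1.

Lemma sieve_swap (f g : nat -> rat) (T : nat) :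
  \sum_(1 <= t < T.+1) (\sum_(1 <= d < t.+1 | sieving d && (d %| t)%N) f d) * g t =
  \sum_(1 <= d < T.+1 | sieving d) f d * \sum_(1 <= i < (T %/ d).+1) g (d * i)%N.
Proof.
rewrite [RHS]big_nat_cond.
transitivity (\sum_(1 <= d < T.+1 | (1 <= d < T.+1)%N && sieving d)
   \sum_(1 <= t < T.+1 | (d %| t)%N) f d * g t); last first.
  apply: eq_bigr => d /andP[/andP[d0 _] _].
  by rewrite -sum_multiples // mulr_sumr.
rewrite -big_nat_cond (exchange_big_dep xpredT) //=.
rewrite big_nat [RHS]big_nat; apply: eq_bigr => t /andP[t0 le_tT].
rewrite mulr_suml [RHS](@big_cat_nat _ _ _ t.+1) //=.
rewrite [X in _ + X]big_nat_cond [X in _ + X]big1 ?addr0 // => d.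
case/andP=> /andP[lt_td _] /andP[_ /(dvdn_leq t0)].
by rewrite leqNgt lt_td.
Qed.

Lemma sieve_error_sum (T : nat) :
  wsum sieve_error T <= T%:R * (1 + sieve_sum 1 T).
Proof.
rewrite /wsum /sieve_error big_split /= sumr_const_nat subn1 /= mulrDr mulr1 lerD2l.
under eq_bigr do rewrite -[\sum_(_ <= _ < _ | _) _]mulr1.
rewrite (sieve_swap (fun=> 1) (fun=> 1)) /sieve_sum mulr_sumr.
rewrite big_nat_cond [leRHS]big_nat_cond; apply: ler_sum => d /andP[/andP[d0 _] _].
rewrite mul1r sumr_const_nat subn1 /= expr1 ler_pdivlMr ?ltr0n //.
by rewrite -natrM ler_nat leq_divM.
Qed.

Lemma sieve_sum_le (e K K' : nat) : (K <= K')%N -> sieve_sum e K <= sieve_sum e K'.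
Proof.
move=> le_K; rewrite /sieve_sum [leRHS](@big_cat_nat _ _ _ K.+1) //= lerDl.
by rewrite sumr_ge0 // => d _; rewrite invr_ge0 exprn_ge0.
Qed.

Lemma sieve_single (x : rat) (T : nat) : 0 < x -> Num.truncn x = T ->
  x / 2 * (1 - sieve_sum 2 T) - 1 / 2 <= \sum_(1 <= t < T.+1) sieve_weight t * hat x t.
Proof.
move=> x0 def_T; under eq_bigr do rewrite /sieve_weight mulrBl mul1r.
rewrite sumrB sieve_swap hat_sum_saw ?def_T //.
have h : \sum_(1 <= d < T.+1 | sieving d) d%:R^-1 * (\sum_(1 <= i < (T %/ d).+1) hat x (d * i)) <=
   x / 2 * sieve_sum 2 T.
  rewrite /sieve_sum mulr_sumr big_nat_cond [leRHS]big_nat_cond.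
  apply: ler_sum => d /andP[/andP[d0 _] _].
  have d0' : (0 : rat) < d%:R by rewrite ltr0n.
  rewrite hat_sum_mul ?(ltW x0) ?def_T //.
  have -> : x / 2 / d%:R ^+ 2 = d%:R^-1 * (x / d%:R / 2) by field; rewrite gt_eqF.
  by rewrite ler_pM2l ?invr_gt0 // saw_upper // divr_gt0.
by have := saw_lower x0; move: h; set S := sieve_sum 2 T; lra.
Qed.

(** The factor [1 - sieve_sum 2 T] stands in for [6 / pi ^ 2], the density of primitive points. It
    is smaller, but only a value above [1 / 2] is required. *)
Lemma sieve_pair (al be : rat) (s T : nat) : 0 <= al -> (0 < s)%N -> be = al + s%:R ->
  Num.truncn be = T ->
  s%:R / 2 * (1 - sieve_sum 2 T) - s%:R / (2 * be) * (1 + sieve_sum 1 T) <=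
  \sum_(1 <= t < T.+1) sieve_weight t * hat be t - \sum_(1 <= t < T.+1) sieve_weight t * hat al t.
Proof.
move=> al0 s0 def_be def_T; have s0' : (0 : rat) < s%:R by rewrite ltr0n.
have be0 : 0 < be by lra.
have le_tr : (Num.truncn al <= T)%N by rewrite -def_T le_truncn // def_be lerDl ltW.
have -> : \sum_(1 <= t < T.+1) sieve_weight t * hat be t - \sum_(1 <= t < T.+1) sieve_weight t * hat al t
  = saw be - saw al - \sum_(1 <= d < T.+1 | sieving d) d%:R^-1 * (saw (be / d%:R) - saw (al / d%:R)).
  have swap x : 0 <= x -> (Num.truncn x <= T)%N -> \sum_(1 <= t < T.+1) sieve_weight t * hat x t =
      saw x - \sum_(1 <= d < T.+1 | sieving d) d%:R^-1 * saw (x / d%:R).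
    move=> x0 le_x; under eq_bigr do rewrite /sieve_weight mulrBl mul1r.
    rewrite sumrB sieve_swap hat_sum_saw0 //; congr (_ - _).
    rewrite big_nat_cond [RHS]big_nat_cond; apply: eq_bigr => d /andP[/andP[d0 _] _].
    by rewrite hat_sum_mul.
  rewrite !swap ?(ltW be0) ?def_T //.
  under [in RHS]eq_bigr do rewrite mulrBr.
  by rewrite sumrB; ring.
have h : \sum_(1 <= d < T.+1 | sieving d) d%:R^-1 * (saw (be / d%:R) - saw (al / d%:R)) <=
   s%:R / 2 * sieve_sum 2 T + s%:R / (2 * be) * sieve_sum 1 T.
  rewrite /sieve_sum !mulr_sumr -big_split /= big_nat_cond [leRHS]big_nat_cond.
  apply: ler_sum => d /andP[/andP[d0 _] _].
  have d0' : (0 : rat) < d%:R by rewrite ltr0n.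
  have -> : s%:R / 2 / d%:R ^+ 2 + s%:R / (2 * be) / d%:R ^+ 1 = d%:R^-1 *
    ((be / d%:R - al / d%:R) / 2 + (be / d%:R - al / d%:R) / (2 * (be / d%:R))).
    by rewrite def_be expr1 in be0 *; field; rewrite !gt_eqF.
  rewrite ler_pM2l ?invr_gt0 //; apply: saw_diff_upper; last by rewrite divr_gt0.
    by rewrite divr_ge0 // ltW.
  by rewrite ler_pM2r ?invr_gt0 // def_be lerDl ltW.
have := saw_diff_lower al0 s0; rewrite -def_be; move: h; set S := sieve_sum 2 T; set H := sieve_sum 1 T; lra.
Qed.

Definition sievingZ (d : Z) : bool :=
  [|| Z.eqb d 2, Z.eqb d 3 | Z.ltb 1 d && Z.eqb (Z.gcd d 6) 1].

Lemma sievingZE d : sievingZ (Z.of_nat d) = sieving d.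
Proof. by rewrite /sievingZ /sieving !inE; lia. Qed.

Definition inv_scale : Z := 1000000.

(** Fixed-point upper bounds for [sieve_sum 1] and [sieve_sum 2], every reciprocal being rounded up
    in units of [1 / inv_scale]. *)
Fixpoint inv_sums (fuel : nat) (d a b : Z) : Z * Z :=
  if fuel is f.+1 then
    let d' := Z.succ d in
    if sievingZ d' then inv_sums f d' (Z.add a (Z.succ (Z.div inv_scale d')))
      (Z.add b (Z.succ (Z.div inv_scale (Z.mul d' d'))))
    else inv_sums f d' a b
  else (a, b).

Lemma ceil_inv (C d : Z) : Z.lt 0 d -> ratZ C * (ratZ d)^-1 <= ratZ (Z.succ (Z.div C d)).
Proof.
move=> d0; have d0' : 0 < ratZ d by rewrite ratZ0 lt_ratZ; apply/Z.ltb_lt.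
rewrite ler_pdivrMr // mulrC -ratZM le_ratZ; apply/Z.leb_le/Z.lt_le_incl.
exact: Z.mul_succ_div_gt.
Qed.

Lemma sieve_sumS e d :
  sieve_sum e d.+1 = sieve_sum e d + (if sieving d.+1 then (d.+1%:R ^+ e)^-1 else 0).
Proof. by rewrite /sieve_sum [LHS]big_mkcond big_nat_recr // -big_mkcond. Qed.

Lemma inv_sumsP fuel (d : nat) a b :
  ratZ inv_scale * sieve_sum 1 d <= ratZ a -> ratZ inv_scale * sieve_sum 2 d <= ratZ b ->
  ratZ inv_scale * sieve_sum 1 (d + fuel) <= ratZ (inv_sums fuel (Z.of_nat d) a b).1 /\
  ratZ inv_scale * sieve_sum 2 (d + fuel) <= ratZ (inv_sums fuel (Z.of_nat d) a b).2.
Proof.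
elim: fuel d a b => [|f IHf] d a b ha hb; first by rewrite addn0.
have d1 : Z.lt 0 (Z.succ (Z.of_nat d)) by clear; lia.
rewrite addnS -addSn [inv_sums _ _ _ _]/= -Nat2Z.inj_succ sievingZE.
case: ifP => sv; apply: IHf; rewrite sieve_sumS sv ?addr0 // mulrDr ratZD; apply: lerD => //.
  by rewrite expr1 -ratZ_nat; apply: ceil_inv; rewrite Nat2Z.inj_succ.
by rewrite expr2 -ratZ_nat -ratZM; apply: ceil_inv; rewrite Nat2Z.inj_succ; apply: Z.mul_pos_pos.
Qed.

Lemma inv_sums_500 : inv_sums 500 0 0 0 = (2512186, 457160)%bZ.
Proof. by vm_cast_no_check (erefl (2512186, 457160)%bZ). Qed.

(** The added [1 / 500] bounds the tail of the sum of [1 / d ^ 2]. The bound [6 / 13] leaves the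
    factor [7 / 13], enough above one half. *)
Lemma sieve_sum_500 : sieve_sum 1 500 <= 63 / 25 /\ sieve_sum 2 500 + (ratZ 500)^-1 <= 6 / 13.
Proof.
have h0 e : ratZ inv_scale * sieve_sum e 0 <= ratZ Z0 by rewrite /sieve_sum big_geq // mulr0 -ratZ0.
have := @inv_sumsP 500 0 _ _ (h0 1%N) (h0 2%N).
rewrite (inv_sums_500 : inv_sums 500 (Z.of_nat 0) 0 0 = _) [_.1]/= [_.2]/= add0n.
have C0 : 0 < ratZ inv_scale := ratZ_pos_gt0 _.
have e1 : Z.le (Z.mul 25 2512186) (Z.mul 63 inv_scale) by [].
have e2 : Z.le (Z.mul (Z.mul 13 500) (Z.add 457160 2000)) (Z.mul (Z.mul 6 500) inv_scale) by [].
have e3 : Z.mul 2000 500 = inv_scale by [].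
move: e1 e2; rewrite -!Z.leb_le -!le_ratZ !ratZM ratZD.
have -> : (ratZ 500)^-1 = ratZ 2000 / ratZ inv_scale.
  rewrite -e3 ratZM invfM mulrA divff; first by rewrite mul1r.
  by rewrite gt_eqF ?ratZ_pos_gt0.
move: (sieve_sum 1 _) (sieve_sum 2 _) (ratZ inv_scale) C0 => s1 s2 C C0.
have r500 := ratZ_pos_gt0 500; move: (ratZ 500) r500 => r r0.
move: (ratZ 2512186) (ratZ 457160) (ratZ 2000) => A B D.
rewrite (ratZ_pos 25) (ratZ_pos 63) (ratZ_pos 13) (ratZ_pos 6) => e1 e2 [h1 h2]; split.
  by rewrite -(ler_pM2l C0); apply: le_trans h1 _; rewrite mulrA ler_pdivlMr // mulrC [C * _]mulrC.
have {}e2 : 13 * (B + D) <= 6 * C by rewrite -(ler_pM2r r0) mulrAC [6 * C * r]mulrAC.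
rewrite -(ler_pM2l C0) mulrDr [C * (D / C)]mulrC divfK ?gt_eqF //.
apply: le_trans (lerD h2 (lexx D)) _.
by rewrite mulrA ler_pdivlMr // mulrC [C * _]mulrC.
Qed.

(** Each term beyond [m] is at most [1 / m]. The linear growth is affordable in place of a
    logarithm: [K ^ 2 / 500] is still a small fraction of [N] when [3 * K ^ 2 <= 4 * N]. *)
Lemma sieve_sum1_from (m K : nat) (b : rat) : (0 < m)%N -> sieve_sum 1 m <= b ->
  sieve_sum 1 K <= b + K%:R / m%:R.
Proof.
move=> m0 h; have mR : (0 : rat) < m%:R by rewrite ltr0n.
have [le_K|lt_K] := leqP K m.
  apply: le_trans (sieve_sum_le 1 le_K) _; apply: le_trans h _.
  by rewrite lerDl divr_ge0 ?ler0n.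
rewrite -(subnKC (ltnW lt_K)); move: (K - m)%N => k {lt_K}.
elim: k => [|k IHk].
  by rewrite addn0; apply: le_trans h _; rewrite lerDl divr_ge0 ?ler0n.
rewrite addnS sieve_sumS -[X in _ <= b + X / _]natr1 mulrDl addrA mul1r; apply: lerD IHk _.
case: ifP => _; last by rewrite invr_ge0 ltW.
by rewrite expr1 lef_pV2 ?posrE ?ltr0n // ler_nat leqW // leq_addr.
Qed.

Lemma sieve_sum2_from (m K : nat) (b : rat) : (0 < m)%N -> sieve_sum 2 m + m%:R^-1 <= b ->
  sieve_sum 2 K <= b.
Proof.
move=> m0 h; have mR : (0 : rat) < m%:R by rewrite ltr0n.
have [le_K|lt_K] := leqP K m.
  apply: le_trans (sieve_sum_le 2 le_K) _; apply: le_trans h.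
  by rewrite lerDl invr_ge0 ltW.
suff hk k : sieve_sum 2 (m + k) <= b - (m + k)%:R^-1.
  rewrite -(subnKC (ltnW lt_K)); apply: le_trans (hk _) _.
  by rewrite gerBl invr_ge0 ler0n.
elim: k => [|k IHk]; first by rewrite addn0 lerBrDr.
rewrite addnS sieve_sumS.
have k0 : (0 : rat) < (m + k)%:R by rewrite ltr0n addn_gt0 m0.
have k1 : (0 : rat) < (m + k).+1%:R by rewrite ltr0n.
apply: le_trans (lerD IHk (_ : _ <= (m + k)%:R^-1 - (m + k).+1%:R^-1)) _; last first.
  by rewrite addrA subrK.
have -> : (m + k)%:R^-1 - (m + k).+1%:R^-1 = ((m + k)%:R * (m + k).+1%:R)^-1 :> rat.
  by rewrite -natr1 in k1 *; move: ((m + k)%:R) k0 k1 => x x0 x1; field; rewrite !gt_eqF.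
case: ifP => _; last by rewrite invr_ge0 mulr_ge0 // ltW.
by rewrite expr2 lef_pV2 ?posrE ?mulr_gt0 // ler_pM2r // ler_nat leqnSn.
Qed.

Lemma sieve_sum1_bound K : sieve_sum 1 K <= 63 / 25 + K%:R / 500.
Proof. by have [h _] := sieve_sum_500; exact: sieve_sum1_from h. Qed.

Lemma sieve_sum2_bound K : sieve_sum 2 K <= 6 / 13.
Proof.
have [_] := sieve_sum_500; rewrite -[Zpos 500]/(Z.of_nat 500) ratZ_nat => h.
exact: sieve_sum2_from h.
Qed.

(** The main term [4 * (N / 2) * (7 / 13)] exceeds [N] by [N / 13]. Since [b >= 450] and
    [4 * N >= 3 * b ^ 2], the errors, multiples of [b] and [N / b] by [88 / 25 = 1 + 63 / 25] and
    small multiples of [N], stay below that; this is why the tables reach 450. Here [d] is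
    [1 / 500]. *)
Lemma sieve_count_out (N b S H n d : rat) : 450 <= b -> 3 * b ^+ 2 <= 4 * N -> S <= 6 / 13 ->
  0 <= d -> d * 500 = 1 -> H <= 63 / 25 + b * d -> n <= N ->
  n + 13 <= 4 * (N / 2 * (1 - S) - N / (2 * b) * (1 + H) - b * (1 + H)).
Proof.
move=> hb hW hS d_ge0 hd hH le_n; have b_gt0 : 0 < b by lra.
rewrite expr2 in hW; set x := N / (2 * b).
have xb : x * b = N / 2 by rewrite /x; field; rewrite gt_eqF.
clearbody x; have b450 : 450 * b <= b * b by exact: ler_wpM2r (ltW b_gt0) _ _ hb.
have N_gt0 : 0 < N by lra.
have x_gt0 : 0 < x by rewrite -(pmulr_lgt0 _ b_gt0) xb; lra.
have x450 : x * 450 <= N / 2 by rewrite -xb; exact: ler_wpM2l (ltW x_gt0) _ _ hb.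
have Nd : N * d * 500 = N by rewrite -mulrA hd mulr1.
have bd : b * b * d <= 4 / 3 * (N * d) by rewrite [4 / 3 * _]mulrA; apply: (ler_wpM2r d_ge0); lra.
have h3 : N / 2 * (7 / 13) <= N / 2 * (1 - S) by apply: ler_wpM2l; lra.
have hH' : 1 + H <= 88 / 25 + b * d by lra.
have h1 : x * (1 + H) <= x * (88 / 25 + b * d) by rewrite (ler_pM2l x_gt0).
have h2 : b * (1 + H) <= b * (88 / 25 + b * d) by rewrite (ler_pM2l b_gt0).
have e1 : x * (88 / 25 + b * d) = 88 / 25 * x + N * d / 2.
  by rewrite mulrDr [x * (88 / 25)]mulrC [x * (b * d)]mulrA xb; ring.
have e2 : b * (88 / 25 + b * d) = 88 / 25 * b + b * b * d by ring.
rewrite e1 in h1; rewrite e2 in h2; move: h1 h2 h3 bd Nd {hS hH hd d_ge0 e1 e2 hH' b_gt0 x_gt0 xb}.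
move: (x * (1 + H)) (b * (1 + H)) (N / 2 * (1 - S)) (b * b * d) (N * d) => X1 X2 X3 X4 z.
lra.
Qed.

Lemma sieve_count_in (N s A B n X Y E1 E2 d : rat) : 450 <= s -> 3 * s ^+ 2 <= 4 * N -> A + B = s ->
  0 <= d -> d * 500 = 1 -> n <= N -> 0 < A -> 0 < B ->
  A / 2 * (7 / 13) - 1 / 2 <= X -> B / 2 * (7 / 13) - 1 / 2 <= Y ->
  E1 <= A * (88 / 25 + s * d) -> E2 <= B * (88 / 25 + s * d) ->
  n + 13 <= 4 * ((N / s * X - E1) + (N / s * Y - E2) + 1).
Proof.
move=> hs hW AB d_ge0 hd le_n A0 B0 hX hY hE1 hE2; have s_gt0 : 0 < s by lra.
rewrite expr2 in hW; set x := N / s.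
have xs : x * s = N by rewrite /x divfK ?gt_eqF.
clearbody x; have s450 : 450 * s <= s * s by exact: ler_wpM2r (ltW s_gt0) _ _ hs.
have N_gt0 : 0 < N by lra.
have x_gt0 : 0 < x by rewrite -(pmulr_lgt0 _ s_gt0) xs.
have x450 : x * 450 <= N by rewrite -xs; exact: ler_wpM2l (ltW x_gt0) _ _ hs.
have XY : s / 2 * (7 / 13) - 1 <= X + Y by lra.
have h1 : x * (s / 2 * (7 / 13) - 1) <= x * (X + Y) by rewrite (ler_pM2l x_gt0).
have e1 : x * (s / 2 * (7 / 13) - 1) = N * (7 / 26) - x by rewrite -xs; field.
have Nd : N * d * 500 = N by rewrite -mulrA hd mulr1.
have sd : s * s * d <= 4 / 3 * (N * d) by rewrite [4 / 3 * _]mulrA; apply: (ler_wpM2r d_ge0); lra.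
have h2 : E1 + E2 <= 88 / 25 * s + s * s * d.
  apply: le_trans (lerD hE1 hE2) _; rewrite -mulrDl AB mulrDr [s * (s * d)]mulrA.
  rewrite [s * (88 / 25)]mulrC; exact: lexx.
rewrite e1 in h1.
move: (N * d) (s * s * d) Nd sd h2 => z y Nd sd h2.
move: {hE1 hE2 hX hY XY e1 AB xs A0 B0 hd d_ge0 x_gt0 s_gt0} h1; lra.
Qed.

Lemma sieve_bound (t : nat) : (0 < t)%N -> line_bound (sieve_weight t / 1) (sieve_error t / 1) t.
Proof. by move=> t0; rewrite !divr1; exact: line_bound_sieve. Qed.

Lemma inv500 : 0 <= 500^-1 :> rat /\ 500^-1 * 500 = 1 :> rat.
Proof. by split; [rewrite invr_ge0 ler0n | rewrite mulVf // pnatr_eq0]. Qed.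

Lemma sieve_error_le (x b : rat) : 0 <= x -> x <= b ->
  wsum sieve_error (Num.truncn x) <= x * (88 / 25 + b * 500^-1).
Proof.
move=> x0 le_xb; have /andP[tx _] := truncn_itv x0.
have H0 : 0 <= 1 + sieve_sum 1 (Num.truncn x).
  by rewrite addr_ge0 // sumr_ge0 // => d _; rewrite invr_ge0 exprn_ge0.
apply: le_trans (sieve_error_sum _) _; apply: (ler_pM (ler0n _ _) H0 tx).
have h : (Num.truncn x)%:R / 500 <= b / 500 :> rat.
  by apply: ler_wpM2r (le_trans tx le_xb); case: inv500.
have := sieve_sum1_bound (Num.truncn x); move: h.
by move: (sieve_sum 1 _) (_ / 500) (b / 500) => S1 y z; clear; lra.
Qed.

Section SideSieve.
Variables (N c n al be : rat) (eps : int) (p s : nat).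
Hypotheses (N_gt0 : 0 < N) (s_gt0 : (0 < s)%N) (cop : coprime p s)
  (epsP : (eps == 1) || (eps == -1))
  (be1 : eps = 1 -> be = s%:R * c - p%:R * N + s%:R)
  (be2 : eps = -1 -> be = p%:R * N - s%:R * c)
  (al_def : al = be - s%:R) (al_ge0 : 0 <= al) (width : 3 * be ^+ 2 <= 4 * N).

Lemma side_rich_sieve : 450 <= be -> n <= N -> rich N c n.
Proof.
move=> be450 le_n; have fin S H d := @sieve_count_out N be S H n d be450 width.
move: {be450} fin => fin; have s0' : (0 : rat) < s%:R by rewrite ltr0n.
have def_be : be = al + s%:R by rewrite al_def subrK.
have be0 : 0 < be by rewrite def_be ltr_wpDl.
have [j [le_j lt_j le_T lt_T]] := real_cell al_ge0 def_be.
have def_T : Num.truncn be = (j + s)%N by apply: truncn_def; rewrite le_T -natr1.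
apply: (side_bound_rich ltr01 sieve_bound N_gt0 s_gt0 cop epsP be1 be2 al_def be0 le_T
  (leq_addr _ _) lt_j); first by rewrite le_j implybT.
rewrite divr1 -(hat_sum_top _ be0 le_T) -(hat_sumP _ (leq_addr s j) lt_j) ?le_j ?implybT //.
have h1 := sieve_pair al_ge0 s_gt0 def_be def_T.
have h2 := sieve_error_sum (j + s).
have h3 := sieve_sum1_bound (j + s); have h4 := sieve_sum2_bound (j + s).
move: h1 h2 h3 h4; set S := sieve_sum 2 _; set H := sieve_sum 1 _; set X := _ - _.
move=> h1 h2 h3 h4.
have H0 : 0 <= H by rewrite sumr_ge0 // => d _; rewrite invr_ge0 exprn_ge0.
have [d0 d1] := inv500; have h3' : H <= 63 / 25 + be * 500^-1.
  by apply: le_trans h3 _; rewrite lerD2l; exact: (ler_wpM2r d0 le_T).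
apply: le_trans (fin _ _ _ h4 d0 d1 h3' le_n) _.
apply: (ler_wpM2l (ler0n _ 4)); apply: lerB.
  have -> : N / 2 * (1 - S) - N / (2 * be) * (1 + H) =
    N / s%:R * (s%:R / 2 * (1 - S) - s%:R / (2 * be) * (1 + H)).
    by field; rewrite !gt_eqF.
  by apply: ler_wpM2l h1; apply: divr_ge0; exact: ltW.
apply: le_trans h2 _; apply: ler_wpM2r le_T; apply: addr_ge0 H0; exact: ler01.
Qed.

End SideSieve.

Section BothSieve.
Variables (N c n A B : rat) (p s : nat).
Hypotheses (s_gt3 : (3 < s)%N) (cop : coprime p s)
  (def_A : A = p%:R * N - s%:R * c) (def_B : B = s%:R * c - p%:R * N + s%:R)
  (A_gt0 : 0 < A) (B_gt0 : 0 < B) (width : 3 * s%:R ^+ 2 <= 4 * N).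

Lemma both_rich_sieve : 450 <= s%:R :> rat -> n <= N -> rich N c n.
Proof.
move=> s450 le_n; have AB : A + B = s%:R by rewrite def_A def_B; ring.
have fin X Y E1 E2 d := @sieve_count_in N s%:R A B n X Y E1 E2 d s450 width AB.
move: {s450} fin => fin; have ltN := both_lt s_gt3 width.
have s_gt0 : (0 < s)%N by apply: leq_trans s_gt3.
have /andP[jA _] := truncn_itv (ltW A_gt0); have /andP[lB _] := truncn_itv (ltW B_gt0).
apply: (two_sides_rich ltr01 sieve_bound ltN s_gt0 cop def_A def_B A_gt0 B_gt0 jA lB).
rewrite !divr1.
have side x : 0 < x -> x / 2 * (7 / 13) - 1 / 2 <= hat_sum sieve_weight (Num.truncn x) x.
  move=> x0; have /andP[tx _] := truncn_itv (ltW x0).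
  rewrite -(hat_sum_top _ x0 tx); apply: le_trans (sieve_single x0 erefl).
  have h4 := sieve_sum2_bound (Num.truncn x); rewrite lerD2r; apply: ler_wpM2l.
    by rewrite divr_ge0 // ltW.
  by move: h4; move: (sieve_sum 2 _) => S2 h4; lra.
have [d0 d1] := inv500.
apply: (fin _ _ _ _ _ d0 d1 le_n A_gt0 B_gt0 (side _ A_gt0) (side _ B_gt0)).
  by apply: sieve_error_le; [exact: ltW | rewrite -AB lerDl ltW].
by apply: sieve_error_le; [exact: ltW | rewrite -AB lerDr ltW].
Qed.

End BothSieve.

(** * Windows of large order *)

Lemma cap_ratio (a b : Z) (N n : rat) : 0 < ratZ b -> ratZ b * n <= N * ratZ a ->
  0 < ratZ b /\ ratZ b * (ratZ weight_scale * n) <= ratZ weight_scale * N * ratZ a + ratZ Z0.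
Proof.
move=> b0 h; split=> //; rewrite -ratZ0 addr0 mulrCA -[ratZ weight_scale * N * _]mulrA.
by rewrite (ler_pM2l weight_scale_gt0).
Qed.

Lemma out_cap_none (N n al be : rat) (s j : nat) : (0 < s)%N -> j%:R <= al -> al < j%:R + 1 ->
  be = al + s%:R -> (s = 1%N -> n <= N - al) ->
  ((1 < s)%N -> s%:R * n <= N * (s%:R - 1) + be) ->
  let: (num, den, ex) := out_cap None (Z.of_nat s) (Z.of_nat j) in
  0 < ratZ den /\ ratZ den * (ratZ weight_scale * n) <= ratZ weight_scale * N * ratZ num + ratZ ex.
Proof.
move=> s0 le_j lt_j def_be h1 h2; have M0 := weight_scale_gt0; rewrite /out_cap.
have [s1|s_neq1] := eqVneq s 1%N.
  have -> : Z.eqb (Z.of_nat s) 1 = true by rewrite s1.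
  have -> : ratZ 1 = 1 by rewrite ratZ_pos.
  split; first exact: ltr01.
  rewrite mul1r mulr1 ratZN ratZM ratZ_nat [j%:R * _]mulrC -mulrBr (ler_pM2l M0).
  by apply: le_trans (h1 s1) _; rewrite lerD2l lerN2.
have s_gt1 : (1 < s)%N by rewrite ltn_neqAle eq_sym s_neq1.
have -> : Z.eqb (Z.of_nat s) 1 = false by move: s_gt1; clear; lia.
have -> : Z.pred (Z.of_nat s) = Z.of_nat s.-1 by move: s0; clear; lia.
have -> : Z.succ (Z.add (Z.of_nat s) (Z.of_nat j)) = Z.of_nat (s + j).+1 by clear; lia.
rewrite ratZM !ratZ_nat; split; first by rewrite ltr0n.
rewrite mulrCA -[ratZ weight_scale * N * _]mulrA -mulrDr (ler_pM2l M0).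
apply: le_trans (h2 s_gt1) _; rewrite -subn1 natrB // lerD2l def_be.
by rewrite -natr1 natrD -addrA addrC lerD2r ltW.
Qed.

Lemma in_cap_none (N n : rat) (s : nat) : (0 < s)%N -> s%:R * n <= N * (s%:R - 1) + s%:R ->
  let: (num, den, ex) := in_cap None (Z.of_nat s) in
  0 < ratZ den /\ ratZ den * (ratZ weight_scale * n) <= ratZ weight_scale * N * ratZ num + ratZ ex.
Proof.
move=> s0 h; have M0 := weight_scale_gt0; rewrite /in_cap.
have -> : Z.pred (Z.of_nat s) = Z.of_nat s.-1 by move: s0; clear; lia.
rewrite ratZM !ratZ_nat; split; first by rewrite ltr0n.
rewrite mulrCA -[ratZ weight_scale * N * _]mulrA [s%:R * ratZ _]mulrC -mulrDr (ler_pM2l M0).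
by rewrite -subn1 natrB.
Qed.

Lemma in_cap_some (N n : rat) (s : nat) (a b : Z) : (0 < s)%N -> 0 < ratZ b ->
  ratZ b * n <= N * ratZ a -> s%:R * n <= N * (s%:R - 1) + s%:R ->
  let: (num, den, ex) := in_cap (Some (a, b)) (Z.of_nat s) in
  0 < ratZ den /\ ratZ den * (ratZ weight_scale * n) <= ratZ weight_scale * N * ratZ num + ratZ ex.
Proof.
move=> s0 b0 hb hs; rewrite /in_cap; case: ifP => _; first exact: cap_ratio.
exact: in_cap_none.
Qed.

Lemma truncn_nat_lt (x : rat) (j : nat) (z : nat) : (z <= j)%N -> j%:R <= x -> z%:R <= x.
Proof. by move=> h; apply: le_trans; rewrite ler_nat. Qed.

Lemma out_rich_large (N c n al be : rat) (eps : int) (p s : nat) :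
  0 < N -> (0 < s)%N -> coprime p s -> (eps == 1) || (eps == -1) ->
  (eps = 1 -> be = s%:R * c - p%:R * N + s%:R) ->
  (eps = -1 -> be = p%:R * N - s%:R * c) ->
  al = be - s%:R -> 0 <= al -> 3 * be ^+ 2 <= 4 * N -> ratZ 1350 <= N -> n <= N ->
  (s = 1%N -> n <= N - al) -> (s = 1%N -> 1 <= al) ->
  ((1 < s)%N -> s%:R * n <= N * (s%:R - 1) + be) -> rich N c n.
Proof.
move=> N0 s0 cop epsP be1 be2 al_def al0 wd le_N le_n h1 h1' h2.
have def_be : be = al + s%:R by rewrite al_def subrK.
have [j [le_j lt_j le_k lt_k]] := real_cell al0 def_be.
have [k111|k111] := ltnP (j + s) 111.
  apply: (side_rich_table N0 s0 cop epsP be1 be2 al_def al0 wd out_table_large _ _ le_N k111 le_j lt_j).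
  - by [].
  - exact: ratZ_pos_gt0.
  - rewrite orbF; apply/negP => /andP[/eqP s1 /eqP j0].
    by have := le_lt_trans (h1' s1) lt_j; rewrite j0 add0r ltxx.
  exact: (out_cap_none s0 le_j lt_j def_be h1 h2).
have [k450|k450] := leqP (j + s) 450.
  apply: (side_rich_far N0 s0 cop epsP be1 be2 al_def al0 wd _ le_j lt_j le_n).
  by rewrite k450 andbT; exact: leq_trans k111.
apply: (side_rich_sieve N0 s0 cop epsP be1 be2 al_def al0 wd _ le_n).
exact: truncn_nat_lt (ltnW k450) le_k.
Qed.

Lemma in_rich_large (N c n A B : rat) (p s : nat) : (3 < s)%N -> coprime p s ->
  A = p%:R * N - s%:R * c -> B = s%:R * c - p%:R * N + s%:R -> 0 < A -> 0 < B ->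
  3 * s%:R ^+ 2 <= 4 * N -> ratZ 1350 <= N -> n <= N ->
  s%:R * n <= N * (s%:R - 1) + s%:R -> rich N c n.
Proof.
move=> s3 cop dA dB A0 B0 wd le_N le_n h.
have s0 : (0 < s)%N by apply: leq_trans s3.
have [s111|s111] := leqP s 111.
  apply: (both_rich_table s3 cop dA dB A0 B0 wd in_table_large _ _ le_N s111).
  - by [].
  - exact: ratZ_pos_gt0.
  exact: in_cap_none.
have [s450|s450] := leqP s 450.
  apply: (both_rich_far s3 cop dA dB A0 B0 wd _ le_n).
  by rewrite s450 andbT; exact: leq_trans (ltnW s111).
by apply: (both_rich_sieve s3 cop dA dB A0 B0 wd _ le_n); rewrite ler_nat ltnW.
Qed.

(* The three ways in which the strip of width [W] can lie with respect to the direction [(p, s)]. *)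
Lemma narrow_cases (n c : rat) (P : Prop) : 1 <= c -> c <= n - 2 -> n <= 2 * c \/ 2 * c + 3 <= n ->
  (forall p s eps al be, 0 < n + c -> (0 < s)%N -> coprime p s -> (eps == 1) || (eps == -1 :> int) ->
    (eps = 1 -> be = s%:R * c - p%:R * (n + c) + s%:R) ->
    (eps = -1 -> be = p%:R * (n + c) - s%:R * c) ->
    al = be - s%:R -> 0 <= al -> 3 * be ^+ 2 <= 4 * (n + c) ->
    (s = 1%N -> n <= n + c - al) -> (s = 1%N -> al = c) ->
    ((1 < s)%N -> s%:R * n <= (n + c) * (s%:R - 1) + be) -> P) ->
  (forall p s A B, (3 < s)%N -> coprime p s ->
    A = p%:R * (n + c) - s%:R * c -> B = s%:R * c - p%:R * (n + c) + s%:R -> 0 < A -> 0 < B ->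
    3 * s%:R ^+ 2 <= 4 * (n + c) -> s%:R * n <= (n + c) * (s%:R - 1) + s%:R -> P) ->
  P.
Proof.
move=> c1 le_c half outP inP; have c0 : 0 <= c by lra.
have [p [s [W [s0 cop lt_ps nar hW]]]] := narrow_direction c0 le_c.
have N0 : 0 < n + c by lra.
have p_big : (0 < p)%N -> n + c <= p%:R * (n + c).
  by move=> p0; rewrite ler_peMl ?ler1n // ltW.
have sE : (n + c) * (s%:R - 1) = s%:R * n + s%:R * c - (n + c) by ring.
case: nar => [[t0 WE]|[rho0 s1 rhoW sW _]].
  apply: (outP p s 1 (s%:R * c - p%:R * (n + c)) W) => //; rewrite ?WE //; first by rewrite addrK.
  - move=> s1; move: lt_ps; rewrite s1 ltnS leqn0 => /eqP->; lra.
  - move=> s1; move: lt_ps; rewrite s1 ltnS leqn0 => /eqP->; lra.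
  move=> s1; have p0 : (0 < p)%N by case: (p) cop s1 => // /eqP; rewrite gcd0n => ->.
  have := p_big p0; have : (0 : rat) <= s%:R by rewrite ler0n.
  rewrite sE; lra.
have p0 : (0 < p)%N.
  rewrite lt0n; apply/eqP => p0; move: rho0; rewrite p0 mul0r ltNge mulr_ge0 ?ler0n //.
have pb := p_big p0.
have [le_sr|lt_rs] := leP s%:R (p%:R * (n + c) - s%:R * c).
  apply: (outP p s (-1) (p%:R * (n + c) - s%:R * c - s%:R) (p%:R * (n + c) - s%:R * c)) => //.
  - by rewrite subr_ge0.
  - apply: le_trans hW; rewrite ler_pM2l // lerXn2r // nnegrE; last by rewrite (le_trans _ sW).
    by rewrite subr_ge0 ltW.
  - by move=> s1'; move: s1; rewrite s1'.
  - by move=> s1'; move: s1; rewrite s1'.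
  by move=> _; rewrite sE; lra.
have sW2 : 3 * s%:R ^+ 2 <= 4 * (n + c).
  apply: le_trans hW; rewrite ler_pM2l // lerXn2r // nnegrE ?ler0n //.
  by rewrite (le_trans _ sW).
apply: (inP p s _ _ _ cop erefl erefl _ _ sW2); [| lra | lra | rewrite sE; lra].
(* For [s <= 3] the direction [p / s] inside the window would be the fraction 1, [1/2] or 2. The
   first and the last are excluded by the bounds on [c], the middle one by [half]. *)
rewrite ltnNge; apply/negP => s3.
have [s2|s2] := eqVneq s 2%N.
  have p1 : p = 1%N by move: lt_ps p0; rewrite s2; case: (p) => [|[|]].
  by move: lt_rs; rewrite p1 s2; lra.
have {s2}s3 : s = 3%N by apply/eqP; rewrite eqn_leq s3 ltn_neqAle eq_sym s2.
have [p1|p2] : p = 1%N \/ p = 2%N.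
  by move: lt_ps p0; rewrite s3; case: (p) => [|[|[|]]] //; [left|right].
  by move: lt_rs rho0; rewrite p1 s3; lra.
by move: lt_rs rho0; rewrite p2 s3; lra.
Qed.

Lemma rich_large (n c : rat) : 1 <= c -> c <= n - 2 -> n <= 2 * c \/ 2 * c + 3 <= n ->
  ratZ 1350 <= n -> rich (n + c) c n.
Proof.
move=> c1 le_c half hn.
have le_nN : n <= n + c by rewrite lerDl (le_trans ler01).
have hN : ratZ 1350 <= n + c := le_trans hn le_nN.
apply: (narrow_cases c1 le_c half) => [p s eps al be N0 s0 cop epsP be1 be2 dal al0 wd k1 k2 k3|
  p s A B s3 cop dA dB A0 B0 wd k].
  by apply: (out_rich_large N0 s0 cop epsP be1 be2 dal al0 wd hN le_nN k1 _ k3) => s1; rewrite k2.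
exact: (in_rich_large s3 cop dA dB A0 B0 wd hN le_nN k).
Qed.

Lemma width_60 (b N : rat) (k : nat) : k%:R <= b -> 0 <= b -> 3 * b ^+ 2 <= 4 * N -> N <= ratZ 2700 ->
  (k <= 60)%N.
Proof.
move=> le_k b0 wd hN; rewrite leqNgt; apply/negP => k61.
have hb : ratZ (Z.of_nat 61) <= b by rewrite ratZ_nat; apply: le_trans le_k; rewrite ler_nat.
have h1 : 3 * ratZ (Z.of_nat 61) ^+ 2 <= 4 * ratZ 2700.
  apply: le_trans (_ : 3 * b ^+ 2 <= _).
    by rewrite ler_pM2l // lerXn2r // nnegrE ratZ_nat ler0n.
  by apply: le_trans wd _; rewrite ler_pM2l.
have := h1; have -> : 3 = ratZ 3 by rewrite ratZ_pos.
have -> : 4 = ratZ 4 by rewrite ratZ_pos.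
by rewrite expr2 -!ratZM le_ratZ.
Qed.

(** A lower bound on [xi] makes [N] larger than [n] by a fixed factor, and this additional slack is
    what allows orders below 1350. *)
Lemma rich_mid (N0 a b : Z) (n c : rat) :
  all_near 65 (out_check N0 (Some (a, b))) 0 (take 65 table) ->
  all_near 65 (in_check N0 (Some (a, b))) 0 (take 65 table) ->
  1 <= c -> c <= n - 2 -> n <= 2 * c \/ 2 * c + 3 <= n ->
  ratZ 60 <= c -> n + c <= ratZ 2700 -> 0 < ratZ N0 -> ratZ N0 <= n + c -> 0 < ratZ b ->
  ratZ b * n <= (n + c) * ratZ a -> rich (n + c) c n.
Proof.
move=> outT inT c1 le_c half c60 hN N0' le_N b0 hab.
apply: (narrow_cases c1 le_c half) => [p s eps al be Np s0 cop epsP be1 be2 dal al0 wd k1 k2 k3|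
  p s A B s3 cop dA dB A0 B0 wd k].
  have def_be : be = al + s%:R by rewrite dal subrK.
  have [j [le_j lt_j le_k lt_k]] := real_cell al0 def_be.
  have be0 : 0 <= be by rewrite def_be addr_ge0 ?ler0n.
  have k60 := width_60 le_k be0 wd hN.
  apply: (side_rich_table Np s0 cop epsP be1 be2 dal al0 wd outT _ N0' le_N _ le_j lt_j).
  - by [].
  - by apply: leq_ltn_trans k60 _.
  (* For [s = 1] the offset is [al = c >= 60], so the width would be at least 61, more than
     [N <= 2700] allows. *)
  - apply/negP => /andP[/eqP s1 _]; have cE := k2 s1.
    have h : (j + s)%:R <= ratZ 60 by rewrite -[Zpos 60]/(Z.of_nat 60) ratZ_nat ler_nat.
    have lt_c : c < (j + s)%:R by rewrite -cE s1 natrD.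
    by have := le_lt_trans (le_trans h c60) lt_c; rewrite ltxx.
  exact: cap_ratio.
have sk := width_60 (lexx s%:R) (ler0n _ s) wd hN.
have s0 : (0 < s)%N by apply: leq_trans s3.
apply: (both_rich_table s3 cop dA dB A0 B0 wd inT _ N0' le_N).
- by [].
- exact: leq_trans sk _.
exact: in_cap_some.
Qed.

(** * Windows of moderate order *)

Definition qval (z : nat * nat) : rat := z.1%:R / z.2%:R.

Lemma qval_lt u v : (0 < u.2)%N -> (0 < v.2)%N -> (qval u < qval v) = (u.1 * v.2 < v.1 * u.2)%N.
Proof.
move=> hu hv; rewrite /qval ltr_pdivrMr ?ltr0n // mulrAC ltr_pdivlMr ?ltr0n //.
by rewrite -!natrM ltr_nat.
Qed.

Lemma qval_le u v : (0 < u.2)%N -> (0 < v.2)%N -> (qval u <= qval v) = (u.1 * v.2 <= v.1 * u.2)%N.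
Proof. by move=> hu hv; rewrite !leNgt qval_lt // -leqNgt. Qed.

Lemma qval_eq u v : (0 < u.2)%N -> (0 < v.2)%N -> (qval u == qval v) = (u.1 * v.2 == v.1 * u.2)%N.
Proof. by move=> hu hv; rewrite eq_le !qval_le // eqn_leq. Qed.

Definition farey_step (u v : nat * nat) : bool := (v.1 * u.2 == u.1 * v.2 + 1)%N.

Definition good (n : nat) (z : nat * nat) : bool := coprime z.1 z.2 && (0 < z.2 <= n)%N.

Lemma coprime_step u v : farey_step u v -> coprime u.1 u.2 /\ coprime v.1 v.2.
Proof.
move=> /eqP h.
by have /andP[] := @coprime_det v.1 u.1 v.2 u.2 h.
Qed.

Lemma steps_sorted n x s : all (fun z => 0 < z.2 <= n)%N (x :: s) -> path farey_step x s ->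
  sorted <%R (map qval (x :: s)).
Proof.
elim: s x => //= y s IHs x /and3P[/andP[x0 _] hy hs] /andP[xy ys].
rewrite [path _ _ _](IHs y) ?hy ?hs // andbT qval_lt //; last by case/andP: hy.
by rewrite (eqP xy) addn1.
Qed.

(* Fuel [n] suffices; with less, the list still satisfies [farey_step] but may omit terms. *)
Fixpoint stern_brocot (fuel : nat) (n a b c d : N) (acc : seq (N * N)) : seq (N * N) :=
  if fuel is f.+1 then
    let m := N.add b d in
    if N.leb m n then stern_brocot f n a b (N.add a c) m (stern_brocot f n (N.add a c) m c d acc)
    else (a, b) :: acc
  else (a, b) :: acc.

Definition nat_pair (z : N * N) : nat * nat := (N.to_nat z.1, N.to_nat z.2).

(** Completeness of the list is not asserted: the windows need enough fractions, not all of them,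
    and determinant 1 between neighbours already makes the terms reduced and increasing. *)
Lemma stern_brocotP fuel (n a b c d : N) acc :
  let f := map nat_pair in
  farey_step (nat_pair (a, b)) (nat_pair (c, d)) ->
  all (fun z => 0 < z.2 <= N.to_nat n)%N (nat_pair (a, b) :: nat_pair (c, d) :: f acc) ->
  path farey_step (nat_pair (c, d)) (f acc) ->
  exists l, [/\ stern_brocot fuel n a b c d ((c, d) :: acc) = (a, b) :: l,
    path farey_step (nat_pair (a, b)) (f l),
    all (fun z => 0 < z.2 <= N.to_nat n)%N (nat_pair (a, b) :: f l) &
    last (a, b) l = last (c, d) acc].
Proof.
elim: fuel a b c d acc => [|fuel IHf] a b c d acc f step dens pth.
  by exists ((c, d) :: acc); split=> //=; rewrite step.
rewrite /=; case: ifP => [le_m|_]; last first.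
  by exists ((c, d) :: acc); split=> //=; rewrite step.
case/and3P: dens => ab cd dacc.
have ok_m : (0 < N.to_nat (N.add b d) <= N.to_nat n)%N.
  by move: le_m ab cd; rewrite /nat_pair /=; clear; lia.
have step2 : farey_step (nat_pair (N.add a c, N.add b d)) (nat_pair (c, d)).
  by move: step; rewrite /farey_step /nat_pair /=; clear; lia.
have step1 : farey_step (nat_pair (a, b)) (nat_pair (N.add a c, N.add b d)).
  by move: step; rewrite /farey_step /nat_pair /=; clear; lia.
have dens1 : all (fun z => 0 < z.2 <= N.to_nat n)%N
    (nat_pair (N.add a c, N.add b d) :: nat_pair (c, d) :: f acc) by rewrite /= ok_m cd.
have [l1 [-> p1 d1 e1]] := IHf (N.add a c) (N.add b d) c d acc step2 dens1 pth.
have dens2 : all (fun z => 0 < z.2 <= N.to_nat n)%N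
    (nat_pair (a, b) :: nat_pair (N.add a c, N.add b d) :: f l1).
  by case/andP: d1 => dm dl; rewrite /= ab dm.
have [l2 [-> p2 d2 e2]] := IHf a b (N.add a c) (N.add b d) l1 step1 dens2 p1.
by exists l2; split=> //; rewrite e2.
Qed.

Definition win_point (n a b : nat) (z : nat * nat) : bool :=
  [&& good n z, a * z.2 < z.1 * b & z.1 * b * (n - 1) < (n * a + b) * z.2]%N.

(* For a start [xi] in [[u, w)] with [w] the successor of [u] and an order [n <= n1], the window
   reaches beyond [v] (if [u = 0], from [xi >= 1 / n1]). *)
Definition window_ok (n1 : N) (u v : N * N) : bool :=
  let u := if N.eqb u.1 0 then (1%num, n1) else u in
  N.ltb (N.mul (N.sub (N.mul v.1 u.2) (N.mul u.1 v.2)) (N.pred n1)) (N.mul (N.add u.1 u.2) v.2).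

(* Starting points left out: those from [1/q] on, those close to [1], and those just below [1/2]. *)
Definition slope_limit (q : N) (u : N * N) : bool := N.ltb 0 q && N.leb u.2 (N.mul q u.1).

Definition end_skip (n1 : N) (u : N * N) : bool :=
  N.ltb (N.mul n1 u.2) (N.add (N.mul n1 u.1) (N.mul 2 u.2)).

Definition half_skip (n1 : N) (u : N * N) (l : seq (N * N)) : bool :=
  N.ltb (N.mul n1 u.2) (N.add (N.mul (N.mul 2 n1) u.1) (N.mul 3 u.2)) &&
  (if l is w :: _ then N.leb (N.mul 2 w.1) w.2 else false).

(* [l'] is [l] advanced by the number of terms that each window must contain. *)
Fixpoint walk (n1 q : N) (l l' : seq (N * N)) : bool :=
  if l is u :: l2 then
    [|| slope_limit q u, (if l' is v :: _ then window_ok n1 u v else false), end_skip n1 u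
      | half_skip n1 u l2] &&
    walk n1 q l2 (behead l')
  else true.

Lemma behead_drop (T : Type) (K : nat) (s : seq T) : behead (drop K s) = drop K (behead s).
Proof. by rewrite -!drop1 !drop_drop addnC. Qed.

(** The right end of the window is [xi + (xi + 1) / (n - 1)]: it increases with [xi] and decreases
    with [n]. *)
Lemma window_mono (n n1 a b c d a' b' : nat) : (0 < n)%N -> (n <= n1)%N -> (0 < b)%N -> (0 < d)%N ->
  (a * b' <= a' * b)%N -> (a * d <= c * b)%N -> (0 < b')%N -> (c * b * n1.-1 < (n1 * a + b) * d)%N ->
  (c * b' * n.-1 < (n * a' + b') * d)%N.
Proof.
case: n n1 => [|n] [|n1] //= _; rewrite ltnS => le_n b0 d0 hab had b'0 hw.
have [k kE] : exists k, (c * b = a * d + k)%N by exists (c * b - a * d)%N; rewrite subnKC.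
have hk1 : (k * n1 < (a + b) * d)%N by move: hw; rewrite kE; clear; nia.
have hk : (k * n < (a + b) * d)%N by apply: leq_ltn_trans hk1; rewrite leq_mul2l le_n orbT.
have h1 : (c * b * n < (n.+1 * a + b) * d)%N by move: hk; rewrite kE; clear; nia.
have h2 : (c * b * n * b' < (n.+1 * a + b) * d * b')%N by rewrite ltn_pmul2r.
have h3 : (n.+1 * d * (a * b') <= n.+1 * d * (a' * b))%N by rewrite leq_mul2l hab orbT.
have : (c * b' * n * b < (n.+1 * a' + b') * d * b)%N by move: h2 h3; clear; nia.
by rewrite ltn_pmul2r.
Qed.

(** Adding [(n - 1) * a * d] to both sides turns the test evaluated by [window_ok] into the window
    condition. *)
Lemma slope_det (n a b c d : nat) : (0 < n)%N -> ((c * b - a * d) * n.-1 < (a + b) * d)%N ->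
  (c * b * n.-1 < (n * a + b) * d)%N.
Proof.
case: n => [//|n] _; rewrite [n.+1.-1]/=.
have -> : ((n.+1 * a + b) * d = a * d + n * (a * d) + b * d)%N by rewrite mulnDl mulSn mulnDl mulnA.
rewrite mulnDl.
move: (c * b)%N (a * d)%N (b * d)%N => x y z.
have [/ltnW le_xy|le_yx] := ltnP x y; last by rewrite mulnBl; nia.
have : (x * n <= y * n)%N by rewrite leq_mul2r le_xy orbT.
by rewrite (eqP le_xy); nia.
Qed.

Lemma ltb_slope (n a b c d : N) :
  N.ltb (N.mul (N.sub (N.mul c b) (N.mul a d)) (N.pred n)) (N.mul (N.add a b) d) ->
  ((N.to_nat c * N.to_nat b - N.to_nat a * N.to_nat d) * (N.to_nat n).-1 <
   (N.to_nat a + N.to_nat b) * N.to_nat d)%N.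
Proof.
move=> h; rewrite -multE -plusE -minusE.
rewrite -!(Nnat.N2Nat.inj_mul, Nnat.N2Nat.inj_sub, Nnat.N2Nat.inj_add, Nnat.N2Nat.inj_pred).
by move: h; clear; lia.
Qed.

(** From [k * a + r <= b <= n] follows [k * (a / b) <= 1 - r / n], while the last hypothesis says
    [k * (u1 / u2) > 1 - r / n]. The pair [(k, r) = (1, 2)] serves for terms near 1 and [(2, 3)] for
    those just below [1/2]. *)
Lemma slope_skip (n b a u1 u2 k r : nat) : (0 < u2)%N -> (0 < r)%N -> (b <= n)%N -> (k * a + r <= b)%N ->
  (k * u1 * b <= k * a * u2)%N -> (n * u2 < k * n * u1 + r * u2)%N -> False.
Proof.
move=> u2_gt0 r_gt0 bn hr hu hn.
have h1 : ((k * a + r) * u2 <= b * u2)%N by rewrite leq_mul2r hr orbT.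
have [le_k|lt_k] := leqP u2 (k * u1).
  have : (u2 * b <= k * u1 * b)%N by rewrite leq_mul2r le_k orbT.
  have : (0 < r * u2)%N by rewrite muln_gt0 r_gt0.
  by move: h1 hu; clear; lia.
have [d dE] : exists d, u2 = (k * u1 + d)%N by exists (u2 - k * u1)%N; rewrite subnKC // ltnW.
have h2 : (d * b <= d * n)%N by rewrite leq_mul2l bn orbT.
have h3 : (n * d < r * u2)%N by move: hn; rewrite {1}dE; clear; nia.
have h4 : (r * u2 <= d * b)%N by move: h1 hu; rewrite {2}dE; clear; nia.
by move: (leq_trans h3 h4) h2; clear; lia.
Qed.

Lemma path_coprime u w l z : farey_step u w -> path farey_step w l -> z \in w :: l ->
  coprime z.1 z.2.
Proof.
elim: l u w => [|v l IHl] u w uw.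
  by move=> _; rewrite inE => /eqP->; case: (coprime_step uw).
move=> /andP[wv vl]; rewrite inE => /predU1P[->|]; first by case: (coprime_step uw).
exact: (IHl w v wv vl).
Qed.

Lemma nat_pairE u : ((nat_pair u).1 = N.to_nat u.1) * ((nat_pair u).2 = N.to_nat u.2).
Proof. by []. Qed.

(** Once [u] is the last listed term at or below [a / b], the next [K] terms lie above [a / b], and
    they are in the window as soon as the last of them, [v], is. The test was made for the worst
    case, the start [u] and the order [n1]. *)
Lemma walkP (n0 n1 q : N) (K n a b : nat) (u : N * N) (l : seq (N * N)) :
  path farey_step (nat_pair u) (map nat_pair l) ->
  all (fun z => 0 < z.2 <= N.to_nat n0)%N (map nat_pair (u :: l)) ->
  walk n1 q (u :: l) (drop K (u :: l)) -> (0 < K)%N ->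
  (N.to_nat n0 <= n <= N.to_nat n1)%N -> (0 < a)%N -> (0 < b <= n)%N ->
  (a + 2 <= b)%N -> (b <= 2 * a)%N || (2 * a + 3 <= b)%N -> (N.to_nat q * a < b)%N ->
  qval (nat_pair u) <= qval (a, b) -> qval (a, b) < qval (nat_pair (last u l)) ->
  exists L : seq (nat * nat), [/\ uniq L, all (win_point n a b) L & size L = K].
Proof.
move=> pth dens wk K0 /andP[n0n nn1] a0 /andP[b0 bn] ab2 half hq.
elim: l u pth dens wk => [|w l IHl] u pth dens wk le_u lt_l.
  by move: (le_lt_trans le_u lt_l); rewrite ltxx.
have /andP[wk1 wk2] := wk.
have [du dwl'] := andP dens.
have dwl : all (fun z => 0 < z.2 <= N.to_nat n0)%N (map nat_pair (w :: l)) := dwl'.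
have /andP[dw dl] := dwl.
have /andP[uw wl] := pth.
have [le_w|lt_w] := leP (qval (nat_pair w)) (qval (a, b)).
  by apply: (IHl w) => //; move: wk2; rewrite behead_drop.
have u20 : (0 < (nat_pair u).2)%N by case/andP: du.
have w20 : (0 < (nat_pair w).2)%N by case/andP: dw.
have le_u' := le_u; rewrite qval_le //= in le_u'.
have lt_w' := lt_w; rewrite qval_lt //= in lt_w'.
have [hhalf|[hs|[hs|hw]]] : half_skip n1 u (w :: l) \/ end_skip n1 u \/ slope_limit q u \/
    is_true (if drop K [:: u, w & l] is v :: _ then window_ok n1 u v else false).
  case/or4P: wk1 => h; [by right; right; left | by right; right; right | by right; left | by left].
- exfalso; case/andP: hhalf => h1 h2; case/orP: half => half.
    move: h2 lt_w' half; rewrite ?nat_pairE; clear => h2 lt_w half.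
    have h3 : (2 * N.to_nat w.1 * b <= N.to_nat w.2 * b)%N by rewrite leq_mul2r; lia.
    have h4 : (b * N.to_nat w.2 <= 2 * a * N.to_nat w.2)%N by rewrite leq_mul2r half orbT.
    lia.
  apply: (@slope_skip (N.to_nat n1) b a (nat_pair u).1 (nat_pair u).2 2 3 u20 isT (leq_trans bn nn1)) => //.
    by rewrite -!mulnA leq_mul2l.
  by move: h1; rewrite ?nat_pairE; clear; lia.
- exfalso; apply: (@slope_skip (N.to_nat n1) b a (nat_pair u).1 (nat_pair u).2 1 2 u20 isT (leq_trans bn nn1)).
  + by rewrite mul1n.
  + by rewrite !mul1n; exact: le_u'.
  + by move: hs; rewrite /end_skip ?nat_pairE; clear; lia.
- exfalso; move: hs le_u' u20 hq; rewrite ?nat_pairE; clear => hs le_u' u20 hq.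
  have h : (N.to_nat u.2 <= N.to_nat q * N.to_nat u.1)%N by move: hs; rewrite /slope_limit; lia.
  have h1 : (N.to_nat u.2 * b <= N.to_nat q * N.to_nat u.1 * b)%N by rewrite leq_mul2r h orbT.
  have h2 : (N.to_nat q * (N.to_nat u.1 * b) <= N.to_nat q * (a * N.to_nat u.2))%N by rewrite leq_mul2l le_u' orbT.
  have h3 : (N.to_nat q * a * N.to_nat u.2 < b * N.to_nat u.2)%N by rewrite ltn_pmul2r.
  lia.
have szK : (K < size (u :: w :: l))%N.
  by rewrite ltnNge; apply/negP => /drop_oversize e; move: hw; rewrite e.
move: hw; rewrite (drop_nth u szK) -(prednK K0) [nth _ _ _]/=.
set v := nth u (w :: l) K.-1 => hw; rewrite /= ltnS in szK.
have srt : sorted <%R (map (fun z => qval (nat_pair z)) (w :: l)).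
  have -> : map (fun z => qval (nat_pair z)) (w :: l) = map qval (map nat_pair (w :: l)).
    by rewrite -map_comp.
  exact: (@steps_sorted (N.to_nat n0)).
exists (map nat_pair (take K.-1.+1 (w :: l))); rewrite (prednK K0); split.
- apply: (map_uniq (f := qval)); rewrite -map_comp map_take.
  by apply: take_uniq; apply: lt_sorted_uniq srt.
- apply/allP => z1 /mapP[z0 /(nthP u)[i lt_iK zE] -> {z1}].
  rewrite size_takel // in lt_iK; rewrite nth_take // in zE; rewrite -zE {z0 zE}; set z := nth u (w :: l) i.
  have lt_i : (i < size (w :: l))%N by apply: leq_trans lt_iK _.
  have lt_K : (K.-1 < size (w :: l))%N by rewrite prednK.
  have zin : nat_pair z \in map nat_pair (w :: l) by apply/map_f/mem_nth.
  have vin : nat_pair v \in map nat_pair (w :: l) by apply/map_f/mem_nth.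
  have /andP[z20 zn0] := allP dwl _ zin; have /andP[v20 _] := allP dwl _ vin.
  have mono i' j' : (i' <= j')%N -> (j' < size (w :: l))%N ->
      qval (nat_pair (nth u (w :: l) i')) <= qval (nat_pair (nth u (w :: l) j')).
    move=> le_ij lt_j; have lt_i' : (i' < size (w :: l))%N := leq_ltn_trans le_ij lt_j.
    rewrite -!(nth_map u 0 (fun z => qval (nat_pair z))) //.
    by apply: (sorted_leq_nth le_trans lexx 0 (sub_sorted (fun x y => @ltW _ _ x y) srt)) => //; rewrite inE size_map.
  have lt_abz : qval (a, b) < qval (nat_pair z) by apply: lt_le_trans lt_w (mono 0%N i _ _).
  have le_zv : qval (nat_pair z) <= qval (nat_pair v).
    by apply: mono => //; rewrite -ltnS prednK.
  have le_uv : qval (nat_pair u) <= qval (nat_pair v).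
    exact: le_trans le_u (le_trans (ltW lt_abz) le_zv).
  rewrite /win_point /good z20 (leq_trans zn0 n0n) andbT.
  have lt_abz' := lt_abz; have le_zv' := le_zv.
  rewrite qval_lt // in lt_abz; rewrite qval_le // in le_zv; rewrite qval_le // in le_uv.
  apply/and3P; split=> //.
    have pw : path farey_step (nat_pair w) (map nat_pair l) := wl.
    rewrite ?andbT.
    exact: (@path_coprime (nat_pair u) (nat_pair w) (map nat_pair l) (nat_pair z) uw pw zin).
  have n_gt0 : (0 < n)%N by apply: leq_trans bn.
  have hv : ((nat_pair v).1 * b * n.-1 < (n * a + b) * (nat_pair v).2)%N.
    move: hw; rewrite /window_ok; case: N.eqb_spec => [u1_eq0|_] hw; last first.
      apply: (window_mono n_gt0 nn1 u20 v20 le_u' le_uv b0).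
      exact: slope_det (leq_trans n_gt0 nn1) (ltb_slope hw).
    have v1_gt0 : (0 < (nat_pair v).1)%N.
      have := lt_le_trans lt_abz' le_zv'; rewrite qval_lt //.
      by case: (nat_pair v).1; rewrite ?mul0n.
    have v2_le : ((nat_pair v).2 <= N.to_nat n1)%N.
      by have /andP[_ ?] := allP dwl _ vin; apply: leq_trans (leq_trans n0n nn1).
    apply: (@window_mono n (N.to_nat n1) 1 (N.to_nat n1)) => //.
    + exact: leq_trans n_gt0 nn1.
    + rewrite mul1n; apply: leq_trans (leq_trans bn nn1) _; exact: leq_pmull.
    + rewrite mul1n; apply: leq_trans v2_le _; exact: leq_pmull.
    + exact: slope_det (leq_trans n_gt0 nn1) (ltb_slope hw).
  move: hv le_zv v20 z20; rewrite subn1; move: (nat_pair z) (nat_pair v) => [x y] [c d] /=.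
  clear; move=> hv le_zv d0 y0.
  have h1 : (x * d * (b * n.-1) <= c * y * (b * n.-1))%N by rewrite leq_mul2r le_zv orbT.
  have h2 : (c * b * n.-1 * y < (n * a + b) * d * y)%N by rewrite ltn_pmul2r.
  have : (x * b * n.-1 * d < (n * a + b) * y * d)%N by move: h1 h2; clear; nia.
  by rewrite ltn_pmul2r.
- by rewrite size_map size_takel.
Qed.

Definition walk_check (q c d : N) (g : N * N * N) : bool :=
  let l := stern_brocot (N.to_nat g.1.1) g.1.1 0 1 c d [:: (c, d)] in
  walk g.1.2 q l (drop (N.to_nat g.2) l).

(** [K] is compared with every [U n] of a row because [U] is not monotone. *)
Fixpoint grid_covers (n0 n1 : nat) (g : seq (N * N * N)) : bool :=
  if g is (a, b, K) :: g' then
    [&& N.to_nat a == n0, n0 <= N.to_nat b, 0 < N.to_nat K,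
        all (fun n => U n <= N.to_nat K) (iota n0 ((N.to_nat b).+1 - n0)) &
        grid_covers (N.to_nat b).+1 n1 g']%N
  else n0 == n1.

Definition grid_all : seq (N * N * N) :=
(  [:: (92, 94, 25); (95, 98, 27); (99, 101, 28); (102, 104, 29); (105, 106, 28); (107, 110, 30);
      (111, 114, 31); (115, 118, 32); (119, 122, 33); (123, 126, 34); (127, 131, 36);
      (132, 135, 37); (136, 139, 38)])%num.

Definition grid_half : seq (N * N * N) :=
(  [:: (140, 144, 39); (145, 150, 40); (151, 157, 42); (158, 163, 44); (164, 170, 45);
      (171, 176, 47); (177, 182, 48); (183, 189, 50); (190, 197, 52); (198, 205, 54);
      (206, 214, 56); (215, 223, 59); (224, 233, 61); (234, 242, 63); (243, 251, 66);
      (252, 262, 68); (263, 274, 71); (275, 286, 74); (287, 299, 78); (300, 300, 76)])%num.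

Definition grid_quarter : seq (N * N * N) :=
(  [:: (301, 316, 82); (317, 334, 86); (335, 354, 91); (355, 374, 96); (375, 396, 102);
      (397, 421, 108); (422, 446, 114); (447, 473, 121); (474, 502, 128); (503, 532, 136);
      (533, 565, 144); (566, 598, 152); (599, 634, 161); (635, 669, 170)])%num.

Definition grid_tenth : seq (N * N * N) :=
(  [:: (670, 710, 180); (711, 754, 191); (755, 801, 203); (802, 851, 216); (852, 903, 229);
      (904, 958, 242); (959, 1016, 257); (1017, 1078, 272); (1079, 1146, 289); (1147, 1218, 307);
      (1219, 1294, 326); (1295, 1349, 340)])%num.

Lemma grid_all_walks : all (walk_check 0%num 1%num 1%num) grid_all.
Proof. vm_cast_no_check (erefl true). Qed.

Lemma grid_half_walks : all (walk_check 2%num 1%num 1%num) grid_half.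
Proof. vm_cast_no_check (erefl true). Qed.

(** Starting points are tested below [1/4] only, but windows that start just below [1/4] extend
    beyond it, so the list runs on to [1/3]. The next grid treats [1/10] and [1/9] in the same
    way. *)
Lemma grid_quarter_walks : all (walk_check 4%num 1%num 3%num) grid_quarter.
Proof. vm_cast_no_check (erefl true). Qed.

Lemma grid_tenth_walks : all (walk_check 10%num 1%num 9%num) grid_tenth.
Proof. vm_cast_no_check (erefl true). Qed.

Lemma grid_all_covers : grid_covers 92 140 grid_all.
Proof. vm_cast_no_check (erefl true). Qed.

Lemma grid_half_covers : grid_covers 140 301 grid_half.
Proof. vm_cast_no_check (erefl true). Qed.

Lemma grid_quarter_covers : grid_covers 301 670 grid_quarter.
Proof. vm_cast_no_check (erefl true). Qed.

Lemma grid_tenth_covers : grid_covers 670 1350 grid_tenth.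
Proof. vm_cast_no_check (erefl true). Qed.

Lemma grid_coversP n0 n1 g n : grid_covers n0 n1 g -> (n0 <= n < n1)%N ->
  exists2 k, k \in g & [&& n0 <= N.to_nat k.1.1, N.to_nat k.1.1 <= n <= N.to_nat k.1.2,
                         0 < N.to_nat k.2 & U n <= N.to_nat k.2]%N.
Proof.
elim: g n0 => [|[[a b] K] g IHg] n0 /=.
  by move=> /eqP -> /andP[/leq_ltn_trans h /h]; rewrite ltnn.
case/and5P=> /eqP aE le_ab K0 hU hg /andP[n0n nn1].
have [le_b|lt_b] := leqP n (N.to_nat b).
  exists (a, b, K); first by rewrite inE eqxx.
  rewrite /= aE leqnn n0n le_b K0; apply: (allP hU).
  have le_n0b : (n0 <= (N.to_nat b).+1)%N by apply: leq_trans (leq_trans n0n le_b) _.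
  by rewrite mem_iota n0n subnKC // ltnS.
have [|k kg /and4P[h1 h2 h3 h4]] := IHg (N.to_nat b).+1 hg; first by rewrite lt_b.
exists k; first by rewrite inE kg orbT.
by rewrite h2 h3 h4 (leq_trans _ h1) ?leqW.
Qed.

Lemma walk_windows (q d : N) n0 n1 g n a b :
  all (walk_check q 1 d) g -> grid_covers n0 n1 g -> (n0 <= n < n1)%N ->
  (0 < N.to_nat d <= n0)%N -> (0 < a)%N -> (0 < b <= n)%N ->
  (a + 2 <= b)%N -> (b <= 2 * a)%N || (2 * a + 3 <= b)%N -> (N.to_nat q * a < b)%N ->
  (a * N.to_nat d < b)%N ->
  exists L : seq (nat * nat), [/\ uniq L, all (win_point n a b) L & (U n <= size L)%N].
Proof.
move=> walks covers rn /andP[d0 dn0] a0 b_ok ab half hq hd.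
have [k kg /and4P[k0 rk K0 hU]] := grid_coversP covers rn.
have := allP walks _ kg; rewrite /walk_check.
have step : farey_step (nat_pair (0%num, 1%num)) (nat_pair (1%num, d)).
  by rewrite /farey_step !nat_pairE /=.
have k0_gt0 : (0 < N.to_nat k.1.1)%N by apply: leq_trans k0; apply: leq_trans dn0.
have dens : all (fun z => 0 < z.2 <= N.to_nat k.1.1)%N
    (nat_pair (0%num, 1%num) :: nat_pair (1%num, d) :: map nat_pair [::]).
  by rewrite /= k0_gt0 d0 (leq_trans dn0 k0).
have [l [-> pth dl lst]] := @stern_brocotP (N.to_nat k.1.1) k.1.1 0 1 1 d [::] step dens isT.
move=> wk.
have [||L [uL aL sL]] := @walkP k.1.1 k.1.2 q (N.to_nat k.2) n a b _ _ pth dl wk K0 rk a0 b_ok ab half hq.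
- by rewrite qval_le //; case/andP: b_ok.
- by rewrite lst /= qval_lt //=; [rewrite mul1n | case/andP: b_ok].
by exists L; rewrite sL.
Qed.

(** * Discordant pairs *)

(** Return from [(x, x + y)] to the fraction [x / y]. The bound [y < n] comes from
    [(n + c) * y < n * (x + y) < n * N], where the first step is [c * y < n * x]. *)
Lemma in_window_point (n a b : nat) (z : int * int) (c := (n * a)%N%:R / b%:R : rat) :
  (1 < n)%N -> (0 < a)%N -> (0 < b)%N -> in_window (n%:R + c) c z ->
  [&& 0 < z.1, z.1 < z.2 & win_point n a b (`|z.1|%N, `|z.2 - z.1|%N)].
Proof.
case: z => x s /= n1 a0 b0.
have n0 : 0 < n%:R :> rat by rewrite ltr0n ltnW.
have bR : 0 < b%:R :> rat by rewrite ltr0n.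
have c0 : 0 < c by rewrite divr_gt0 // ltr0n muln_gt0 a0 ltnW.
rewrite /in_window /= => /and4P[cop h1 h2 h3].
pose y := s - x; have sE : s = x + y by rewrite /y addrC subrK.
rewrite sE addrC addKr; move: cop h1 h2 h3; rewrite sE intrD.
set X : rat := x%:~R; set Y : rat := y%:~R => cop h1 h2 h3.
have k1 : c * Y < n%:R * X by rewrite -subr_gt0; move: h1; rewrite -subr_gt0; congr (0 < _); ring.
have k2 : X * (n%:R - 1) < (c + 1) * Y by rewrite -subr_gt0; move: h2; rewrite -subr_gt0; congr (0 < _); ring.
have nc : 0 < n%:R + c by rewrite addr_gt0.
have n10 : 0 < n%:R - 1 :> rat by rewrite subr_gt0 ltr1n.
have Y0 : 0 < Y.
  rewrite -(pmulr_rgt0 _ nc).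
  have := ltrD (y := n%:R * X * (n%:R - 1)) (t := n%:R * ((c + 1) * Y)) (x := c * Y * (n%:R - 1))
    (z := n%:R * (X * (n%:R - 1))).
  rewrite ltr_pM2r // ltr_pM2l // => /(_ k1 k2); rewrite -subr_gt0; congr (0 < _); ring.
have X0 : 0 < X by rewrite -(pmulr_rgt0 _ n0) (lt_trans _ k1) // mulr_gt0.
have Yn : Y < n%:R.
  rewrite -(ltr_pM2l nc).
  rewrite mulrDl; apply: (@lt_trans _ _ (n%:R * (X + Y))).
    by rewrite addrC mulrDr ltrD2r.
  by rewrite [ltRHS]mulrC ltr_pM2l.
have x0 : 0 < x by move: X0; rewrite /X ltr0z.
have y0 : 0 < y by move: Y0; rewrite /Y ltr0z.
rewrite x0 ltrDl y0 /=.
clear h1 h2 h3 sE; move: x y x0 y0 cop @X @Y k1 k2 Yn X0 Y0 => [x|//] [y|//] x0 y0 cop /= k1 k2 Yn _ _.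
rewrite /win_point /good /=.
have {k1} : c * y%:R < n%:R * x%:R := k1.
have {k2} : x%:R * (n%:R - 1) < (c + 1) * y%:R := k2.
have -> : c + 1 = (n * a + b)%N%:R / b%:R by rewrite natrD mulrDl divff // lt0r_neq0.
rewrite /c ![_ / _ * _]mulrAC ltr_pdivlMr // ltr_pdivrMr // -[1]/(1%:R) -natrB ?(ltnW n1) //.
rewrite -!natrM !ltr_nat => k2 k1.
have {}Yn : (y <= n)%N by rewrite -(ler_nat rat); apply: ltW.
apply/and3P; split.
- apply/andP; split; last exact/andP.
  have : coprime x (x + y) := cop; by rewrite /coprime gcdnDl.
- by move: k1; rewrite -!mulnA ltn_pmul2l // ltnW.
- by move: k2; rewrite mulnAC.
Qed.

Lemma window_main (n a b : nat) : (92 <= n)%N -> (0 < a)%N -> (a + 2 <= b <= n)%N ->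
  (b <= 2 * a)%N || (2 * a + 3 <= b)%N ->
  exists L : seq (nat * nat), [/\ uniq L, all (win_point n a b) L & (U n <= size L)%N].
Proof.
move=> n92 a0 /andP[ab bn] half.
have b0 : (0 < b)%N by apply: leq_trans ab; rewrite addn2.
have n1 : (1 < n)%N by apply: leq_trans n92.
have n0 := ltnW n1.
pose c : rat := (n * a)%N%:R / b%:R.
have bR : 0 < b%:R :> rat by rewrite ltr0n.
have nR : 0 < n%:R :> rat by rewrite ltr0n.
have le_c k : (k%:R <= c) = (k * b <= n * a)%N by rewrite ler_pdivlMr // -natrM ler_nat.
have c_le k : (c <= k%:R) = (n * a <= k * b)%N by rewrite ler_pdivrMr // -natrM ler_nat.
have c1 : 1 <= c.
  by rewrite -[1]/(1%:R) le_c mul1n (leq_trans bn) // leq_pmulr.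
have c2 : c <= n%:R - 2.
  rewrite -[2]/(2%:R) -natrB // c_le mulnBl leq_subRL.
    by apply: leq_trans (leq_mul (leqnn n) ab); rewrite mulnDr; move: bn; clear; lia.
  exact: leq_mul.
have chalf : n%:R <= 2 * c \/ 2 * c + 3 <= n%:R.
  case/orP: half => half; [left|right].
    rewrite mulrA ler_pdivlMr // -[2]/(2%:R) -!natrM ler_nat; move: half n0 bn; clear; nia.
  rewrite -lerBrDr mulrA ler_pdivrMr // mulrBl lerBrDr -[2]/(2%:R) -[3]/(3%:R) -!natrM -natrD ler_nat.
  move: half n0 bn; clear; nia.
suff: rich (n%:R + c) c n%:R \/
  exists L : seq (nat * nat), [/\ uniq L, all (win_point n a b) L & (U n <= size L)%N].
  case=> // -[L [uL aL sL]].
  have prp z : z \in L -> [&& 0 < z.1, z.1 < z.2 & win_point n a b (`|z.1|%N, `|z.2 - z.1|%N)].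
    by move=> /(allP aL); apply: in_window_point.
  exists [seq (`|z.1|%N, `|z.2 - z.1|%N) | z <- L]; split.
  - rewrite map_inj_in_uniq // => -[x s] [x' s'] /prp/and3P[h1 h2 _] /prp/and3P[h3 h4 _] [].
    by move: h1 h2 h3 h4 => /=; clear => h1 h2 h3 h4 e1 e2; congr pair; lia.
  - by apply/allP=> _ /mapP[z /prp/and3P[_ _ h] ->].
  rewrite size_map; move: sL; rewrite -[13]/(13%:R) -[4]/(4%:R) -natrD -natrM ler_nat /U.
  by clear; case: (n %% 4)%N (divn_eq n 4) => [|[|[|k]]]; lia.
(* Below 1350 the strip method is used only for [xi] at least [1/10], [1/4] or [1/2], a threshold
   that grows as [n] decreases. Smaller slopes go to the grids, and below 140 all slopes do. *)
have [h1350|h1350] := leqP 1350 n.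
  left; apply: rich_large => //.
  by rewrite ratZ_pos ler_nat; move: h1350; clear; lia.
have ncE : n%:R + c = (n * b + n * a)%N%:R / b%:R.
  by rewrite natrD mulrDl natrM mulfK // lt0r_neq0.
have le_nc k : (k%:R <= n%:R + c) = (k * b <= n * b + n * a)%N.
  by rewrite ncE ler_pdivlMr // -natrM ler_nat.
have slope k l : (k%:R * n%:R <= (n%:R + c) * l%:R) = (k * n * b <= (n * b + n * a) * l)%N.
  by rewrite ncE mulrAC ler_pdivlMr // -!natrM ler_nat.
have c_n : c <= n%:R by rewrite c_le leq_mul // (leq_trans _ ab) // leq_addr.
have top (k : positive) : (n + n <= Pos.to_nat k)%N -> n%:R + c <= ratZ (Zpos k).
  by move=> hk; apply: le_trans (lerD (lexx _) c_n) _; rewrite ratZ_pos -natrD ler_nat.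
have [hn|lt670] := leqP 670 n.
  have [hk|hk] := leqP b (10 * a); last first.
    right; apply: (walk_windows (d := 9) grid_tenth_walks grid_tenth_covers); rewrite ?hn ?b0 //.
    by move: hk ab; clear; lia.
  left; apply: (rich_mid out_table_tenth in_table_tenth c1 c2 chalf).
  - by rewrite ratZ_pos le_c; move: hk hn; clear; nia.
  - by apply: top; move: h1350; clear; lia.
  - exact: ratZ_pos_gt0.
  - by rewrite ratZ_pos le_nc; move: hk hn; clear; nia.
  - exact: ratZ_pos_gt0.
  - by rewrite !ratZ_pos slope; move: hk; clear; nia.
have [hn|lt301] := leqP 301 n.
  have [hk|hk] := leqP b (4 * a); last first.
    right; apply: (walk_windows (d := 3) grid_quarter_walks grid_quarter_covers); rewrite ?hn ?b0 //.
    by move: hk ab; clear; lia.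
  left; apply: (rich_mid out_table_quarter in_table_quarter c1 c2 chalf).
  - by rewrite ratZ_pos le_c; move: hk hn; clear; nia.
  - by apply: top; move: h1350; clear; lia.
  - exact: ratZ_pos_gt0.
  - by rewrite ratZ_pos le_nc; move: hk hn; clear; nia.
  - exact: ratZ_pos_gt0.
  - by rewrite !ratZ_pos slope; move: hk; clear; nia.
have [hn|lt140] := leqP 140 n.
  have [hk|hk] := leqP b (2 * a); last first.
    right; apply: (walk_windows (d := 1) grid_half_walks grid_half_covers); rewrite ?hn ?b0 //.
    by move: hk ab; clear; lia.
  left; apply: (rich_mid out_table_half in_table_half c1 c2 chalf).
  - by rewrite ratZ_pos le_c; move: hk hn; clear; nia.
  - by apply: top; move: h1350; clear; lia.
  - exact: ratZ_pos_gt0.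
  - by rewrite ratZ_pos le_nc; move: hk hn; clear; nia.
  - exact: ratZ_pos_gt0.
  - by rewrite !ratZ_pos slope; move: hk; clear; nia.
right; apply: (walk_windows (d := 1) grid_all_walks grid_all_covers); rewrite ?n92 ?b0 //.
by move: ab; clear; lia.
Qed.

Definition in_between (n : nat) (u v z : nat * nat) : bool :=
  [&& good n z, u.1 * z.2 < z.1 * u.2 & z.1 * v.2 < v.1 * z.2]%N.

Lemma qval_inj n : {in good n &, injective qval}.
Proof.
move=> [a b] [c d] /andP[/= ab /andP[b0 _]] /andP[/= cd /andP[d0 _]] /eqP.
rewrite qval_eq //= => /eqP e.
have bd : b = d.
  apply/eqP; rewrite eqn_dvd; apply/andP; split.
    by rewrite -(@Gauss_dvdr b a) 1?coprime_sym // e dvdn_mull.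
  by rewrite -(@Gauss_dvdr d c) 1?coprime_sym // -e dvdn_mull.
by move/eqP: e; rewrite bd eqn_pmul2r // => /eqP->.
Qed.

Lemma numden_qval n z : good n z -> numq (qval z) = z.1 /\ denq (qval z) = z.2.
Proof.
case/andP=> cz /andP[z0 _].
have z20 : z.2%:Z != 0 by rewrite eqz_nat -lt0n.
have e : qval z = z.1%:Z%:Q / z.2%:Z%:Q by [].
by rewrite e coprimeq_num // coprimeq_den // (negbTE z20) gtr0_sg ?ltz_nat // mul1r.
Qed.

Lemma qval_farey n z : good n z -> (z.1 <= z.2)%N -> qval z \in farey n.
Proof.
move=> gz le_z; have /andP[_ /andP[z0 zn]] := gz.
rewrite mem_farey (numden_qval gz).2 lez_nat zn andbT /qval divr_ge0 ?ler0n //=.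
by rewrite ler_pdivrMr ?ltr0n // mul1r ler_nat.
Qed.

Lemma fareyP n x : x \in farey n -> exists z, [/\ good n z, (z.1 <= z.2)%N & x = qval z].
Proof.
rewrite mem_farey => /and3P[x0 x1 xn].
have xE : x = qval (`|numq x|%N, `|denq x|%N).
  rewrite /qval /= !pmulrn.
  have e1 : (`|numq x|%N : int) = numq x by rewrite gez0_abs // numq_ge0.
  have e2 : (`|denq x|%N : int) = denq x by rewrite absz_denq.
  by rewrite e1 e2 divq_num_den.
exists (`|numq x|%N, `|denq x|%N); split=> //.
  rewrite /good /= coprime_num_den absz_gt0 denq_neq0 /=.
  by move: xn; rewrite -absz_denq lez_nat.
by move: x1; rewrite {1}xE /qval /= ler_pdivrMr ?ltr0n ?absz_gt0 ?denq_neq0 // mul1r ler_nat.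
Qed.

Lemma in_between_index n i j u v L : (i < j < size (farey n))%N ->
  (farey n)`_i = qval u -> (farey n)`_j = qval v -> good n u -> good n v ->
  uniq L -> all (in_between n u v) L -> (size L <= j - i - 1)%N.
Proof.
move=> /andP[ij jn] iE jE gu gv uL aL.
have lt_in := ltn_trans ij jn.
have /andP[_ /andP[u0 _]] := gu; have /andP[_ /andP[v0 _]] := gv.
have v1 : (v.1 <= v.2)%N.
  have : qval v \in farey n by rewrite -jE mem_nth.
  by rewrite mem_farey => /and3P[_ + _]; rewrite ler_pdivrMr ?ltr0n // mul1r ler_nat.
pose ix z := index (qval z) (farey n).
have inF z : z \in L -> [/\ good n z, qval z \in farey n & i < ix z < j]%N.
  move=> /(allP aL) /and3P[gz uz zv]; have /andP[_ /andP[z0 _]] := gz.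
  have zF : qval z \in farey n.
    apply: qval_farey => //.
    have h : (z.1 * v.2 < z.2 * v.2)%N.
      by apply: leq_trans zv _; rewrite mulnC leq_mul2l v1 orbT.
    by rewrite -(leq_pmul2r v0) ltnW.
  have zi : (ix z < size (farey n))%N by rewrite index_mem.
  split=> //; apply/andP; split.
    by rewrite -(lt_sorted_ltn_nth 0 (farey_sorted n)) ?inE // nth_index // iE qval_lt.
  by rewrite -(lt_sorted_ltn_nth 0 (farey_sorted n)) ?inE // nth_index // jE qval_lt.
rewrite -(size_map ix) -subnDA addn1 -(size_iota i.+1 (j - i.+1)); apply: uniq_leq_size.
  rewrite map_inj_in_uniq // => x y /inF[gx xF _] /inF[gy yF _] e.
  apply: (qval_inj gx gy).
  by rewrite -(nth_index 0 xF) -(nth_index 0 yF); congr nth.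
by move=> k /mapP[z /inF[_ _ hz] ->]; rewrite mem_iota subnKC.
Qed.

Lemma gap_le_size n u v L : good n u -> good n v -> (v.1 <= v.2)%N -> (u.1 < v.1)%N -> (v.2 < u.2)%N ->
  (forall z, in_between n u v z -> z \in L) -> (farey_gap n <= size L)%N.
Proof.
move=> gu gv v1 uv1 uv2 hL.
have /andP[_ /andP[u0 _]] := gu; have /andP[_ /andP[v0 _]] := gv.
have uF : qval u \in farey n.
  by apply: qval_farey => //; apply: ltnW; apply: leq_trans uv1 (leq_trans v1 (ltnW uv2)).
have vF : qval v \in farey n by apply: qval_farey.
have lt_uv : qval u < qval v.
  by rewrite qval_lt // (leq_trans (n := v.1 * v.2)) ?ltn_pmul2r ?leq_mul2l ?(ltnW uv2) ?orbT.
set i := index (qval u) (farey n); set j := index (qval v) (farey n).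
have jn : (j < size (farey n))%N by rewrite index_mem.
have i_n : (i < size (farey n))%N by rewrite index_mem.
have ij : (i < j)%N by rewrite -(lt_sorted_ltn_nth 0 (farey_sorted n)) ?inE // !nth_index.
have dis : discordant n i j.
  rewrite /discordant ij /fnum /fden !nth_index //.
  rewrite !(numden_qval gu).1 !(numden_qval gu).2 !(numden_qval gv).1 !(numden_qval gv).2.
  by rewrite pmulr_rlt0 ?subr_gt0 ?subr_lt0 ltz_nat.
apply: leq_trans (farey_gap_le jn dis) _.
have le_sz : (j - i.+1 <= size (drop i.+1 (farey n)))%N by rewrite size_drop leq_sub2r // ltnW.
have -> : (j - i - 1 = size (take (j - i.+1) (drop i.+1 (farey n))))%N.
  by rewrite size_takel // -subnDA addn1.
rewrite -(size_map qval L); apply: uniq_leq_size.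
  by rewrite take_uniq ?drop_uniq // lt_sorted_uniq ?farey_sorted.
move=> x /(nthP 0)[k]; rewrite size_takel // => hk.
rewrite nth_take // nth_drop => xE.
have lt_k : (i.+1 + k < j)%N by move: hk; clear; lia.
have lt_kn := ltn_trans lt_k jn.
have /fareyP[z [gz _ zE]] : x \in farey n by rewrite -xE mem_nth.
have /andP[_ /andP[z0 _]] := gz.
rewrite zE; apply/map_f/hL; rewrite /in_between gz -!qval_lt // -zE -xE /=.
rewrite -(nth_index 0 uF) -(nth_index 0 vF) !(lt_sorted_ltn_nth 0 (farey_sorted n)) ?inE //.
by rewrite lt_k addSn ltnS leq_addr.
Qed.

Lemma discordant_pair n i j : (j < size (farey n))%N -> discordant n i j ->
  exists u v, [/\ (farey n)`_i = qval u, (farey n)`_j = qval v, good n u, good n v &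
    [/\ u.1 < v.1, v.2 < u.2 & v.1 <= v.2]%N].
Proof.
move=> jn /andP[ij]; have i_n := ltn_trans ij jn; rewrite /fnum /fden.
have /fareyP[u [gu u1 uE]] : (farey n)`_i \in farey n by rewrite mem_nth.
have /fareyP[v [gv v1 vE]] : (farey n)`_j \in farey n by rewrite mem_nth.
have /andP[_ /andP[u0 _]] := gu; have /andP[_ /andP[v0 _]] := gv.
have : qval u < qval v.
  by rewrite -uE -vE (lt_sorted_ltn_nth 0 (farey_sorted n)) ?inE.
rewrite qval_lt // => lt_uv.
rewrite uE vE (numden_qval gu).1 (numden_qval gu).2 (numden_qval gv).1 (numden_qval gv).2 => dis.
exists u, v; split=> //.
suff : (u.1 < v.1)%N && (v.2 < u.2)%N by case/andP.
have [c|c] := ltnP u.1 v.1.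
  by move: dis; rewrite pmulr_rlt0 ?subr_gt0 ?subr_lt0 ltz_nat.
exfalso; have [d|d] := leqP v.2 u.2.
  move: dis; rewrite ltNge mulr_le0 //; by rewrite subr_le0 lez_nat.
by move: lt_uv; rewrite ltnNge leq_mul // ltnW.
Qed.

Lemma leq_gap n K : (4 <= n)%N ->
  (forall u v, good n u -> good n v -> u.1 < v.1 -> v.2 < u.2 -> v.1 <= v.2 ->
    exists L, [/\ uniq L, all (in_between n u v) L & K <= size L])%N -> (K <= farey_gap n)%N.
Proof.
move=> n4 h; have [i [j [jn dis ->]]] := farey_gap_attained n4.
have [u [v [iE jE gu gv [uv1 uv2 v1]]]] := discordant_pair jn dis.
have [L [uL aL sL]] := h u v gu gv uv1 uv2 v1.
have ij : (i < j < size (farey n))%N by rewrite jn andbT; case/andP: dis.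
exact: leq_trans sL (in_between_index ij iE jE gu gv uL aL).
Qed.

(* The points [(x, y)] with [y <= 2 * h + 1] and [2 * x - y] equal to [0], [1] or [-1]; the
   last two lie at distance [1 / (2 * y)] from [1/2]. *)
Definition half_points (l r h : nat) : seq (nat * nat) :=
  (1, 2)%N :: [seq (i.+1, 2 * i + 1)%N | i <- iota r (h.+1 - r)] ++
              [seq (i, 2 * i + 1)%N | i <- iota l (h.+1 - l)].

Lemma mem_half_points l r h z : (z \in half_points l r h) =
  [|| z == (1, 2)%N, (z.2 == 2 * z.1.-1 + 1)%N && (r < z.1 <= h.+1)%N |
      (z.2 == 2 * z.1 + 1)%N && (l <= z.1 <= h)%N].
Proof.
case: z => x y; rewrite inE mem_cat; congr (_ || (_ || _)).
  apply/mapP/andP => [[i] + [-> ->]|[/eqP /= yE hx]].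
    by rewrite mem_iota /= eqxx ltnS; clear; lia.
  by exists x.-1; [rewrite mem_iota|congr pair]; move: hx yE => /=; clear; lia.
apply/mapP/andP => [[i] + [-> ->]|[/eqP /= yE hx]].
  by rewrite mem_iota /= eqxx; clear; lia.
by exists x; [rewrite mem_iota|congr pair]; move: hx yE => /=; clear; lia.
Qed.

Lemma size_half_points l r h : size (half_points l r h) = (1 + (h.+1 - r) + (h.+1 - l))%N.
Proof. by rewrite /= size_cat !size_map !size_iota. Qed.

Lemma half_points_uniq l r h : (0 < r)%N -> uniq (half_points l r h).
Proof.
move=> r0; rewrite cons_uniq cat_uniq !map_inj_uniq ?iota_uniq ?andbT; last 2 first.
- by move=> i j [].
- by move=> i j [].
apply/andP; split.
  rewrite mem_cat; apply/norP; split; apply/mapP => -[i _] []; clear; lia.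
apply/hasPn => z /mapP[i _ ->]; apply/mapP => -[j _ []]; clear; lia.
Qed.

(** [i / (2 * i + 1)] exceeds [u] exactly when [u.1 < i * (u.2 - 2 * u.1)], and
    [(i + 1) / (2 * i + 1)] is below [v] exactly when [v.2 - v.1 < i * (2 * v.1 - v.2)]; the
    hypotheses on [l] and [r] are these conditions at the first index. *)
Lemma half_between n u v l r h : (0 < r)%N -> (2 * h + 1 <= n)%N -> (2 <= n)%N ->
  (2 * u.1 < u.2)%N -> (v.2 < 2 * v.1)%N -> (u.1 < l * (u.2 - 2 * u.1))%N ->
  (v.2 - v.1 < r * (2 * v.1 - v.2))%N -> (v.1 <= v.2)%N ->
  all (in_between n u v) (half_points l r h).
Proof.
move=> r0 hn n2; case: u v => [a b] [c d] /= ab cd hl hr cd1.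
have [p bE] : exists p, b = (2 * a + p)%N by exists (b - 2 * a)%N; rewrite subnKC // ltnW.
have [q cE] : exists q, (2 * c = d + q)%N by exists (2 * c - d)%N; rewrite subnKC // ltnW.
have [w dE] : exists w, d = (c + w)%N by exists (d - c)%N; rewrite subnKC.
rewrite bE addKn in hl; rewrite cE addKn dE addKn in hr.
have cw : (c = w + q)%N by move: cE; rewrite dE; clear; lia.
apply/(@allP _ _ (half_points l r h)) => -[x y]; rewrite mem_half_points /=.
case/or3P=> [/eqP[-> ->]|/andP[/eqP yE /andP[rx xh]]|/andP[/eqP yE /andP[lx xh]]].
- by rewrite /in_between /good /= n2; move: ab cd; clear; lia.
- have x1 : (0 < x)%N := leq_trans r0 (ltnW rx).
  rewrite /in_between /good /= yE; case: x x1 rx xh yE => [//|x] _ rx xh yE /=.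
  have -> : coprime x.+1 (2 * x + 1).
    by have /andP[_ ] := @coprime_det x.+1 1 (2 * x + 1) 2 ltac:(lia).
  have k : (r * q <= x * q)%N by rewrite leq_mul2r -ltnS rx orbT.
  apply/and3P; split; [move: xh hn; clear; lia | move: ab; rewrite bE; clear; nia |].
  by rewrite dE cw; move: k hr; clear; nia.
have k : (l * p <= x * p)%N by rewrite leq_mul2r lx orbT.
rewrite /in_between /good /= yE; have -> : coprime x (2 * x + 1).
  by have /andP[+ _] := @coprime_det 1 x 2 (2 * x + 1) ltac:(lia).
apply/and3P; split; [move: xh hn; clear; lia | rewrite bE; move: k hl; clear; nia |].
by rewrite dE cw; move: cd; rewrite dE cw; clear; nia.
Qed.

Lemma not_both_even x y : coprime x y -> odd x || odd y.
Proof.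
apply: contraLR; rewrite negb_or -!dvdn2 => /andP[dx dy].
by apply/negP => /eqP g; have := dvdn_gcd 2 x y; rewrite dx dy g.
Qed.

Lemma double_coprime x y : y = (2 * x)%N -> coprime x y -> (x, y) = (1, 2)%N.
Proof. by move=> ->; rewrite coprimeMr => /andP[_]; rewrite /coprime gcdnn => /eqP->. Qed.

Lemma split_twice x y :
  (exists s, y = 2 * x + 2 + s)%N \/ y = (2 * x + 1)%N \/ y = (2 * x)%N \/ (2 * x = y + 1)%N \/
  exists s, (2 * x = y + 2 + s)%N.
Proof.
have [h|h] := leqP (2 * x + 2) y; first by left; exists (y - (2 * x + 2))%N; rewrite subnKC.
right; have [h'|h'] := leqP (y + 2) (2 * x); last by lia.
by do 3 right; exists (2 * x - (y + 2))%N; rewrite subnKC.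
Qed.

Lemma near_half_points n u v : (92 <= n)%N -> good n u -> good n v ->
  (u.1 < v.1)%N -> (v.2 < u.2)%N -> (v.1 <= v.2)%N ->
  (2 * u.1 < u.2)%N -> (u.2 <= 2 * u.1 + 2)%N ->
  exists L, [/\ uniq L, all (in_between n u v) L & (U n <= size L)%N].
Proof.
move=> n92 gu gv uv1 uv2 v1 hu1 hu2.
have n_eq := divn_eq n 4; have lt4 : (n %% 4 < 4)%N by rewrite ltn_mod.
pose p := (u.2 - 2 * u.1)%N; pose e := (2 * v.1 - v.2)%N; pose w := (v.2 - v.1)%N.
pose h := (n.-1 %/ 2)%N.
have hE : (n.-1 %% 2 + 2 * h = n.-1)%N by rewrite addnC mulnC -divn_eq.
have h2 : (n.-1 %% 2 < 2)%N by rewrite ltn_mod.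
have e0 : (v.2 < 2 * v.1)%N by move: uv1 uv2 hu2; clear; lia.
have e_gt0 : (0 < e)%N by rewrite subn_gt0.
have wE := divn_eq w e; have w_lt : (w %% e < e)%N by rewrite ltn_mod.
have pE := divn_eq u.1 p; have p0 : (0 < p)%N by rewrite subn_gt0.
have p_lt : (u.1 %% p < p)%N by rewrite ltn_mod.
exists (half_points (u.1 %/ p).+1 (w %/ e).+1 h); split.
- exact: half_points_uniq.
- apply: half_between => //; first by move: hE h2 n92; clear; lia.
  + exact: leq_trans n92.
  + by rewrite {1}pE -/p mulSn addnC ltn_add2r.
  + by rewrite -/w {1}wE -/e mulSn addnC ltn_add2r.
rewrite size_half_points !subSS.
have /andP[cu /andP[_ un]] := gu; have /andP[cv _] := gv.
have odd_u := not_both_even cu; have odd_v := not_both_even cv.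
suff: (U n + (u.1 %/ p + w %/ e) <= 2 * h + 1)%N.
  by clearbody h; move: (U n) (u.1 %/ p)%N (w %/ e)%N; clear; lia.
have w_small : (1 < e)%N -> (w %/ e <= w %/ 2)%N by move=> ?; apply: leq_div2l.
have w_small3 : (2 < e)%N -> (w %/ e <= w %/ 3)%N by move=> ?; apply: leq_div2l.
have w_one : e = 1%N -> (w %/ e = w)%N by move->; rewrite divn1.
have w_two : e = 2%N -> (w %/ e = w %/ 2)%N by move->.
have u_one : p = 1%N -> (u.1 %/ p = u.1)%N by move->; rewrite divn1.
have u_two : p = 2%N -> (u.1 %/ p = u.1 %/ 2)%N by move->.
have ewE : (e + 2 * w = v.2)%N by rewrite /e /w; move: e0 v1; clear; lia.
have wvE : (v.1 = w + e)%N by rewrite /e /w; move: e0 v1; clear; lia.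
have puE : (u.2 = 2 * u.1 + p)%N by rewrite /p; move: hu1; clear; lia.
move: (w %/ e)%N (u.1 %/ p)%N w_small w_small3 w_one w_two u_one u_two => x y.
move: n_eq lt4 hE h2 n92 uv1 uv2 hu2 un odd_u odd_v; rewrite /U wvE -ewE puE.
move: u.1 (n %/ 4)%N => a m; clearbody w e p h.
move: e_gt0 p0; clear => e_gt0 p0 n_eq lt4 hE h2 n92 uv1 uv2 hu2 un odd_u odd_v s2 s3 s1 s2' t1 t2.
(* [p = e = 1] contradicts the discordance, and for [p = e = 2] one of the fractions is not reduced.
   For [p <> e] in [{1, 2}] the discordance determines [w] ([a] or [a - 1]), the inequality is
   tight, and the parity of [a] decides. For [e >= 3] there is about [n / 12] to spare. *)
have {hu2} [p1|p2] : p = 1%N \/ p = 2%N by move: p0 hu2; clear; lia.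
all: have {e_gt0} [e1|[e2|e3]] : e = 1%N \/ e = 2%N \/ (2 < e)%N by move: e_gt0; clear; lia.
all: case: (n %% 4)%N n_eq lt4 => [|[|[|[|k]]]] //= n_eq _; lia.
Qed.

Lemma lower_bound n : (92 <= n)%N -> (U n <= farey_gap n)%N.
Proof.
move=> n92; apply: leq_gap; first exact: leq_trans n92.
move=> u v gu gv uv1 uv2 v1.
have [/andP[]|far] := boolP ((2 * u.1 < u.2) && (u.2 <= 2 * u.1 + 2))%N.
  exact: near_half_points.
have /andP[cu /andP[u0 un]] := gu; have /andP[_ /andP[v0 _]] := gv.
have a0 : (0 < u.1)%N.
  rewrite lt0n; apply/eqP => a0; move: cu uv2 v0; rewrite a0 /coprime gcd0n => /eqP->.
  by case: (v.2).
have [||L [uL aL sL]] := @window_main n u.1 u.2 n92 a0.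
- by rewrite un andbT; move: uv1 uv2 v1; clear; lia.
- by move: far; clear; lia.
exists L; split=> //; apply: sub_all aL => z /and3P[gz h1 h2].
rewrite /in_between gz h1 /=; have /andP[_ /andP[z0 _]] := gz.
(* [v] is at least [(u.1 + 1) / (u.2 - 1) = xi + (xi + 1) / (u.2 - 1)], where [xi] is the value of
   [u], and [u.2 <= n] makes this at least [xi + (xi + 1) / (n - 1)], the end of the window. *)
have k1 : ((n * u.1 + u.2) * v.2 <= v.1 * u.2 * (n - 1))%N.
  have [t nE] : exists t, n = (u.2 + t)%N by exists (n - u.2)%N; rewrite subnKC.
  have [s bE] : exists s, u.2 = s.+1 by exists u.2.-1; rewrite prednK.
  have le_s : (v.2 <= s)%N by rewrite -ltnS -bE.
  apply: leq_trans (leq_mul (leqnn _) le_s) _.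
  apply: leq_trans (leq_mul (leq_mul uv1 (leqnn _)) (leqnn _)).
  by rewrite nE bE; clear; nia.
have k2 : (z.1 * u.2 * (n - 1) * v.2 < (n * u.1 + u.2) * z.2 * v.2)%N by rewrite ltn_pmul2r.
have k3 : ((n * u.1 + u.2) * v.2 * z.2 <= v.1 * u.2 * (n - 1) * z.2)%N by rewrite leq_mul2r k1 orbT.
have k4 : (z.1 * v.2 * (u.2 * (n - 1)) < v.1 * z.2 * (u.2 * (n - 1)))%N.
  by move: k2 k3; clear; lia.
move: k4; rewrite ltn_pmul2r // muln_gt0 u0 subn_gt0; exact: leq_trans n92.
Qed.

(** [x / y] differs from [1/2] by [(2 * x - y) / (2 * y)], so [|2 * x - y| >= 2] puts it at distance
    at least [1 / n]. Both ends of the pair are at most that far from [1/2], except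
    [(2 * m + 1) / (4 * m)], at distance [1 / (4 * m)], which needs a parity argument. *)
Lemma upper_bound n : (8 <= n)%N -> (farey_gap n <= U n)%N.
Proof.
move=> n8.
have n_eq := divn_eq n 4; have lt4 : (n %% 4 < 4)%N by rewrite ltn_mod.
pose m := (n %/ 4)%N; pose h := (n.-1 %/ 2)%N.
have hE : (n.-1 %% 2 + 2 * h = n.-1)%N by rewrite addnC mulnC -divn_eq.
have h2 : (n.-1 %% 2 < 2)%N by rewrite ltn_mod.
have m2 : (2 <= m)%N by rewrite /m; move: n_eq lt4 n8; clear; lia.
rewrite -/m in n_eq.
have [r0|r0] := posnP (n %% 4).
  have -> : U n = size (half_points m (2 * m) h).
    by rewrite size_half_points /U r0 -/m; move: hE h2 n_eq r0 m2; clear; lia.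
  apply: (@gap_le_size n ((2 * m).-1, 4 * m) (2 * m, (4 * m).-1)%N).
  - rewrite /good; have /andP[-> _] := @coprime_det m (2 * m).-1 (2 * m).+1 (4 * m) ltac:(nia).
    by move=> /=; move: m2 n_eq; clear; lia.
  - rewrite /good; have /andP[_ ->] := @coprime_det (2 * m) 1 (4 * m).-1 2 ltac:(lia).
    by move=> /=; move: m2 n_eq; clear; lia.
  - by move=> /=; move: m2; clear; lia.
  - by move=> /=; move: m2; clear; lia.
  - by move=> /=; move: m2; clear; lia.
  move=> [x y]; rewrite mem_half_points /in_between /good /= => /and3P[/andP[cop /andP[y0 yn]] k1 k2].
  have {}yn : (y <= 4 * m)%N by move: yn n_eq r0; clear; lia.
  have hm : h.+1 = (2 * m)%N by move: hE h2 n_eq r0 m2; clear; lia.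
  case: (split_twice x y) => [[s yE]|[yE|[yE|[yE|[s xE]]]]].
  - by exfalso; move: k1 yn m2; rewrite yE; clear; nia.
  - have : (m <= x)%N by move: k1 m2; rewrite yE; clear; nia.
    by move: yn hm; rewrite yE eqxx; clear; lia.
  - by rewrite (double_coprime yE cop).
  - by exfalso; move: k2 yn m2 yE; clear; nia.
  - by exfalso; move: k2 yn m2 xE; clear; nia.
have -> : U n = size (half_points (2 * m).+1 m h).
  rewrite size_half_points /U -/m; move: hE h2 n_eq r0 m2 lt4; clear.
  by case: (n %% 4)%N => [|[|[|[|r]]]] //; lia.
apply: (@gap_le_size n (2 * m, (4 * m).+1) ((2 * m).+1, 4 * m)%N).
- rewrite /good; have /andP[-> _] := @coprime_det 1 (2 * m) 2 (4 * m).+1 ltac:(lia).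
  by move=> /=; move: m2 n_eq r0; clear; lia.
- rewrite /good; have /andP[-> _] := @coprime_det m (2 * m).+1 (2 * m).-1 (4 * m) ltac:(nia).
  by move=> /=; move: m2 n_eq r0; clear; lia.
- by move=> /=; move: m2; clear; lia.
- by move=> /=; move: m2; clear; lia.
- by move=> /=; move: m2; clear; lia.
move=> [x y]; rewrite mem_half_points /in_between /good /= => /and3P[/andP[cop /andP[y0 yn]] k1 k2].
have yn' : (y <= 4 * m + 3)%N by move: yn n_eq lt4; clear; lia.
case: (split_twice x y) => [[s yE]|[yE|[yE|[yE|[s xE]]]]].
- by exfalso; move: k1 yn' m2; rewrite yE; clear; nia.
- have : (2 * m < x)%N by move: k1; rewrite yE; clear; nia.
  by move: yn hE h2; rewrite yE eqxx; clear; lia.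
- by rewrite (double_coprime yE cop).
- have : (m < x)%N by move: k2 yE; clear; nia.
  by move: yn hE h2 yE; clear; lia.
case: s xE => [|s] xE; last by exfalso; move: k2 yn' m2 xE; clear; nia.
(* The only candidate left is [(2 * m + 2) / (4 * m + 2)], which is not reduced. *)
exfalso; have xm : (2 * m + 1 < x)%N by move: k2 xE; clear; nia.
have xE2 : x = (2 * m + 2)%N by move: xm yn' xE; clear; lia.
by move: (not_both_even cop) xE; rewrite xE2; clear; lia.
Qed.

(** * Orders below 92 *)

(* [n < u.2 + v.2] leaves no fraction of order [n] between [u] and [v]. *)
Definition adjacent (n : N) (u v : N * N) : bool :=
  N.eqb (N.mul v.1 u.2) (N.add (N.mul u.1 v.2) 1) && N.ltb n (N.add u.2 v.2).

Definition is_farey (n : N) (l : seq (N * N)) : bool :=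
  [&& if l is u :: l' then [&& u.1 == 0%num, path (adjacent n) u l' & (last u l').1 == (last u l').2]
      else false,
      all (fun z => N.leb 1 z.2 && N.leb z.2 n) l & all (fun z => N.leb z.1 z.2) l].

Definition nqval (u : N * N) : rat := qval (nat_pair u).

(** A fraction strictly between neighbours of determinant 1 is a combination of them with positive
    integral coefficients, here [m.+1] and [k.+1], so its denominator is at least [u.2 + v.2]. *)
Lemma adjacent_complete n u v z : good n z -> farey_step u v -> (n < u.2 + v.2)%N ->
  (0 < u.2)%N -> (0 < v.2)%N -> qval u < qval z -> qval v <= qval z.
Proof.
move=> /andP[_ /andP[z0 zn]] /eqP step big u0 v0; rewrite qval_lt // => uz; rewrite leNgt.
apply/negP; rewrite qval_lt // => zv.
suff le_uvz : (u.2 + v.2 <= z.2)%N by move: (leq_ltn_trans (leq_trans le_uvz zn) big); rewrite ltnn.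
clear zn big; move: u v z step uz zv z0 u0 v0 => [a b] [c d] [x y] /= det h1 h2 y0 b0 d0.
have [k kE] : exists k, (x * b = a * y + k.+1)%N by exists (x * b - a * y).-1; move: h1; clear; lia.
have [m mE] : exists m, (c * y = x * d + m.+1)%N by exists (c * y - x * d).-1; move: h2; clear; lia.
have e : (y = b * m.+1 + d * k.+1)%N.
  have e1 : (c * b * y = a * d * y + y)%N by rewrite det mulnDl mul1n.
  have e2 : (c * y * b = x * d * b + m.+1 * b)%N by rewrite mE mulnDl.
  have e3 : (x * b * d = a * y * d + k.+1 * d)%N by rewrite kE mulnDl.
  by move: e1 e2 e3; clear; lia.
by rewrite e; apply: leq_add; apply: leq_pmulr.
Qed.

Lemma is_farey_path n u l : path (adjacent n) u l ->
  path farey_step (nat_pair u) (map nat_pair l).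
Proof.
elim: l u => //= v l IHl u /andP[/andP[uv _] vl]; rewrite IHl // andbT.
by move: uv; rewrite /farey_step !nat_pairE; clear; lia.
Qed.

Lemma is_farey_good n l : is_farey n l -> {in l, forall z, good (N.to_nat n) (nat_pair z)}.
Proof.
case: l => [//|u l] /and3P[/and3P[/eqP u0 pth /eqP lst] dens le1].
have pth' := is_farey_path pth.
have densP z : z \in u :: l -> (0 < (nat_pair z).2 <= N.to_nat n)%N.
  by move=> /(allP dens); rewrite nat_pairE; clear; lia.
move=> z zl; rewrite /good densP // andbT.
case: l pth' lst le1 dens densP zl pth => [|w l] pth' lst _ _ densP zl _.
  by move: lst (densP u (mem_head _ _)); rewrite /= => <-; rewrite u0.
case/andP: pth' => uw wl; move: zl; rewrite inE => /predU1P[->|zl].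
  by case: (coprime_step uw).
exact: (path_coprime uw wl (map_f nat_pair zl)).
Qed.

(** The list is certified after its computation: ends 0 and 1 together with adjacent neighbours
    force completeness, whatever produced the list. *)
Lemma is_fareyP n l : is_farey n l -> farey (N.to_nat n) = map nqval l.
Proof.
case: l => [//|u l] ifl; have /and3P[/and3P[/eqP u0 pth /eqP lst] dens le1] := ifl.
have pth' := is_farey_path pth.
have densP z : z \in u :: l -> (0 < (nat_pair z).2 <= N.to_nat n)%N.
  by move=> /(allP dens); rewrite nat_pairE; clear; lia.
have goodP := is_farey_good ifl.
have srt : sorted <%R (map nqval (u :: l)).
  have -> : map nqval (u :: l) = map qval (map nat_pair (u :: l)) by rewrite -map_comp.
  apply: (@steps_sorted (N.to_nat n)) => //.
  by apply/(@allP _ _ (map nat_pair (u :: l))) => _ /mapP[z zl ->]; apply: densP.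
apply: (irr_sorted_eq lt_trans ltxx (farey_sorted _) srt) => x.
apply/idP/mapP => [|[z zl ->]]; last first.
  apply: qval_farey; first exact: goodP.
  by move: (allP le1 z zl); rewrite !nat_pairE; clear; lia.
move=> /fareyP[z [gz z1 ->]]; have /andP[_ /andP[z0 _]] := gz.
have le_u : nqval u <= qval z.
  by rewrite /nqval qval_le ?nat_pairE ?u0 //; case/andP: (densP u (mem_head _ _)).
have le_l : qval z <= nqval (last u l).
  rewrite /nqval qval_le //; last by case/andP: (densP _ (mem_last u l)).
  by rewrite !nat_pairE lst mulnC leq_mul2l z1 orbT.
clear ifl srt le1 dens goodP pth' lst u0.
elim: l u pth densP le_u le_l => [|w l IHl] u pth densP le_u le_l.
  by exists u; rewrite ?mem_head //; apply/eqP; rewrite eq_le le_u andbT.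
move: le_u; rewrite le_eqVlt => /predU1P[<-|lt_u]; first by exists u; rewrite ?mem_head.
case/andP: pth => /andP[uw big] wl.
have ww : w \in u :: w :: l by rewrite !inE eqxx orbT.
have le_w : nqval w <= qval z.
  apply: (adjacent_complete gz _ _ _ _ lt_u).
  - by move: uw; rewrite /farey_step !nat_pairE; clear; lia.
  - by move: big; rewrite !nat_pairE; clear; lia.
  - by case/andP: (densP u (mem_head _ _)).
  - by case/andP: (densP w ww).
have [|v vl ->] := IHl w wl _ le_w le_l; last by exists v => //; rewrite inE vl orbT.
by move=> v vl; apply: densP; rewrite inE vl orbT.
Qed.

Definition discord (u v : N * N) : bool := N.ltb u.1 v.1 && N.ltb v.2 u.2.

Fixpoint no_discord (K : nat) (l : seq (N * N)) : bool :=
  if l is u :: l' then all (fun v => ~~ discord u v) (take K l') && no_discord K l' else true.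

(** [drop K l'] starts [K + 1] places after [u], so exactly [K] terms lie between the two
    fractions. *)
Fixpoint has_discord (K : nat) (l : seq (N * N)) : bool :=
  if l is u :: l' then (if drop K l' is v :: _ then discord u v else false) || has_discord K l'
  else false.

Lemma no_discordP K l x0 i j : no_discord K l -> (i < j < size l)%N -> (j - i - 1 < K)%N ->
  ~~ discord (nth x0 l i) (nth x0 l j).
Proof.
elim: l i j => [|u l IHl] i j /=; first by rewrite ltn0 andbF.
case/andP=> ul hl; case: j => [//|j] /=; rewrite !ltnS => /andP[ij jl] hK.
case: i ij hK => [|i] ij hK /=; last first.
  apply: (IHl i j hl); [exact/andP | by move: hK; rewrite subSS].
have jK : (j < K)%N by move: hK; clear; lia.
by apply: (allP ul); rewrite -(nth_take x0 jK) mem_nth // size_take; case: ifP.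
Qed.

Lemma has_discordP K l x0 : has_discord K l ->
  exists2 i, (i + K.+1 < size l)%N & discord (nth x0 l i) (nth x0 l (i + K.+1)).
Proof.
elim: l => [//|u l IHl] /= /orP[|/IHl[i hi di]]; last by exists i.+1; rewrite ?addSn.
have [/drop_oversize->|lt_K] := leqP (size l) K; first by [].
by rewrite (drop_nth x0 lt_K) => d; exists 0%N; rewrite ?add0n.
Qed.

Lemma farey_gap_eq (n : N) l (K : nat) : (4 <= N.to_nat n)%N -> is_farey n l ->
  no_discord K l -> has_discord K l -> farey_gap (N.to_nat n) = K.
Proof.
move=> n4 fl noK hasK; have fE := is_fareyP fl; pose x0 := (0, 0)%num.
have sz : size (farey (N.to_nat n)) = size l by rewrite fE size_map.
have goodl := is_farey_good fl.
have nthl i : (i < size l)%N -> (farey (N.to_nat n))`_i = nqval (nth x0 l i).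
  by move=> il; rewrite fE (nth_map x0).
apply/eqP; rewrite eqn_leq; apply/andP; split.
  have [i hi /andP[d1 d2]] := has_discordP x0 hasK.
  have il : (i < size l)%N by apply: leq_trans hi; rewrite ltnS leq_addr.
  have gu := goodl _ (mem_nth x0 il); have gv := goodl _ (mem_nth x0 hi).
  have k1 : ((nat_pair (nth x0 l i)).1 < (nat_pair (nth x0 l (i + K.+1))).1)%N.
    by rewrite !nat_pairE; move: d1; clear; lia.
  have k2 : ((nat_pair (nth x0 l (i + K.+1))).2 < (nat_pair (nth x0 l i)).2)%N.
    by rewrite !nat_pairE; move: d2; clear; lia.
  have dis : discordant (N.to_nat n) i (i + K.+1).
    rewrite /discordant /fnum /fden addnS ltnS leq_addr -addnS !nthl //= /nqval.
    rewrite (numden_qval gu).1 (numden_qval gu).2 (numden_qval gv).1 (numden_qval gv).2.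
    by rewrite pmulr_rlt0 ?subr_gt0 ?subr_lt0 ltz_nat.
  apply: leq_trans (farey_gap_le _ dis) _; first by rewrite sz.
  by clear; lia.
have [i [j [jn dis ->]]] := farey_gap_attained n4.
have [u [v [iE jE gu gv [uv1 uv2 v1]]]] := discordant_pair jn dis.
have ij : (i < j)%N by case/andP: dis.
rewrite sz in jn; have i_n := ltn_trans ij jn.
rewrite leqNgt; apply/negP => hK.
have ij_l : (i < j < size l)%N by rewrite ij.
have := no_discordP x0 noK ij_l hK.
have uE : u = nat_pair (nth x0 l i).
  by apply: (qval_inj gu (goodl _ (mem_nth x0 i_n))); rewrite -iE nthl.
have vE : v = nat_pair (nth x0 l j).
  by apply: (qval_inj gv (goodl _ (mem_nth x0 jn))); rewrite -jE nthl.
by move: uv1 uv2; rewrite uE vE !nat_pairE /discord; clear; lia.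
Qed.

Definition small_gap (n : nat) : nat :=
  (if n \in [:: 15; 27] then U n - 2 else if n \in exceptional then U n - 1 else U n)%N.

Definition small_check (n : nat) : bool :=
  let k := N.of_nat n in let l := stern_brocot n k 0 1 1 1 [:: (1, 1)%num] in
  [&& is_farey k l, no_discord (small_gap n) l & has_discord (small_gap n) l].

Lemma small_checks : all small_check (iota 4 88).
Proof. vm_cast_no_check (erefl true). Qed.

Lemma small_gapE n : (4 <= n < 92)%N -> farey_gap n = small_gap n.
Proof.
move=> hn; have /and3P[h1 h2 h3] : small_check n.
  by apply: (allP small_checks); rewrite mem_iota.
have nK : N.to_nat (N.of_nat n) = n by clear; lia.
rewrite -[n in farey_gap n]nK; apply: farey_gap_eq h1 h2 h3.
by rewrite nK; case/andP: hn.
Qed.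

Local Close Scope ring_scope.

Theorem theorem1p3 (n : nat) (hn : 4 <= n) :
  farey_gap n =
    (if n \in [:: 15; 27] then U n - 2
     else if n \in exceptional then U n - 1
     else U n).
Proof.
have [lt_n|le_n] := ltnP n 92; first by rewrite small_gapE ?hn.
have -> : n \in [:: 15; 27] = false.
  by rewrite !inE; apply/negP; move: le_n; clear; lia.
have -> : n \in exceptional = false.
  by rewrite !inE; apply/negP; move: le_n; clear; lia.
by apply/eqP; rewrite eqn_leq upper_bound ?lower_bound // (leq_trans _ le_n).
Qed.
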